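(* Let $2O\subset SU(2)$ be the binary octahedral group of order $48$. For the round binary octahedral space $SU(2)/2O$ with the trivial spin structure, the spectrum of the canonical Dirac operator $D$ is contained in the set $\{\pm(3/2+k) : k\in\mathbb{N}\}$. For every $k\in\{0,1,\dots,23\}$ and $t\in\mathbb{Z}$, the multiplicity of $3/2+k+24t$ (as an eigenvalue of $D$, with multiplicity $0$ meaning that it is not an eigenvalue) equals $P_k(3/2+k+24t)$, where $P_k(u)=0$ if $k$ is odd, and $$P_0(u)=\tfrac{15}{32}+\tfrac{23}{24}u+\tfrac1{24}u^2,\quad P_2(u)=-\tfrac{7}{96}-\tfrac18u+\tfrac1{24}u^2,\quad P_4(u)=-\tfrac{11}{96}-\tfrac{5}{24}u+\tfrac1{24}u^2,$$ $$P_6(u)=-\tfrac{5}{32}-\tfrac{7}{24}u+\tfrac1{24}u^2,\quad P_8(u)=\tfrac{29}{96}+\tfrac58u+\tfrac1{24}u^2,\quad P_{10}(u)=-\tfrac{23}{96}-\tfrac{11}{24}u+\tfrac1{24}u^2,$$ $$P_{12}(u)=\tfrac{7}{32}+\tfrac{11}{24}u+\tfrac1{24}u^2,\quad P_{14}(u)=-\tfrac{31}{96}-\tfrac58u+\tfrac1{24}u^2,\quad P_{16}(u)=\tfrac{13}{96}+\tfrac{7}{24}u+\tfrac1{24}u^2,$$ $$P_{18}(u)=\tfrac{3}{32}+\tfrac{5}{24}u+\tfrac1{24}u^2,\quad P_{20}(u)=\tfrac{5}{96}+\tfrac18u+\tfrac1{24}u^2,\quad P_{22}(u)=-\tfrac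{47}{96}-\tfrac{23}{24}u+\tfrac1{24}u^2.$$
   Context: $\mathbb{N}=\{0,1,2,\dots\}$. Identify $SU(2)$ with the unit quaternions; $2O$ consists of the 24 elements $\pm1,\pm i,\pm j,\pm k,\tfrac12(\pm1\pm i\pm j\pm k)$ (all sign combinations) together with the 24 elements obtained from $\tfrac1{\sqrt2}(\pm1\pm i+0j+0k)$ by permuting the coordinates and taking all sign combinations. In $\mathfrak{su}(2)$ let $I=\begin{pmatrix} i&0\\0&-i\end{pmatrix}$, $J=\begin{pmatrix}0&1\\-1&0\end{pmatrix}$, $K=\begin{pmatrix}0&i\\i&0\end{pmatrix}$ (corresponding to the quaternions $i,j,k$). For a finite subgroup $\Gamma\subset SU(2)$, the round metric on $SU(2)/\Gamma=\{g\Gamma\}$ is induced by the bi-invariant metric on $SU(2)\cong S^3$ for which $X_1=I,\ X_2=J,\ X_3=K$ is an orthonormal basis (the unit 3-sphere). The trivial spin structure is the one corresponding to the lift of the isotropy representation $\Gamma\to SO(3)$ given by the inclusion $\iota:\Gamma\to SU(2)\cong\mathrm{Spin}(3)$, i.e. $SU(2)\times_\iota\mathrm{Spin}(3)$ (equivalently, writing $\mathrm{Spin}(4)=SU(2)\times SU(2)$ with $\Gamma$ acting on $S^3$ through one factor, the lift $\gamma\mapsto(\gamma,1)$). Concretely, spinor fields are the functions $\psi:SU(2)\to\mathbb{C}^2$ with $\psi(g\gamma)=\gamma^{-1}\psi(g)$ for all $\gamma\in\Gamma$, and $$D\psi = I\,(X_1\psi)+J\,(X_2\psi)+K\,(X_3\psi)-\tfrac32\,\psi,$$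 where $(X\psi)(g)=\frac{d}{dt}\big|_{t=0}\psi(g\exp(tX))$. *)

(* Defs.v *)
From HB Require Import structures.
From mathcomp Require Import all_boot all_order all_algebra.
From mathcomp Require Import all_classical all_reals all_analysis.
From mathcomp Require Import complex.
From mathcomp Require Import ring.
Set Implicit Arguments.
Unset Strict Implicit.
Unset Printing Implicit Defensive.
Import Order.TTheory GRing.Theory Num.Theory.
Import numFieldNormedType.Exports.
Local Open Scope classical_set_scope.
Local Open Scope complex_scope.
Local Open Scope ring_scope.

(* R[i] is the field of complex numbers over R; r%:C embeds R into it and
   a +i* b builds a complex number from its real and imaginary parts. *)

Definition mx2 (T : Type) (a b c d : T) : 'M[T]_2 :=
  \matrix_(i, j) if i == 0 then if j == 0 then a else b
                 else if j == 0 then c else d.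

Lemma det_mx2 (R : comNzRingType) (a b c d : R) :
  \det (mx2 a b c d) = a * d - b * c.
Proof.
rewrite (expand_det_row _ 0) !big_ord_recl big_ord0 /cofactor !det_mx11 !mxE /=.
by rewrite addr0 !add0n expr0 expr1 mul1r mulN1r mulrN.
Qed.

Definition mxI (R : realType) : 'M[R[i]]_2 := mx2 'i%C 0 0 (- 'i%C).
Definition mxJ (R : realType) : 'M[R[i]]_2 := mx2 0 1 (-1) 0.
Definition mxK (R : realType) : 'M[R[i]]_2 := mx2 0 'i%C 'i%C 0.

Definition adjmx (R : realType) (A : 'M[R[i]]_2) : 'M[R[i]]_2 :=
  (map_mx (@conjc R) A)^T.

Definition special_unitary (R : realType) : pred 'M[R[i]]_2 :=
  fun A => (A *m adjmx A == 1%:M) && (\det A == 1).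

Record SU2 (R : realType) : Type := MkSU2 {
  su2val :> 'M[R[i]]_2;
  su2valP : special_unitary su2val }.

HB.instance Definition _ (R : realType) := [isSub for @su2val R].
HB.instance Definition _ (R : realType) := [Equality of SU2 R by <:].
HB.instance Definition _ (R : realType) := [Choice of SU2 R by <:].

Lemma special_unitary_mul (R : realType) (g h : SU2 R) :
  special_unitary (g *m h).
Proof.
case: g h => [g /andP[/eqP g1 /eqP g2]] [h /andP[/eqP h1 /eqP h2]] /=.
apply/andP; split; last by rewrite det_mulmx g2 h2 mulr1.
rewrite /adjmx map_mxM trmx_mul !mulmxA -[g *m h *m _]mulmxA.
by rewrite -/(adjmx h) h1 mulmx1 -/(adjmx g) g1.
Qed.

Definition su2mul (R : realType) (g h : SU2 R) : SU2 R :=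
  MkSU2 (special_unitary_mul g h).

(* The quaternion x_0 + x_1 i + x_2 j + x_3 k as a complex matrix. *)
Definition quat (R : realType) (x : 'rV[R]_4) : 'M[R[i]]_2 :=
  (x 0 (inord 0))%:C *: 1%:M + (x 0 (inord 1))%:C *: mxI R
  + (x 0 (inord 2))%:C *: mxJ R + (x 0 (inord 3))%:C *: mxK R.

Definition row4 (R : realType) (a b c d : R) : 'rV[R]_4 :=
  \row_j nth 0 [:: a; b; c; d] j.

Lemma quat_row4 (R : realType) (a b c d : R) :
  quat (row4 a b c d) = mx2 (a +i* b) (c +i* d) (- c +i* d) (a -i* b).
Proof.
rewrite /quat !mxE !inordK //=; apply/matrixP => i j; rewrite !mxE.
by case: i j => [[|[|//]] ?] [[|[|//]] ?] /=; apply/eqP;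
  rewrite eq_complex /= ?(mulr0, mulr1, mul0r, mulrN, mulrN1, oppr0, subr0,
    addr0, add0r, opprK, mulr1n, mulr0n) !eqxx.
Qed.

Lemma special_unitary_row4 (R : realType) (a b c d : R) :
  a ^+ 2 + b ^+ 2 + c ^+ 2 + d ^+ 2 = 1 -> special_unitary (quat (row4 a b c d)).
Proof.
move=> n1; rewrite quat_row4; apply/andP; split; apply/eqP; last first.
  rewrite det_mx2; apply/eqP; rewrite eq_complex /=.
  by apply/andP; split; apply/eqP; [rewrite -n1; ring | ring].
apply/matrixP => i j; rewrite !mxE !big_ord_recl big_ord0 !mxE.
case: i j => [[|[|//]] ?] [[|[|//]] ?] /=; apply/eqP;
  rewrite eq_complex /= ?mulr1n ?mulr0n /=; apply/andP; split; apply/eqP;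
  by [ring | rewrite -n1; ring].
Qed.

(* The matrix exponential as an entrywise convergent power series; limits of
   complex sequences are taken on real and imaginary parts. *)
Definition mexp (R : realType) (A : 'M[R[i]]_2) : 'M[R[i]]_2 :=
  \matrix_(i, j)
   (limn (series (fun n => complex.Re (((n`!%:R : R)^-1)%:C * (A ^+ n) i j)))
    +i* limn (series (fun n => complex.Im (((n`!%:R : R)^-1)%:C * (A ^+ n) i j)))).

Lemma expr_mx_root (R : realType) (X : 'M[R[i]]_2) (t : R) (n : nat) :
  X *m X = - 1%:M ->
  ((n`!%:R : R)^-1)%:C *: (t%:C *: X) ^+ n
  = (cos_coeff t n)%:C *: 1%:M + (sin_coeff t n)%:C *: X.
Proof.
move=> X2.
have XX k : X ^+ k.*2 = ((-1) ^+ k)%:C *: 1%:M.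
  elim: k => [|k IH]; first by rewrite double0 !expr0 scale1r.
  rewrite doubleS !exprS IH -!mulmxE mulmxA X2 -scalemxAr mulmx1 scalerN.
  by rewrite mulN1r rmorphN scaleNr.
rewrite exprZn scalerA -rmorphXn -rmorphM /cos_coeff /sin_coeff /=.
rewrite -{3}(odd_double_half n); case: (boolP (odd n)) => on /=.
  rewrite add1n exprS XX -mulmxE -scalemxAr mulmx1 scalerA -rmorphM /=.
  rewrite !mul0r scale0r add0r !mul1r; congr (_%:C *: _).
  have -> : n.-1./2 = n./2 by rewrite -[in LHS](odd_double_half n) on /= doubleK.
  by ring.
rewrite add0n XX scalerA -rmorphM /= !mul0r scale0r addr0 mul1r.
by congr (_%:C *: _); rewrite -exprnP; ring.
Qed.

Lemma mexp_root (R : realType) (X : 'M[R[i]]_2) (t : R) :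
  X *m X = - 1%:M ->
  mexp (t%:C *: X) = (cos t)%:C *: 1%:M + (sin t)%:C *: X.
Proof.
move=> X2.
have cvgE (a b : R) :
    limn (series (fun n => cos_coeff t n * a + sin_coeff t n * b))
    = cos t * a + sin t * b.
  apply/cvg_lim => //.
  rewrite [X in X @ _ --> _](_ : _ =
    (fun n => series (cos_coeff t) n * a + series (sin_coeff t) n * b)).
    apply: cvgD; apply: cvgMr_tmp; rewrite unlock.
      exact: is_cvg_series_cos_coeff.
    exact: is_cvg_series_sin_coeff.
  by apply/funext => n; rewrite /series /= big_split /= -!mulr_suml.
have E n i j : ((n`!%:R : R)^-1)%:C * ((t%:C *: X) ^+ n) i j =
    (cos_coeff t n)%:C * (1%:M : 'M[R[i]]_2) i j + (sin_coeff t n)%:C * X i j.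
  transitivity ((((n`!%:R : R)^-1)%:C *: (t%:C *: X) ^+ n) i j).
    by rewrite [RHS]mxE.
  by rewrite expr_mx_root // [LHS]mxE; congr (_ + _); rewrite [LHS]mxE.
have ReE (c s : R) (z w : R[i]) : complex.Re (c%:C * z + s%:C * w) =
    c * complex.Re z + s * complex.Re w.
  by case: z w => [zx zy] [wx wy] /=; ring.
have ImE (c s : R) (z w : R[i]) : complex.Im (c%:C * z + s%:C * w) =
    c * complex.Im z + s * complex.Im w.
  by case: z w => [zx zy] [wx wy] /=; ring.
apply/matrixP => i j; rewrite [LHS]mxE.
transitivity ((cos t)%:C * (1%:M : 'M[R[i]]_2) i j + (sin t)%:C * X i j); last first.
  by rewrite [RHS]mxE; congr (_ + _); rewrite [RHS]mxE.
apply/eqP; rewrite eq_complex; apply/andP; split; apply/eqP.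
  rewrite [LHS]/= ReE -cvgE; congr (limn (series _)).
  by apply/funext => n; rewrite E ReE.
rewrite [LHS]/= ImE -cvgE; congr (limn (series _)).
by apply/funext => n; rewrite E ImE.
Qed.

(* The orthonormal left-invariant frame X_1 = I, X_2 = J, X_3 = K, indexed
   from 0. *)
Definition frame (R : realType) (a : 'I_3) : 'M[R[i]]_2 :=
  nth 0 [:: mxI R; mxJ R; mxK R] a.

Lemma mx2_mul (R : pzSemiRingType) (a b c d a' b' c' d' : R) :
  mx2 a b c d *m mx2 a' b' c' d' =
  mx2 (a * a' + b * c') (a * b' + b * d') (c * a' + d * c') (c * b' + d * d').
Proof.
apply/matrixP => i j; rewrite !mxE !big_ord_recl big_ord0 !mxE addr0.
by case: i j => [[|[|//]] ?] [[|[|//]] ?].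
Qed.

Lemma frame_sqr (R : realType) (a : 'I_3) : frame R a *m frame R a = - 1%:M.
Proof.
apply/matrixP => i j; case: a => [[|[|[|//]]] ?]; rewrite /frame /= mx2_mul !mxE;
by case: i j => [[|[|//]] ?] [[|[|//]] ?] /=;
  rewrite ?mulr1n ?mulr0n; apply/eqP; rewrite eq_complex /=;
  apply/andP; split; apply/eqP; ring.
Qed.

Lemma mexp_frame (R : realType) (a : 'I_3) (t : R) :
  mexp (t%:C *: frame R a) = quat (row4 (cos t) ((a == 0%N :> nat)%:R * sin t)
    ((a == 1%N :> nat)%:R * sin t) ((a == 2%N :> nat)%:R * sin t)).
Proof.
rewrite (mexp_root t (frame_sqr R a)) quat_row4; apply/matrixP => i j.
rewrite !mxE; case: a => [[|[|[|//]]] ?]; rewrite /frame /= !mxE;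
case: i j => [[|[|//]] ?] [[|[|//]] ?] /=;
  rewrite ?mulr1n ?mulr0n; apply/eqP; rewrite eq_complex /=;
  apply/andP; split; apply/eqP; ring.
Qed.

Lemma special_unitary_mexp (R : realType) (a : 'I_3) (t : R) :
  special_unitary (mexp (t%:C *: frame R a)).
Proof.
rewrite mexp_frame; apply: special_unitary_row4; rewrite -[RHS](cos2Dsin2 t).
by case: a => [[|[|[|//]]] ?] /=; ring.
Qed.

Definition exp_frame (R : realType) (a : 'I_3) (t : R) : SU2 R :=
  MkSU2 (special_unitary_mexp a t).

(* F is C^n on the open set U: the iterated partial derivatives of F up to
   order n exist and are continuous on U. *)
Fixpoint Ck (R : realType) (n : nat) (U : set 'rV[R]_4) (F : 'rV[R]_4 -> R) :
    Prop :=
  (forall x, U x -> {for x, continuous F}) /\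
  match n with
  | 0 => True
  | m.+1 => forall i : 'I_4,
      (forall x, U x -> derivable F x (delta_mx 0 i)) /\
      Ck m U (fun x => 'D_(delta_mx 0 i) F x)
  end.

(* Smoothness on SU(2), viewed as the unit sphere of the quaternions R^4: near
   each point, f is the restriction of a smooth function on an open set of
   R^4. *)
Definition smooth (R : realType) (f : SU2 R -> R) : Prop :=
  forall g : SU2 R, exists (U : set 'rV[R]_4) (F : 'rV[R]_4 -> R),
    [/\ open U,
        exists2 x, U x & quat x = g,
        forall n, Ck n U F
      & forall (x : 'rV[R]_4) (h : SU2 R), U x -> quat x = h -> F x = f h].

(* Smooth sections of the spinor bundle of SU(2)/Gamma. *)
Definition spinor_field (R : realType) (Gamma : set (SU2 R)) :
    set (SU2 R -> 'cV[R[i]]_2) :=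
  [set psi | (forall g gamma, Gamma gamma ->
                psi (su2mul g gamma) = invmx gamma *m psi g) /\
             (forall j, smooth (fun g => complex.Re (psi g j 0)) /\
                        smooth (fun g => complex.Im (psi g j 0)))].

Definition frame_deriv (R : realType) (a : 'I_3) (psi : SU2 R -> 'cV[R[i]]_2)
    (g : SU2 R) : 'cV[R[i]]_2 :=
  \col_j (derive1 (fun t : R => complex.Re (psi (su2mul g (exp_frame a t)) j 0)) 0
       +i* derive1 (fun t : R => complex.Im (psi (su2mul g (exp_frame a t)) j 0)) 0).

Definition dirac (R : realType) (psi : SU2 R -> 'cV[R[i]]_2) :
    SU2 R -> 'cV[R[i]]_2 :=
  fun g => \sum_(a < 3) frame R a *m frame_deriv a psi g
           - (3 / 2 : R)%:C *: psi g.

Lemma hopf_norm (R : realType) (eta xi1 xi2 : R) :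
  (cos eta * cos xi1) ^+ 2 + (cos eta * sin xi1) ^+ 2
  + (sin eta * cos xi2) ^+ 2 + (sin eta * sin xi2) ^+ 2 = 1.
Proof.
rewrite !exprMn -mulrDr cos2Dsin2 mulr1 -addrA -mulrDr cos2Dsin2 mulr1.
exact: cos2Dsin2.
Qed.

(* Hopf coordinates on the 3-sphere; the first row of the matrix is
   (cos eta * exp(i xi1), sin eta * exp(i xi2)). *)
Definition hopf (R : realType) (eta xi1 xi2 : R) : SU2 R :=
  MkSU2 (special_unitary_row4 (hopf_norm eta xi1 xi2)).

(* Integration against the Riemannian volume of the unit 3-sphere, which is
   sin eta * cos eta in Hopf coordinates (total mass 2 * pi^2). *)
Definition su2_integral (R : realType) (f : SU2 R -> R) : R :=
  let mu := @lebesgue_measure R in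
  \int[mu]_(eta in `[0, pi / 2]%classic) (sin eta * cos eta *
    \int[mu]_(xi1 in `[0, pi *+ 2]%classic)
    \int[mu]_(xi2 in `[0, pi *+ 2]%classic) f (hopf eta xi1 xi2)).

(* For a finite Gamma this is #|Gamma| times the squared L^2 norm over
   SU(2)/Gamma; the constant factor does not affect the spectrum. *)
Definition L2norm2 (R : realType) (psi : SU2 R -> 'cV[R[i]]_2) : R :=
  su2_integral (fun g =>
    \sum_(j < 2) (complex.Re (psi g j 0) ^+ 2 + complex.Im (psi g j 0) ^+ 2)).

(* The resolvent set of the Dirac operator as an operator in the Hilbert space
   of L^2 spinor fields with the smooth ones as domain: D - lambda has a bounded
   inverse on its range, and this range is dense.  (Smooth spinor fields are
   dense, so approximating these suffices.) *)
Definition dirac_resolvent (R : realType) (Gamma : set (SU2 R)) : set R[i] :=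
  [set lambda |
    (exists2 c : R, 0 < c & forall psi, spinor_field Gamma psi ->
       c * L2norm2 psi <= L2norm2 (dirac psi - lambda *: psi)) /\
    (forall phi, spinor_field Gamma phi -> forall e : R, 0 < e ->
       exists2 psi, spinor_field Gamma psi &
         L2norm2 (dirac psi - lambda *: psi - phi) < e)].

Definition dirac_spectrum (R : realType) (Gamma : set (SU2 R)) : set R[i] :=
  ~` dirac_resolvent Gamma.

Definition dirac_eigenspace (R : realType) (Gamma : set (SU2 R))
    (lambda : R[i]) : set (SU2 R -> 'cV[R[i]]_2) :=
  [set psi | spinor_field Gamma psi /\ dirac psi = lambda *: psi].

(* The complex dimension of the eigenspace is m. *)
Definition dirac_multiplicity (R : realType) (Gamma : set (SU2 R))
    (lambda : R[i]) (m : nat) : Prop :=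
  exists e : 'I_m -> (SU2 R -> 'cV[R[i]]_2),
    [/\ forall i, dirac_eigenspace Gamma lambda (e i),
        forall c : 'I_m -> R[i], \sum_i c i *: e i = 0 -> forall i, c i = 0
      & forall psi, dirac_eigenspace Gamma lambda psi ->
          exists c : 'I_m -> R[i], psi = \sum_i c i *: e i].

Definition binary_octahedral_quat (R : realType) (x : 'rV[R]_4) : Prop :=
  [\/ exists (i : 'I_4) (s : bool), x = (-1) ^+ s *: delta_mx 0 i,
      forall i : 'I_4, x 0 i = 1 / 2 \/ x 0 i = - (1 / 2)
    | exists (i j : 'I_4) (s t : bool), i != j /\
        x = (Num.sqrt 2)^-1 *:
              ((-1) ^+ s *: delta_mx 0 i + (-1) ^+ t *: delta_mx 0 j)].

Definition binary_octahedral (R : realType) : set (SU2 R) :=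
  [set g | exists2 x : 'rV[R]_4, binary_octahedral_quat x & quat x = g].

Definition octahedral_poly (R : realType) (k : nat) (u : R) : R :=
  match k with
  | 0 => 15 / 32 + 23 / 24 * u + 1 / 24 * u ^+ 2
  | 2 => - (7 / 96) - 1 / 8 * u + 1 / 24 * u ^+ 2
  | 4 => - (11 / 96) - 5 / 24 * u + 1 / 24 * u ^+ 2
  | 6 => - (5 / 32) - 7 / 24 * u + 1 / 24 * u ^+ 2
  | 8 => 29 / 96 + 5 / 8 * u + 1 / 24 * u ^+ 2
  | 10 => - (23 / 96) - 11 / 24 * u + 1 / 24 * u ^+ 2
  | 12 => 7 / 32 + 11 / 24 * u + 1 / 24 * u ^+ 2
  | 14 => - (31 / 96) - 5 / 8 * u + 1 / 24 * u ^+ 2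
  | 16 => 13 / 96 + 7 / 24 * u + 1 / 24 * u ^+ 2
  | 18 => 3 / 32 + 5 / 24 * u + 1 / 24 * u ^+ 2
  | 20 => 5 / 96 + 1 / 8 * u + 1 / 24 * u ^+ 2
  | 22 => - (47 / 96) - 23 / 24 * u + 1 / 24 * u ^+ 2
  | _ => 0
  end.

(* Main.v *)
(* For a row sigma and a column tau put r = sigma g. The spinors (r tau)^n r^perp
   and (r tau)^n tau on SU(2) are eigenspinors of D, with eigenvalues n + 3/2 and
   -(n + 3/2). Together they span the spinors polynomial in the entries of g,
   which are uniformly dense by Bernstein approximation on R^4, and D is
   symmetric. Hence for any other lambda Pythagoras bounds the inverse of
   D - lambda, whose range is dense, also among the equivariant spinors after
   averaging over Gamma; and every smooth eigenspinor lies in the corresponding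
   span.

   This span is the tensor product of C^(e + 1), on which Gamma acts trivially,
   and of the space of binary forms of degree d, where e = d + 1 for the
   eigenvalue d + 3/2 and e = d - 1 for -(d + 1/2). Its equivariant elements are
   counted by e + 1 times the dimension of the Gamma-invariant forms, i.e. the
   trace of the averaging projector, which is the mean over Gamma of U_d(tr / 2)
   for the Chebyshev polynomials U_d. For 2O the traces are 2, -2, 0, 1, -1,
   sqrt 2 and - sqrt 2; only the first two contribute a part that is not periodic
   in d modulo 24. *)
Require Import Defs.
From mathcomp Require Import all_boot all_order all_algebra.
From mathcomp Require Import all_classical all_reals all_analysis.
From mathcomp Require Import complex.
From mathcomp Require Import ring lra.
Set Implicit Arguments.
Unset Strict Implicit.
Unset Printing Implicit Defensive.
Import Order.TTheory GRing.Theory Num.Theory.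
Import numFieldNormedType.Exports.
Local Open Scope classical_set_scope.
Local Open Scope complex_scope.
Local Open Scope ring_scope.

(** * Coordinates on SU(2) *)

(** Integration is defined by a formula in Hopf coordinates, which hides its invariance, whereas
    symmetry of D requires every [X_a f] to have integral 0, and that rests on invariance under
    right translations. Invariance is recovered algebraically: [(sigma g tau)^n] with [n > 0] has
    integral 0, a right translation only changes tau, and such powers span a uniformly dense space.
    No L^2 space is completed: the estimates concern finite sums of eigenspinors, and completing a
    square takes the place of a convergent expansion. The generators are powers, so that group
    actions are visible on them; other elements are reached by polarisation, with Vandermonde
    inversion in place of differentiation in a parameter. Counting dimensions needs coordinates. An
    eigenspinor is recorded by a matrix with [e + 1] rows, each of them a binary form of degree [d];
    translation by a group element multiplies it from the right by a symmetric power of that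
    element. The matrix is unique because a homogeneous polynomial identity on SU(2) extends to all
    complex 2 x 2 matrices, where those of rank one separate the rows. *)

Definition co (R : realType) (M : 'M[R[i]]_2) : 'rV[R]_4 :=
  row4 (complex.Re (M 0 0)) (complex.Im (M 0 0))
       (complex.Re (M 0 1)) (complex.Im (M 0 1)).

(** [rowL] and [rowR] are the entries of the row vector [(s, t) M], and [bil] is its pairing with
    the column [(x, y)]. *)
Definition rowL (R : realType) (s t : R[i]) (M : 'M[R[i]]_2) : R[i] :=
  s * M 0 0 + t * M 1 0.
Definition rowR (R : realType) (s t : R[i]) (M : 'M[R[i]]_2) : R[i] :=
  s * M 0 1 + t * M 1 1.
Definition bil (R : realType) (s t x y : R[i]) (M : 'M[R[i]]_2) : R[i] :=
  rowL s t M * x + rowR s t M * y.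

Definition col2 (T : Type) (a b : T) : 'cV[T]_2 :=
  \matrix_(i, j) if i == 0 then a else b.

Section Coordinates.
Variable R : realType.
Local Notation C := R[i].
Implicit Types (g h : SU2 R) (M : 'M[C]_2).

Lemma ord2P (P : 'I_2 -> Prop) : P 0 -> P 1 -> forall i, P i.
Proof.
move=> P0 P1 [[|[|//]] h].
  by rewrite (_ : Ordinal h = 0) //; apply: val_inj.
by rewrite (_ : Ordinal h = 1) //; apply: val_inj.
Qed.

Lemma matrix2P (M N : 'M[C]_2) :
  M 0 0 = N 0 0 -> M 0 1 = N 0 1 -> M 1 0 = N 1 0 -> M 1 1 = N 1 1 -> M = N.
Proof. by move=> *; apply/matrixP; apply: ord2P; apply: ord2P. Qed.

Lemma col2P (u v : 'cV[C]_2) : u 0 0 = v 0 0 -> u 1 0 = v 1 0 -> u = v.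
Proof. by move=> *; apply/matrixP => i j; rewrite (ord1 j); move: i; apply: ord2P. Qed.

Lemma col2_0 (a b : C) : col2 a b 0 0 = a. Proof. by rewrite mxE. Qed.
Lemma col2_1 (a b : C) : col2 a b 1 0 = b. Proof. by rewrite mxE. Qed.

Lemma mulmx2E (M N : 'M[C]_2) (a b : 'I_2) :
  (M *m N) a b = M a 0 * N 0 b + M a 1 * N 1 b.
Proof.
rewrite mxE !big_ord_recl big_ord0 addr0; congr (_ + M _ _ * N _ _); exact: val_inj.
Qed.

Lemma mulmx_col2E (M : 'M[C]_2) (v : 'cV[C]_2) (a : 'I_2) :
  (M *m v) a 0 = M a 0 * v 0 0 + M a 1 * v 1 0.
Proof.
rewrite mxE !big_ord_recl big_ord0 addr0; congr (_ + M _ _ * v _ _); exact: val_inj.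
Qed.

Lemma mx2_00 (T : Type) (a b c d : T) : mx2 a b c d 0 0 = a. Proof. by rewrite mxE. Qed.
Lemma mx2_01 (T : Type) (a b c d : T) : mx2 a b c d 0 1 = b. Proof. by rewrite mxE. Qed.
Lemma mx2_10 (T : Type) (a b c d : T) : mx2 a b c d 1 0 = c. Proof. by rewrite mxE. Qed.
Lemma mx2_11 (T : Type) (a b c d : T) : mx2 a b c d 1 1 = d. Proof. by rewrite mxE. Qed.
Definition mx2E := (mx2_00, mx2_01, mx2_10, mx2_11).

Lemma mx2_eta M : M = mx2 (M 0 0) (M 0 1) (M 1 0) (M 1 1).
Proof. by apply: matrix2P; rewrite mx2E. Qed.

Lemma det2E M : \det M = M 0 0 * M 1 1 - M 0 1 * M 1 0.
Proof. by rewrite {1}[M]mx2_eta det_mx2. Qed.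

Lemma su2_det g : g 0 0 * g 1 1 - g 0 1 * g 1 0 = 1.
Proof. by rewrite -det2E; case: g => g /= /andP[_ /eqP]. Qed.

Lemma su2_unit g : (g : 'M[C]_2) \in unitmx.
Proof. by rewrite unitmxE det2E su2_det unitr1. Qed.

Lemma su2_rows g (a b : 'I_2) :
  g a 0 * conjc (g b 0) + g a 1 * conjc (g b 1) = (a == b)%:R.
Proof.
case: g => g /= /andP[/eqP /matrixP /(_ a b) + _].
by rewrite mulmx2E !mxE.
Qed.

(** The inverse is both the adjugate and the adjoint. Multiplying the two sides by the squared norm
    of the first row and by the determinant, both equal to 1, leaves a multiple of the inner product
    of the rows. *)
Lemma su2_11 g : g 1 1 = conjc (g 0 0).
Proof.
have h := su2_rows g 0 0; have k := su2_rows g 1 0; have d := su2_det g.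
move: h k; rewrite /= => h k.
rewrite -[LHS]mulr1 -[X in _ * X]h -[RHS]mulr1 -d.
apply/eqP; rewrite -subr_eq0; apply/eqP.
transitivity (g 0 1 * (g 1 0 * conjc (g 0 0) + g 1 1 * conjc (g 0 1))); first by ring.
by rewrite k mulr0.
Qed.

Lemma su2_10 g : g 1 0 = - conjc (g 0 1).
Proof.
have h := su2_rows g 0 0; have k := su2_rows g 1 0; have d := su2_det g.
move: h k; rewrite /= => h k.
rewrite -[LHS]mulr1 -[X in _ * X]h -[RHS]mulr1 -d.
apply/eqP; rewrite -subr_eq0; apply/eqP.
transitivity (g 0 0 * (g 1 0 * conjc (g 0 0) + g 1 1 * conjc (g 0 1))); first by ring.
by rewrite k mulr0.
Qed.

Lemma quatK (x : 'rV[R]_4) : co (quat x) = x.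
Proof.
have -> : x = row4 (x 0 (inord 0)) (x 0 (inord 1)) (x 0 (inord 2)) (x 0 (inord 3)).
  apply/rowP => j; rewrite mxE -[in LHS](inord_val j).
  by case: j => [[|[|[|[|]]]] ?].
by rewrite quat_row4 /co !mx2E.
Qed.

(** The second row of an element of SU(2) is determined by the first, so [co], which reads only the
    first row, loses nothing. *)
Lemma coK g : quat (co g) = g.
Proof.
rewrite /co quat_row4; apply: matrix2P; rewrite mx2E ?su2_10 ?su2_11.
- by case: (g 0 0).
- by case: (g 0 1).
- by case: (g 0 1) => a b /=; apply/eqP; rewrite eq_complex /= opprK !eqxx.
- by case: (g 0 0).
Qed.

Lemma su2_inj g h : (g : 'M[C]_2) = h -> g = h.
Proof. by move=> e; apply: val_inj. Qed.

Lemma row4E (a b c d : R) : (row4 a b c d 0 (inord 0) = a) * (row4 a b c d 0 (inord 1) = b)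
  * (row4 a b c d 0 (inord 2) = c) * (row4 a b c d 0 (inord 3) = d).
Proof. by rewrite !mxE !inordK. Qed.

Definition sqn (x : 'rV[R]_4) : R := x 0 (inord 0) ^+ 2 + x 0 (inord 1) ^+ 2 +
  x 0 (inord 2) ^+ 2 + x 0 (inord 3) ^+ 2.

Lemma sqn_co g : sqn (co g) = 1.
Proof.
have := su2_rows g 0 0; rewrite /= => h.
rewrite /sqn /co !row4E; case: (g 0 0) (g 0 1) h => a b [c d] /=.
move/eqP; rewrite eq_complex /= => /andP[/eqP h _]; rewrite -h; ring.
Qed.

Lemma row4_eta (x : 'rV[R]_4) :
  x = row4 (x 0 (inord 0)) (x 0 (inord 1)) (x 0 (inord 2)) (x 0 (inord 3)).
Proof.
apply/rowP => j; rewrite mxE -[in LHS](inord_val j).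
by case: j => [[|[|[|[|]]]] ?].
Qed.

Lemma special_unitary_sqn x : sqn x = 1 -> special_unitary (quat x).
Proof. by move=> h; rewrite [x]row4_eta; apply: special_unitary_row4. Qed.

Lemma special_unitary_1 : special_unitary (1%:M : 'M[C]_2).
Proof.
apply/andP; split; last by rewrite det1.
by rewrite /adjmx map_mx1 trmx1 mulmx1.
Qed.

Definition one2 : SU2 R := MkSU2 special_unitary_1.

(** A total inverse of [co], so that continuity on SU(2) can be expressed by the topology of R^4.
    The value off the unit sphere is arbitrary: continuity is only asked within the sphere. *)
Definition pt (x : 'rV[R]_4) : SU2 R :=
  match pselect (sqn x = 1) with
  | left h => MkSU2 (special_unitary_sqn h)
  | right _ => one2
  end.

Lemma ptE x : sqn x = 1 -> (pt x : 'M[C]_2) = quat x.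
Proof. by rewrite /pt; case: pselect. Qed.

Lemma pt_co g : pt (co g) = g.
Proof. by apply: su2_inj; rewrite ptE ?sqn_co // coK. Qed.

Lemma co_pt x : sqn x = 1 -> co (pt x) = x.
Proof. by move=> h; rewrite ptE // quatK. Qed.

Lemma su2mulE g h : (su2mul g h : 'M[C]_2) = (g : 'M[C]_2) *m h.
Proof. by []. Qed.

Lemma bil_mul s t x y (M N : 'M[C]_2) :
  bil s t x y (M *m N) = bil s t (N 0 0 * x + N 0 1 * y) (N 1 0 * x + N 1 1 * y) M.
Proof. by rewrite /bil /rowL /rowR !mulmx2E; ring. Qed.

Lemma bilDl s t s' t' x y M :
  bil (s + s') (t + t') x y M = bil s t x y M + bil s' t' x y M.
Proof. by rewrite /bil /rowL /rowR; ring. Qed.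

Lemma bilDr s t x y x' y' M :
  bil s t (x + x') (y + y') M = bil s t x y M + bil s t x' y' M.
Proof. by rewrite /bil; ring. Qed.

Lemma bilZl u s t x y M : bil (u * s) (u * t) x y M = u * bil s t x y M.
Proof. by rewrite /bil /rowL /rowR; ring. Qed.

Lemma bilZr u s t x y M : bil s t (u * x) (u * y) M = u * bil s t x y M.
Proof. by rewrite /bil; ring. Qed.

(** Multiplicativity of the determinant for the product of the matrix with rows [(s, t)] and
    [(s', t')], of [g], and of the matrix with columns [(x, y)] and [(x', y')]; [g] contributes
    1. *)
Lemma bil_swap s t s' t' x y x' y' g :
  bil s t x y g * bil s' t' x' y' g - bil s' t' x y g * bil s t x' y' g =
  (s * t' - t * s') * (x * y' - y * x').
Proof.
have d := su2_det g; rewrite -[RHS]mulr1 -d /bil /rowL /rowR; ring.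
Qed.

End Coordinates.

(** * Extracting coefficients by Vandermonde inversion *)

Section Vandermonde.
Variable R : realType.
Local Notation C := R[i].

Lemma natr_inj_C (i j : nat) : (i%:R : C) = j%:R -> i = j.
Proof. by move/eqP; rewrite eqr_nat => /eqP. Qed.

(** The weights are the entries of the inverse Vandermonde matrix at the nodes 0, ..., N, which are
    distinct in characteristic 0. They read off a coefficient of a polynomial of degree at most N
    from its values there. *)
Lemma vandermonde_weights (N : nat) : exists w : nat -> nat -> C,
  forall k l, (k <= N)%N -> (l <= N)%N ->
    \sum_(j < N.+1) w k j * (j%:R) ^+ l = (l == k)%:R.
Proof.
pose a : 'rV[C]_N.+1 := \row_j (j%:R).
pose V := Vandermonde N.+1 a.
have uV : V \in unitmx.
  rewrite unitmxE det_Vandermonde unitfE prodf_seq_neq0.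
  apply/allP => i _; apply/implyP => _; rewrite prodf_seq_neq0.
  apply/allP => j _; apply/implyP => ij; rewrite !mxE subr_eq0.
  by apply/eqP => /natr_inj_C e; rewrite e ltnn in ij.
exists (fun k j => (invmx V) (inord j) (inord k)) => k l kN lN.
have := mulmxV uV; move/matrixP => /(_ (inord l) (inord k)).
rewrite !mxE -val_eqE /= !inordK // => <-.
by apply: eq_bigr => j _; rewrite inord_val !mxE inordK // mulrC.
Qed.

(** Each coefficient is a fixed linear combination of the values at [u = 0, ..., N], so it stays in
    any linear subspace that contains the values. This replaces differentiation in [u] wherever a
    form is polarised. *)
Lemma vandermonde_components (V : lmodType C) (X : Type) (S : (X -> V) -> Prop)
  (N : nat) (f : nat -> X -> V) :
  (S (fun=> 0)) ->
  (forall h1 h2, S h1 -> S h2 -> S (fun x => h1 x + h2 x)) ->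
  (forall c h, S h -> S (fun x => c *: h x)) ->
  (forall u : C, S (fun x => \sum_(k < N.+1) u ^+ k *: f k x)) ->
  forall k, (k <= N)%N -> S (f k).
Proof.
move=> S0 SD SZ Sf k kN.
have [w hw] := vandermonde_weights N.
have Ssum m (h : nat -> X -> V) : (forall j, S (h j)) -> S (fun x => \sum_(j < m) h j x).
  move=> hS; elim: m => [|m IH].
    by rewrite (_ : (fun _ => _) = fun=> 0) //; apply/funext => x; rewrite big_ord0.
  rewrite (_ : (fun _ => _) = fun x => \sum_(j < m) h j x + h m x); first exact: SD.
  by apply/funext => x; rewrite big_ord_recr.
have -> : f k = fun x => \sum_(j < N.+1)
    (fun j x => w k j *: (\sum_(l < N.+1) j%:R ^+ l *: f l x)) j x.
  apply/funext => x /=.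
  transitivity (\sum_(l < N.+1) (\sum_(j < N.+1) w k j * j%:R ^+ l) *: f l x).
    rewrite (bigD1 (inord k)) //= hw ?inordK // eqxx scale1r big1 ?addr0 // => l lk.
    rewrite hw //; last by rewrite -ltnS ltn_ord.
    case: eqP => [e|_]; last by rewrite scale0r.
    by move: lk; rewrite -val_eqE /= inordK // e eqxx.
  rewrite (eq_bigr (fun l : 'I_N.+1 => \sum_(j < N.+1) (w k j * j%:R ^+ l) *: f l x));
    last by move=> l _; rewrite scaler_suml.
  rewrite exchange_big /=; apply: eq_bigr => j _.
  by rewrite scaler_sumr; apply: eq_bigr => l _; rewrite scalerA.
by apply: (Ssum N.+1 (fun j x => w k j *: (\sum_(l < N.+1) j%:R ^+ l *: f l x))) => j; apply: SZ.
Qed.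

End Vandermonde.

(* The polynomials in the matrix entries, as the span of the (sigma g tau)^n. *)
Inductive trig (R : realType) : (SU2 R -> R[i]) -> Prop :=
| trig0 : trig (fun=> 0)
| trigG n s t x y : trig (fun g : SU2 R => bil s t x y g ^+ n)
| trigD f h : trig f -> trig h -> trig (fun g => f g + h g)
| trigZ c f : trig f -> trig (fun g => c * f g).

Section Trig.
Variable R : realType.
Local Notation C := R[i].

Lemma trig_eq (f h : SU2 R -> C) : f =1 h -> trig f -> trig h.
Proof. by move/funext => ->. Qed.

Lemma trig_components N (f : nat -> SU2 R -> C) :
  (forall u : C, trig (fun g => \sum_(k < N.+1) u ^+ k * f k g)) ->
  forall k, (k <= N)%N -> trig (f k).
Proof.
apply: (@vandermonde_components R (C^o) (SU2 R) (@trig R)).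
- exact: trig0.
- exact: trigD.
- exact: trigZ.
Qed.

Lemma trig_cst c : trig (fun=> c : C).
Proof.
apply: (trig_eq _ (trigZ c (trigG 0 0 0 0 0))) => g.
by rewrite expr0 mulr1.
Qed.

Definition polar_coef (A A' B B' : C) (n k : nat) : C :=
  A ^+ (n - k) * A' ^+ k *+ 'C(n, k) * B +
  (if k is k'.+1 then A ^+ (n - k') * A' ^+ k' *+ 'C(n, k') * B' else 0).

Lemma polar_expand (A A' B B' v : C) n :
  (A + v * A') ^+ n * (B + v * B') =
  \sum_(k < n.+2) v ^+ k * polar_coef A A' B B' n k.
Proof.
rewrite mulrDr exprDn.
under [RHS]eq_bigr do rewrite mulrDr.
rewrite big_split /=; congr (_ + _).
  rewrite [RHS]big_ord_recr /= bin_small // mulr0n mul0r mulr0 addr0 mulr_suml.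
  apply: eq_bigr => k _; rewrite exprMn !mulrnAl mulrnAr; congr (_ *+ _); ring.
rewrite [RHS]big_ord_recl /= mulr0 add0r mulr_suml.
apply: eq_bigr => k _; rewrite /bump /= add1n exprMn exprS !mulrnAl mulrnAr; congr (_ *+ _); ring.
Qed.

(** First polarisation, in the row: the coefficient of [u] in the power [n.+1] when [(s, t)] moves
    along [(s', t')]. *)
Lemma trig_polar1 n s t x y s' t' :
  trig (fun g : SU2 R => bil s t x y g ^+ n * bil s' t' x y g).
Proof.
pose f k (g : SU2 R) :=
  bil s t x y g ^+ (n.+1 - k) * bil s' t' x y g ^+ k *+ 'C(n.+1, k).
have h u : trig (fun g : SU2 R => \sum_(k < n.+2) u ^+ k * f k g).
  apply: trig_eq (trigG n.+1 (s + u * s') (t + u * t') x y) => g.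
  rewrite bilDl bilZl exprDn; apply: eq_bigr => k _.
  by rewrite /f exprMn mulrnAr; congr (_ *+ _); ring.
have := trigZ (n.+1%:R^-1) (trig_components h (isT : (1 <= n.+1)%N)).
apply: trig_eq => g; rewrite /f bin1 subn1 expr1 /=.
by rewrite -[(_ * _) *+ _]mulr_natr mulrC mulfK ?pnatr_eq0.
Qed.

(** Second polarisation, in the column: the coefficient of [u] when [(x, y)] moves along [(x', y')]
    in [trig_polar1]. *)
Lemma trig_polar n s t x y s' t' x' y' :
  trig (fun g : SU2 R => bil s t x y g ^+ n * bil s' t' x' y' g
    + n%:R * (bil s t x y g ^+ n.-1 * bil s t x' y' g * bil s' t' x y g)).
Proof.
pose f k (g : SU2 R) := polar_coef (bil s t x y g) (bil s t x' y' g)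
  (bil s' t' x y g) (bil s' t' x' y' g) n k.
have h u : trig (fun g : SU2 R => \sum_(k < n.+2) u ^+ k * f k g).
  apply: trig_eq (trig_polar1 n s t (x + u * x') (y + u * y') s' t') => g.
  by rewrite !bilDr !bilZr polar_expand.
have := trig_components h (isT : (1 <= n.+1)%N).
apply: trig_eq => g; rewrite /f /polar_coef bin1 bin0 subn0 subn1 expr1 expr0.
by rewrite -mulr_natr; ring.
Qed.

(** By [bil_swap] the second term of [trig_polar] is [n] times the desired product, up to a constant
    times the power [n.-1]; division by [n.+1] isolates the product. This is the Clebsch-Gordan
    splitting into degrees [n.+1] and [n.-1]. *)
Lemma trig_mul_bil f s' t' x' y' : trig f ->
  trig (fun g : SU2 R => f g * bil s' t' x' y' g).
Proof.
elim => [|n s t x y|f1 f2 _ h1 _ h2|c f1 _ h1].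
- by apply: trig_eq (@trig0 R) => g; rewrite mul0r.
- have := trigZ n.+1%:R^-1 (trigD (trig_polar n s t x y s' t' x' y')
    (trigZ (n%:R * ((s * t' - t * s') * (x * y' - y * x'))) (trigG n.-1 s t x y))).
  apply: trig_eq => g; rewrite -(bil_swap s t s' t' x y x' y' g).
  have n1 : n.+1%:R != 0 :> C by rewrite pnatr_eq0.
  apply: (mulfI n1); rewrite (mulVKf n1).
  by case: n {n1} => [|n] /=; rewrite ?exprS -?natr1; ring.
- by apply: trig_eq (trigD h1 h2) => g; rewrite mulrDl.
- by apply: trig_eq (trigZ c h1) => g; rewrite mulrA.
Qed.

End Trig.

(** * Continuity and integration *)

Definition sint (R : realType) (a b : R) (f : R -> R) : R :=
  \int[@lebesgue_measure R]_(x in `[a, b]%classic) f x.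

Section IntervalIntegral.
Variable R : realType.
Implicit Types (a b : R) (f g : R -> R).
Local Notation mu := (@lebesgue_measure R).

Lemma continuous_integrable a b f : continuous f ->
  mu.-integrable `[a, b]%classic (EFin \o f).
Proof.
move=> cf; apply: (@continuous_compact_integrable R f `[a, b]%classic).
  exact: segment_compact.
exact: continuous_subspaceT.
Qed.

Lemma continuous_add f g : continuous f -> continuous g -> continuous (fun x => f x + g x).
Proof. by move=> cf cg x; apply: cvgD; [exact: cf|exact: cg]. Qed.

Lemma continuous_mul f g : continuous f -> continuous g -> continuous (fun x => f x * g x).
Proof. by move=> cf cg x; apply: cvgM; [exact: cf|exact: cg]. Qed.

Lemma continuous_cst (c : R) : continuous (fun _ : R => c).
Proof. by move=> x; apply: cvg_cst. Qed.

Lemma continuous_scale (c : R) f : continuous f -> continuous (fun x => c * f x).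
Proof. by move=> cf; apply: continuous_mul cf; exact: continuous_cst. Qed.

Lemma sintD a b f g : continuous f -> continuous g ->
  sint a b (fun x => f x + g x) = sint a b f + sint a b g.
Proof.
by move=> cf cg; apply: RintegralD => //; exact: continuous_integrable.
Qed.

Lemma sintZ a b c f : continuous f -> sint a b (fun x => c * f x) = c * sint a b f.
Proof. by move=> cf; apply: RintegralZl => //; exact: continuous_integrable. Qed.

Lemma sint_le a b f g : continuous f -> continuous g ->
  (forall x, a <= x <= b -> f x <= g x) -> sint a b f <= sint a b g.
Proof.
move=> cf cg fg; apply: le_Rintegral => //; exact: continuous_integrable.
Qed.

Lemma sint_ge0 a b f : (forall x, a <= x <= b -> 0 <= f x) -> 0 <= sint a b f.
Proof. by move=> f0; apply: Rintegral_ge0 => x /=; rewrite in_itv /=; apply: f0. Qed.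

Lemma sint_cst a b c : a <= b -> sint a b (fun=> c) = c * (b - a).
Proof.
move=> ab; rewrite /sint Rintegral_cst //.
have m : mu `[a, b]%classic = (if (a%:E < b%:E)%E then (b - a)%:E else 0%E).
  exact: (lebesgue_measure_itv `[a, b]).
transitivity (c * fine (mu `[a, b]%classic)) => //.
rewrite m lte_fin.
case: ltP => [//|ba] /=.
have -> : a = b by apply/eqP; rewrite eq_le ab.
by rewrite subrr mulr0.
Qed.

Lemma sint_eq a b f g : (forall x, a <= x <= b -> f x = g x) -> sint a b f = sint a b g.
Proof.
move=> fg; apply: eq_Rintegral => x /set_mem /=; rewrite in_itv /= => h; exact: fg.
Qed.

Lemma sint_close a b f g e : a <= b -> continuous f -> continuous g ->
  (forall x, a <= x <= b -> `|f x - g x| <= e) ->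
  `|sint a b f - sint a b g| <= e * (b - a).
Proof.
move=> ab cf cg fg.
have h (u v : R -> R) : continuous u -> continuous v ->
    (forall x, a <= x <= b -> `|u x - v x| <= e) ->
    sint a b u - sint a b v <= e * (b - a).
  move=> cu cv uv; rewrite lerBlDl -sint_cst // -sintD //; last exact: continuous_cst.
  apply: sint_le => //; first by apply: continuous_add => //; exact: continuous_cst.
  by move=> x /uv /ler_normlW; rewrite lerBlDl.
rewrite ler_norml lerNl opprB !h // => x /fg; by rewrite distrC.
Qed.

Lemma sint_FTC a b f (F : R -> R) : a < b -> continuous f ->
  (forall x : R, is_derive x 1 F (f x)) -> sint a b f = F b - F a.
Proof.
move=> ab cf dF; rewrite /sint /Rintegral (@continuous_FTC2 R f F) //.
- exact: continuous_subspaceT.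
- have cF x : {for x, continuous F}.
    by apply: differentiable_continuous; apply/derivable1_diffP.
  split => //.
  + exact/cvg_at_right_filter/cF.
  + exact/cvg_at_left_filter/cF.
- by move=> x _; rewrite derive1E; exact: derive_val.
Qed.

Lemma sint_eq0 a b f : a < b -> continuous f -> (forall x, a <= x <= b -> 0 <= f x) ->
  sint a b f = 0 -> forall x, a < x < b -> f x = 0.
Proof.
move=> ab cf f0 i0 x /andP[ax xb].
apply/eqP; rewrite eq_le (f0 x) ?(ltW ax) ?(ltW xb) ?andbT //.
rewrite leNgt; apply/negP => fx.
have /cvgrPdist_lt /(_ (f x / 2)) := cf x; rewrite divr_gt0 // => /(_ isT).
rewrite -nbhs_nearE => /nbhs_ballP[d /= d0 dd].
pose e := Num.min (d / 2) (Num.min (x - a) (b - x)).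
have e0 : 0 < e by rewrite /e !lt_min divr_gt0 //= !subr_gt0 ax.
have ed : e <= d / 2 by rewrite /e ge_min lexx.
have ea : e <= x - a by rewrite /e !ge_min lexx !orbT.
have eb : e <= b - x by rewrite /e !ge_min lexx !orbT.
have sub : `[x - e, x + e]%classic `<=` `[a, b]%classic.
  move=> y /=; rewrite !in_itv /= => /andP[y1 y2]; lra.
have : f x / 2 * (e *+ 2) <= sint a b f.
  apply: (@le_trans _ _ (sint (x - e) (x + e) f)).
    have -> : e *+ 2 = (x + e) - (x - e) by rewrite -mulr_natr; ring.
    rewrite -sint_cst; last lra.
    apply: sint_le => //; first exact: continuous_cst.
    move=> y yy; have := dd y; rewrite /ball /=.
    have -> : `|x - y| < d by rewrite ltr_norml; lra.
    by move/(_ isT); rewrite ltr_norml; lra.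
  rewrite /sint /Rintegral fine_le //.
  - have := continuous_integrable (x - e) (x + e) cf.
    by move=> h; apply: integrable_fin_num.
  - have := continuous_integrable a b cf.
    by move=> h; apply: integrable_fin_num.
  - apply: ge0_subset_integral => //.
    exact: measurable_int (continuous_integrable a b cf).
rewrite i0 leNgt => /negP; apply; rewrite mulr_gt0 ?divr_gt0 //.
by rewrite mulrn_wgt0.
Qed.

End IntervalIntegral.

(** * Continuous functions on SU(2), seen as the unit sphere *)

Definition usphere (R : realType) : set 'rV[R]_4 := [set x | sqn x = 1].
Arguments usphere : clear implicits.

Definition cont (R : realType) (f : SU2 R -> R) : Prop :=
  {within usphere R, continuous (f \o @pt R)}.

Section Continuity.
Variable R : realType.
Implicit Types (f : SU2 R -> R) (g h : SU2 R) (x y : 'rV[R]_4).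

Lemma coord_norm_le x i : `|x 0 i| <= `|x|.
Proof.
rewrite [leRHS]/Num.norm /= mx_normrE; apply/bigmax_geP; right.
by exists (0, i).
Qed.

Lemma norm_lt_rV x e : 0 < e -> (forall i, `|x 0 i| < e) -> `|x| < e.
Proof.
move=> e0 xe; rewrite [ltLHS]/Num.norm /= mx_normrE; apply/bigmax_ltP; split => //.
by move=> [i j] _ /=; rewrite (ord1 i).
Qed.

Lemma norm_le_rV x e : 0 <= e -> (forall i, `|x 0 i| <= e) -> `|x| <= e.
Proof.
move=> e0 xe; rewrite [leLHS]/Num.norm /= mx_normrE; apply/bigmax_leP; split => //.
by move=> [i j] _ /=; rewrite (ord1 i).
Qed.

Lemma ord4P (P : 'I_4 -> Prop) : P (inord 0) -> P (inord 1) -> P (inord 2) ->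
  P (inord 3) -> forall i, P i.
Proof.
move=> P0 P1 P2 P3 i; rewrite -(inord_val i).
by case: i => [[|[|[|[|]]]] ?].
Qed.

Lemma sqn_coord_le x i : sqn x = 1 -> `|x 0 i| <= 1.
Proof.
move=> h; rewrite -[X in _ <= X]ger0_norm // -ler_sqr ?nnegrE // -!normrX.
rewrite !ger0_norm ?sqr_ge0 // expr1n -h /sqn.
move: i; apply: ord4P; have := sqr_ge0 (x 0 (inord 0)); have := sqr_ge0 (x 0 (inord 1));
  have := sqr_ge0 (x 0 (inord 2)); have := sqr_ge0 (x 0 (inord 3)); lra.
Qed.

Lemma sqn_continuous : continuous (@sqn R).
Proof.
move=> x.
have h i : (y : 'rV[R]_4) 0 i * y 0 i @[y --> x] --> x 0 i * x 0 i.
  have c : (y : 'rV[R]_4) 0 i @[y --> x] --> x 0 i := @coord_continuous R 1 4 0 i x.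
  exact: (cvgM c c).
exact: (cvgD (cvgD (cvgD (h _) (h _)) (h _)) (h _)).
Qed.

Lemma usphere_compact : compact (usphere R).
Proof.
apply: bounded_closed_compact.
  exists 1; split; first exact: num_real.
  move=> M M1 x /= hx; apply: norm_le_rV => [|i]; first by lra.
  by rewrite (le_trans (sqn_coord_le i hx)) ?ltW.
rewrite (_ : usphere R = @sqn R @^-1` [set 1]); last by [].
by apply: preimage_closed => [x _|]; [exact: sqn_continuous|exact: closed_eq].
Qed.

Lemma usphere_co g : usphere R (co g).
Proof. exact: sqn_co. Qed.

Lemma contP f : (forall g (e : R), 0 < e -> exists2 d : R, 0 < d &
    forall h, `|co g - co h| < d -> `|f g - f h| < e) <-> cont f.
Proof.
split=> [cf|cf g e e0].
  rewrite /cont continuous_subspace_in => x /set_mem xS.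
  apply/cvgrPdist_lt => e e0; have [d d0 dP] := cf (pt x) _ e0.
  rewrite /= -(nbhs_subspace_in xS) near_withinE /=; apply/nbhs_ballP; exists d => //= y.
  rewrite -ball_normE /= => xy yS; apply: dP.
  by rewrite !co_pt.
have xS := usphere_co g.
move: cf; rewrite /cont continuous_subspace_in => /(_ (co g) (mem_set xS)).
move/cvgrPdist_lt => /(_ e e0).
move=> H; have {H} : within (usphere R) (nbhs (co g))
    (fun t => `|f (pt (co g)) - f (pt t)| < e) by rewrite (nbhs_subspace_in xS); exact: H.
move=> /nbhs_ballP[d /= d0 dP].
exists d => // h gh.
have := dP (co h); rewrite -ball_normE /= => /(_ gh (usphere_co h)).
by rewrite !pt_co.
Qed.

(** Heine-Cantor on the compact sphere. The uniform modulus controls the iterated integrals, the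
    difference quotients in [int_dX] and the extension [radial]. *)
Lemma cont_unif f : cont f -> forall e : R, 0 < e -> exists2 d : R, 0 < d &
  forall g h, `|co g - co h| < d -> `|f g - f h| < e.
Proof.
move=> cf e e0.
have /compact_near_coveringP := usphere_compact.
move/(_ R (at_right 0) (fun d x => forall y, usphere R y -> `|x - y| < d ->
  usphere R x -> `|f (pt x) - f (pt y)| < e) _).
case.
  move=> x xS; have e2 : 0 < e / 2 by lra.
  have [d d0 dP] := (iffRL (contP f) cf) (pt x) _ e2.
  exists (ball x (d / 2), [set t | t < d / 2]) => /=.
    split; first by apply: nbhsx_ballx; lra.
    by apply: nbhs_right_lt; lra.
  move=> [x' t] [] /=; rewrite -ball_normE /= => xx' td y yS x'y x'S.
  have h1 := dP (pt x'); have h2 := dP (pt y); rewrite !co_pt // in h1 h2.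
  have {}h1 : `|f (pt x) - f (pt x')| < e / 2 by apply: h1; lra.
  have {}h2 : `|f (pt x) - f (pt y)| < e / 2.
    apply: h2; rewrite -(subrKA x') (le_lt_trans (ler_normD _ _)) //; lra.
  rewrite -(subrKA (f (pt x))) (le_lt_trans (ler_normD _ _)) // distrC; lra.
move=> d /= d0 dP; exists (d / 2); first by lra.
move=> g h gh; have := dP (d / 2); rewrite /= => /(_ _ _ (co g)).
rewrite sub0r normrN ger0_norm ?divr_ge0 ?ltW // => /(_ ltac:(lra) ltac:(lra)).
move/(_ (usphere_co g) (co h) (usphere_co h) gh (usphere_co g)).
by rewrite !pt_co.
Qed.

Lemma cont_bounded f : cont f -> exists2 M : R, 0 < M & forall g, `|f g| <= M.
Proof.
move=> cf.
have [M [_ MP]] := compact_bounded (continuous_compact cf usphere_compact).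
exists (`|M| + 1) => [|g]; first by rewrite ltr_wpDl.
apply: (MP (`|M| + 1)); first by rewrite (le_lt_trans (ler_norm _)) // ltrDl.
by exists (co g); [exact: usphere_co|rewrite /= pt_co].
Qed.

Lemma cont_eq f1 f2 : f1 =1 f2 -> cont f1 -> cont f2.
Proof. by move/funext => ->. Qed.

Lemma cont_cst (c : R) : cont (fun _ : SU2 R => c).
Proof. by apply/contP => g e e0; exists 1 => // h _; rewrite subrr normr0. Qed.

Lemma contD f1 f2 : cont f1 -> cont f2 -> cont (fun g => f1 g + f2 g).
Proof. by move=> c1 c2 x; apply: cvgD; [exact: c1|exact: c2]. Qed.

Lemma contM f1 f2 : cont f1 -> cont f2 -> cont (fun g => f1 g * f2 g).
Proof. by move=> c1 c2 x; apply: cvgM; [exact: c1|exact: c2]. Qed.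

Lemma contN f : cont f -> cont (fun g => - f g).
Proof. by move=> c1 x; apply: cvgN; exact: c1. Qed.

Lemma contZ c f : cont f -> cont (fun g => c * f g).
Proof. by apply: contM; exact: cont_cst. Qed.

Lemma contB f1 f2 : cont f1 -> cont f2 -> cont (fun g => f1 g - f2 g).
Proof. by move=> c1 /contN; exact: contD. Qed.

Lemma cont_coord i : cont (fun g : SU2 R => co g 0 i).
Proof.
apply/contP => g e e0; exists e => // h gh.
by have := coord_norm_le (co g - co h) i; rewrite !mxE; move/le_lt_trans; apply.
Qed.

Lemma cont_comp f (m : SU2 R -> SU2 R) :
  (forall i, cont (fun g => co (m g) 0 i)) -> cont f -> cont (fun g => f (m g)).
Proof.
move=> cm cf; apply/contP => g e e0.
have [d d0 dP] := (iffRL (contP f) cf) (m g) _ e0.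
have hd i := (iffRL (contP _) (cm i)) g _ d0.
have [d' d'0 d'P] : exists2 d', 0 < d' & forall h, `|co g - co h| < d' ->
    forall i, `|co (m g) 0 i - co (m h) 0 i| < d.
  have [d1 p1 P1] := hd (inord 0); have [d2 p2 P2] := hd (inord 1).
  have [d3 p3 P3] := hd (inord 2); have [d4 p4 P4] := hd (inord 3).
  exists (Num.min (Num.min d1 d2) (Num.min d3 d4)); first by rewrite !lt_min p1 p2 p3.
  move=> h; rewrite !lt_min => /andP[/andP[h1 h2] /andP[h3 h4]].
  by apply: ord4P; [exact: P1|exact: P2|exact: P3|exact: P4].
exists d' => // h gh; apply: dP; apply: norm_lt_rV => // i.
by rewrite [X in `|X|]mxE [X in _ + X]mxE; apply: d'P.
Qed.

End Continuity.

Definition ccont (R : realType) (f : SU2 R -> R[i]) : Prop :=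
  cont (fun g => complex.Re (f g)) /\ cont (fun g => complex.Im (f g)).

Section ComplexContinuity.
Variable R : realType.
Local Notation C := R[i].
Implicit Types (f : SU2 R -> C).

Lemma cReD (z w : C) : complex.Re (z + w) = complex.Re z + complex.Re w.
Proof. by case: z w => [a b] [c d]. Qed.
Lemma cImD (z w : C) : complex.Im (z + w) = complex.Im z + complex.Im w.
Proof. by case: z w => [a b] [c d]. Qed.
Lemma cReN (z : C) : complex.Re (- z) = - complex.Re z. Proof. by case: z. Qed.
Lemma cImN (z : C) : complex.Im (- z) = - complex.Im z. Proof. by case: z. Qed.
Lemma cReM (z w : C) : complex.Re (z * w) =
  complex.Re z * complex.Re w - complex.Im z * complex.Im w.
Proof. by case: z w => [a b] [c d]. Qed.
Lemma cImM (z w : C) : complex.Im (z * w) =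
  complex.Re z * complex.Im w + complex.Im z * complex.Re w.
Proof. by case: z w => [a b] [c d]. Qed.
Lemma cReJ (z : C) : complex.Re (conjc z) = complex.Re z. Proof. by case: z. Qed.
Lemma cImJ (z : C) : complex.Im (conjc z) = - complex.Im z. Proof. by case: z. Qed.

Lemma complex_ext (z w : C) :
  complex.Re z = complex.Re w -> complex.Im z = complex.Im w -> z = w.
Proof. by case: z w => [a b] [c d] /= -> ->. Qed.

Lemma ccont_eq f1 f2 : f1 =1 f2 -> ccont f1 -> ccont f2.
Proof. by move/funext => ->. Qed.

Lemma ccont_cst (c : C) : ccont (fun _ : SU2 R => c).
Proof. by split; exact: cont_cst. Qed.

Lemma ccontD f1 f2 : ccont f1 -> ccont f2 -> ccont (fun g => f1 g + f2 g).
Proof.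
move=> [a b] [c d]; split.
  by apply: cont_eq (contD a c) => g; rewrite cReD.
by apply: cont_eq (contD b d) => g; rewrite cImD.
Qed.

Lemma ccontM f1 f2 : ccont f1 -> ccont f2 -> ccont (fun g => f1 g * f2 g).
Proof.
move=> [a b] [c d]; split.
  by apply: cont_eq (contB (contM a c) (contM b d)) => g; rewrite cReM.
by apply: cont_eq (contD (contM a d) (contM b c)) => g; rewrite cImM.
Qed.

Lemma ccontZ c f : ccont f -> ccont (fun g => c * f g).
Proof. by apply: ccontM; exact: ccont_cst. Qed.

Lemma ccontX f n : ccont f -> ccont (fun g => f g ^+ n).
Proof.
move=> cf; elim: n => [|n IH]; first exact: ccont_cst.
by apply: ccont_eq (ccontM cf IH) => g; rewrite exprS.
Qed.

Lemma ccontJ f : ccont f -> ccont (fun g => conjc (f g)).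
Proof.
move=> [a b]; split; first by apply: cont_eq a => g; rewrite cReJ.
by apply: cont_eq (contN b) => g; rewrite cImJ.
Qed.

Lemma ccont_entry (i j : 'I_2) : ccont (fun g : SU2 R => (g : 'M[C]_2) i j).
Proof.
have c00 : ccont (fun g : SU2 R => (g : 'M[C]_2) 0 0).
  split; [apply: cont_eq (@cont_coord R (inord 0))|apply: cont_eq (@cont_coord R (inord 1))];
  by move=> g; rewrite row4E.
have c01 : ccont (fun g : SU2 R => (g : 'M[C]_2) 0 1).
  split; [apply: cont_eq (@cont_coord R (inord 2))|apply: cont_eq (@cont_coord R (inord 3))];
  by move=> g; rewrite row4E.
move: i j; apply: ord2P; apply: ord2P => //.
  by apply: ccont_eq (ccontZ (-1) (ccontJ c01)) => g; rewrite su2_10 mulN1r.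
by apply: ccont_eq (ccontJ c00) => g; rewrite su2_11.
Qed.

Lemma ccont_bil s t x y : ccont (fun g : SU2 R => bil s t x y g).
Proof.
by apply: ccontD; apply: ccontM (ccont_cst _); apply: ccontD; apply: ccontZ;
  exact: ccont_entry.
Qed.

Lemma cont_mulr (k : SU2 R) (F : SU2 R -> R) : cont F -> cont (fun g => F (su2mul g k)).
Proof.
apply: cont_comp.
have h a b : ccont (fun g => (su2mul g k : 'M[C]_2) a b).
  apply: (ccont_eq _ (ccontD (ccontM (ccont_entry a 0) (ccont_cst ((k : 'M[C]_2) 0 b)))
    (ccontM (ccont_entry a 1) (ccont_cst ((k : 'M[C]_2) 1 b))))) => g.
  by rewrite su2mulE mulmx2E.
apply: ord4P; [apply: cont_eq (h 0 0).1|apply: cont_eq (h 0 0).2|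
  apply: cont_eq (h 0 1).1|apply: cont_eq (h 0 1).2]; by move=> g; rewrite row4E.
Qed.

Lemma trig_ccont f : trig f -> ccont f.
Proof.
elim => [|n s t x y|f1 f2 _ h1 _ h2|c f1 _ h1].
- exact: ccont_cst.
- by apply: ccontX; exact: ccont_bil.
- exact: ccontD.
- exact: ccontZ.
Qed.

End ComplexContinuity.

(** * The integral in Hopf coordinates *)

Section SphereIntegral.
Variable R : realType.
Implicit Types (f : SU2 R -> R).

Lemma co_hopf (eta x1 x2 : R) : co (hopf eta x1 x2) =
  row4 (cos eta * cos x1) (cos eta * sin x1) (sin eta * cos x2) (sin eta * sin x2).
Proof. by rewrite quatK. Qed.

Lemma lipschitz1 (F dF : R -> R) : (forall x : R, is_derive x 1 F (dF x)) ->
  (forall x, `|dF x| <= 1) -> forall x y, `|F x - F y| <= `|x - y|.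
Proof.
move=> dFP dF1 x y.
have cF z : {for z, continuous F}.
  by apply: differentiable_continuous; apply/derivable1_diffP.
wlog xy : x y / y <= x.
  move=> H; case: (leP y x) => [/H //|/ltW /H].
  by rewrite distrC [X in _ <= X]distrC.
have [c _ ->] := MVT_segment xy (fun z _ => dFP z)
  (continuous_subspaceT cF).
by rewrite normrM ler_piMl.
Qed.

Lemma cos_lipschitz (x y : R) : `|cos x - cos y| <= `|x - y|.
Proof.
apply: (lipschitz1 (@is_derive_cos R)) => z.
by rewrite normrN ler_norml sin_geN1 sin_le1.
Qed.

Lemma sin_lipschitz (x y : R) : `|sin x - sin y| <= `|x - y|.
Proof.
apply: (lipschitz1 (@is_derive_sin R)) => z.
by rewrite ler_norml cos_geN1 cos_le1.
Qed.

Lemma prod_close (a b a' b' d : R) : `|a'| <= 1 -> `|b| <= 1 ->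
  `|a - a'| < d -> `|b - b'| < d -> `|a * b - a' * b'| < d * 2.
Proof.
move=> a1 b1 ad bd.
have -> : a * b - a' * b' = (a - a') * b + a' * (b - b') by ring.
rewrite (le_lt_trans (ler_normD _ _)) // !normrM mulr_natr mulr2n ltr_leD //.
  by rewrite (le_lt_trans _ ad) // ler_piMr.
by rewrite (le_trans _ (ltW bd)) // ler_piMl.
Qed.

Lemma hopf_close (n n' x x' y y' d : R) : 0 < d ->
  `|n - n'| < d -> `|x - x'| < d -> `|y - y'| < d ->
  `|co (hopf n x y) - co (hopf n' x' y')| < d * 2.
Proof.
move=> d0 nd xd yd; rewrite !co_hopf; apply: norm_lt_rV; first lra.
have cn (z : R) : `|cos z| <= 1 by rewrite ler_norml cos_geN1 cos_le1.
have sn (z : R) : `|sin z| <= 1 by rewrite ler_norml sin_geN1 sin_le1.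
have lc a b : `|a - b| < d -> `|cos a - cos b| < d :=
  le_lt_trans (cos_lipschitz a b).
have ls a b : `|a - b| < d -> `|sin a - sin b| < d :=
  le_lt_trans (sin_lipschitz a b).
by apply: ord4P; rewrite [X in `|X|]mxE [X in _ + X]mxE !row4E; apply: prod_close; auto.
Qed.

Lemma cont_hopf f : cont f -> forall e : R, 0 < e -> exists2 d : R, 0 < d &
  forall n n' x x' y y', `|n - n'| < d -> `|x - x'| < d -> `|y - y'| < d ->
  `|f (hopf n x y) - f (hopf n' x' y')| < e.
Proof.
move=> cf e e0; have [d d0 dP] := cont_unif cf e0.
exists (d / 2); first by lra.
move=> n n' x x' y y' h1 h2 h3; apply: dP.
by rewrite (_ : d = d / 2 * 2); [apply: hopf_close => //; lra|field].
Qed.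

Lemma unif_continuous_fun (F : R -> R) :
  (forall e : R, 0 < e -> exists2 d : R, 0 < d & forall x x', `|x - x'| < d ->
    `|F x - F x'| <= e) -> continuous F.
Proof.
move=> hF x; apply/cvgrPdist_le => e e0; have [d d0 dP] := hF _ e0.
by apply/nbhs_ballP; exists d => //= y; rewrite /ball /=; apply: dP.
Qed.

Definition inner2 f (n x : R) : R := sint 0 (pi *+ 2) (fun y => f (hopf n x y)).
Definition inner1 f (n : R) : R := sint 0 (pi *+ 2) (inner2 f n).

Lemma twopi_gt0 : 0 < pi *+ 2 :> R.
Proof. by rewrite pmulrn_lgt0 // pi_gt0. Qed.

Lemma su2_integralE f :
  su2_integral f = sint 0 (pi / 2) (fun n => sin n * cos n * inner1 f n).
Proof. by []. Qed.

Lemma continuous0 f n x : cont f -> continuous (fun y => f (hopf n x y)).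
Proof.
move=> cf; apply: unif_continuous_fun => e e0; have [d d0 dP] := cont_hopf cf e0.
by exists d => // y y' yy; rewrite ltW // dP ?subrr ?normr0.
Qed.

Lemma inner2_close f : cont f -> forall e : R, 0 < e -> exists2 d : R, 0 < d &
  forall n n' x x', `|n - n'| < d -> `|x - x'| < d -> `|inner2 f n x - inner2 f n' x'| <= e.
Proof.
move=> cf e e0; have p0 := twopi_gt0.
have [d d0 dP] := cont_hopf cf (divr_gt0 e0 p0).
exists d => // n n' x x' h1 h2.
rewrite (_ : e = e / (pi *+ 2) * (pi *+ 2 - 0)); last first.
  by rewrite subr0 divfK // gt_eqF.
apply: sint_close; [exact: ltW|exact: continuous0|exact: continuous0|].
by move=> y _; rewrite ltW // dP // subrr normr0.
Qed.

Lemma continuous1 f n : cont f -> continuous (inner2 f n).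
Proof.
move=> cf; apply: unif_continuous_fun => e e0; have [d d0 dP] := inner2_close cf e0.
by exists d => // x x' xx; rewrite dP ?subrr ?normr0.
Qed.

Lemma continuous2 f : cont f -> continuous (inner1 f).
Proof.
move=> cf; apply: unif_continuous_fun => e e0; have p0 := twopi_gt0.
have [d d0 dP] := inner2_close cf (divr_gt0 e0 p0).
exists d => // n n' h.
rewrite (_ : e = e / (pi *+ 2) * (pi *+ 2 - 0)); last first.
  by rewrite subr0 divfK // gt_eqF.
apply: sint_close; [exact: ltW|exact: continuous1|exact: continuous1|].
by move=> y _; rewrite dP // subrr normr0.
Qed.

Lemma continuous_sincos : continuous (fun n : R => sin n * cos n).
Proof. by apply: continuous_mul; [exact: continuous_sin|exact: continuous_cos]. Qed.

Lemma continuous3 f : cont f -> continuous (fun n => sin n * cos n * inner1 f n).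
Proof. by move=> cf; apply: continuous_mul; [exact: continuous_sincos|exact: continuous2]. Qed.

Lemma sincos_ge0 (n : R) : 0 <= n <= pi / 2 -> 0 <= sin n * cos n.
Proof.
move=> /andP[n0 n1]; have := pi_gt0 R => p0.
apply: mulr_ge0; first by apply: sin_ge0_pi; apply/andP; split; lra.
by apply: cos_ge0_pihalf; apply/andP; split; lra.
Qed.

Lemma su2_intD f1 f2 : cont f1 -> cont f2 ->
  su2_integral (fun g => f1 g + f2 g) = su2_integral f1 + su2_integral f2.
Proof.
move=> c1 c2; rewrite !su2_integralE -sintD; try exact: continuous3.
apply: sint_eq => n _; rewrite -mulrDr; congr (_ * _).
rewrite /inner1 -sintD; try exact: continuous1.
by apply: sint_eq => x _; rewrite /inner2 -sintD //; exact: continuous0.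
Qed.

Lemma su2_intZ c f : cont f -> su2_integral (fun g => c * f g) = c * su2_integral f.
Proof.
move=> cf; rewrite !su2_integralE -sintZ; last exact: continuous3.
apply: sint_eq => n _; rewrite mulrCA; congr (_ * _).
rewrite /inner1 -sintZ; last exact: continuous1.
by apply: sint_eq => x _; rewrite /inner2 -sintZ //; exact: continuous0.
Qed.

Lemma su2_intN f : cont f -> su2_integral (fun g => - f g) = - su2_integral f.
Proof.
move=> cf; have -> : (fun g => - f g) = (fun g => -1 * f g).
  by apply/funext => g; rewrite mulN1r.
by rewrite su2_intZ // mulN1r.
Qed.

Lemma su2_intB f1 f2 : cont f1 -> cont f2 ->
  su2_integral (fun g => f1 g - f2 g) = su2_integral f1 - su2_integral f2.
Proof. by move=> c1 c2; rewrite su2_intD ?su2_intN //; exact: contN. Qed.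

Lemma su2_int_le f1 f2 : cont f1 -> cont f2 -> (forall g, f1 g <= f2 g) ->
  su2_integral f1 <= su2_integral f2.
Proof.
move=> c1 c2 f12; rewrite !su2_integralE.
apply: sint_le => [||n nn]; try exact: continuous3.
apply: ler_wpM2l; first exact: sincos_ge0.
apply: sint_le => [||x _]; try exact: continuous1.
by apply: sint_le => [||y _] //; exact: continuous0.
Qed.

Definition su2_volume : R := su2_integral (fun _ : SU2 R => 1).

Lemma su2_int_cst c : su2_integral (fun _ : SU2 R => c) = c * su2_volume.
Proof.
have -> : (fun _ : SU2 R => c) = (fun _ => c * 1) by apply/funext => g; rewrite mulr1.
rewrite /su2_volume; have := @su2_intZ c (fun=> 1) (@cont_cst R 1).
exact.
Qed.

(** The chosen point is interior to all three coordinate intervals, as [sint_eq0] demands, and the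
    density [sin * cos] is nonzero there. One point suffices, because translation invariance later
    carries it everywhere. *)
Lemma su2_int_eq0 f : cont f -> (forall g, 0 <= f g) -> su2_integral f = 0 ->
  f (hopf (pi / 4) pi pi) = 0.
Proof.
move=> cf f0 i0; have p0 := pi_gt0 R; have pp := twopi_gt0.
have i2 n x : 0 <= inner2 f n x by apply: sint_ge0.
have i1 n : 0 <= inner1 f n by apply: sint_ge0.
have pin : 0 < (pi : R) < (pi : R) *+ 2.
  by rewrite p0 mulr2n ltrDl.
have h1 : sin (pi / 4) * cos (pi / 4) * inner1 f (pi / 4) = 0.
  apply: (@sint_eq0 R 0 (pi / 2) _ _ (continuous3 cf)) => //; first lra.
  - by move=> x xx; apply: mulr_ge0 => //; exact: sincos_ge0.
  - by apply/andP; split; lra.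
have {h1} h1 : inner1 f (pi / 4) = 0.
  move/eqP: h1; rewrite mulf_eq0 => /orP[|/eqP //]; rewrite gt_eqF //.
  apply: mulr_gt0; first by apply: sin_gt0_pi; apply/andP; split; lra.
  by apply: cos_gt0_pihalf; apply/andP; split; lra.
have h2 : inner2 f (pi / 4) pi = 0.
  exact: (@sint_eq0 R 0 (pi *+ 2) _ pp (continuous1 cf)).
exact: (@sint_eq0 R 0 (pi *+ 2) _ pp (continuous0 cf)).
Qed.

Lemma su2_int_ge0 f : cont f -> (forall g, 0 <= f g) -> 0 <= su2_integral f.
Proof.
move=> cf f0; rewrite -[X in X <= _](mul0r su2_volume) -su2_int_cst.
by apply: su2_int_le => //; exact: cont_cst.
Qed.

Lemma su2_volume_gt0 : 0 < su2_volume.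
Proof.
rewrite lt_neqAle su2_int_ge0 ?andbT //; last exact: cont_cst.
apply/eqP => /esym /su2_int_eq0 h; have := h (@cont_cst R 1) (fun=> ler01).
by move/eqP; rewrite oner_eq0.
Qed.

Lemma su2_int_close f1 f2 e : cont f1 -> cont f2 -> (forall g, `|f1 g - f2 g| <= e) ->
  `|su2_integral f1 - su2_integral f2| <= e * su2_volume.
Proof.
move=> c1 c2 f12; rewrite -su2_intB // -su2_int_cst.
rewrite ler_norml -su2_intN; last exact: cont_cst.
apply/andP; split; apply: su2_int_le => //; try exact: cont_cst; try exact: contB.
  by move=> g; have := f12 g; rewrite ler_norml => /andP[].
by move=> g; have := f12 g; rewrite ler_norml => /andP[].
Qed.

End SphereIntegral.

(** * Integrals of the powers of matrix entries *)

Section ComplexIntegral.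
Variable R : realType.
Local Notation C := R[i].
Implicit Types (F G : R -> C) (f : R -> R).

Definition ccontinuous F : Prop :=
  continuous (fun x => complex.Re (F x)) /\ continuous (fun x => complex.Im (F x)).

Definition csint (a b : R) F : C :=
  sint a b (fun x => complex.Re (F x)) +i* sint a b (fun x => complex.Im (F x)).

Definition cderiv F G : Prop := forall x : R,
  is_derive x 1 (fun x => complex.Re (F x)) (complex.Re (G x)) /\
  is_derive x 1 (fun x => complex.Im (F x)) (complex.Im (G x)).

Lemma ccontinuous_eq F G : F =1 G -> ccontinuous F -> ccontinuous G.
Proof. by move/funext => ->. Qed.

Lemma ccontinuous_cst c : ccontinuous (fun=> c).
Proof. by split; exact: continuous_cst. Qed.

Lemma ccontinuousD F G : ccontinuous F -> ccontinuous G -> ccontinuous (fun x => F x + G x).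
Proof.
move=> [a b] [c d]; split.
  have -> : (fun x => complex.Re (F x + G x)) = (fun x => complex.Re (F x) + complex.Re (G x)).
    by apply/funext => x; rewrite cReD.
  exact: continuous_add.
have -> : (fun x => complex.Im (F x + G x)) = (fun x => complex.Im (F x) + complex.Im (G x)).
  by apply/funext => x; rewrite cImD.
exact: continuous_add.
Qed.

Lemma continuous_opp f : continuous f -> continuous (fun x => - f x).
Proof. by move=> cf x; apply: cvgN; exact: cf. Qed.

Lemma ccontinuousM F G : ccontinuous F -> ccontinuous G -> ccontinuous (fun x => F x * G x).
Proof.
move=> [a b] [c d]; split.
  have -> : (fun x => complex.Re (F x * G x)) = (fun x =>
      complex.Re (F x) * complex.Re (G x) + - (complex.Im (F x) * complex.Im (G x))).
    by apply/funext => x; rewrite cReM.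
  by apply: continuous_add; [|apply: continuous_opp]; apply: continuous_mul.
have -> : (fun x => complex.Im (F x * G x)) = (fun x =>
    complex.Re (F x) * complex.Im (G x) + complex.Im (F x) * complex.Re (G x)).
  by apply/funext => x; rewrite cImM.
by apply: continuous_add; apply: continuous_mul.
Qed.

Lemma ccontinuousX F n : ccontinuous F -> ccontinuous (fun x => F x ^+ n).
Proof.
move=> cF; elim: n => [|n IH]; first exact: ccontinuous_cst.
by apply: ccontinuous_eq (ccontinuousM cF IH) => x; rewrite exprS.
Qed.

Lemma csintD a b F G : ccontinuous F -> ccontinuous G ->
  csint a b (fun x => F x + G x) = csint a b F + csint a b G.
Proof.
move=> [f1 f2] [g1 g2]; apply: complex_ext; rewrite ?cReD ?cImD /= -sintD //;
by apply: sint_eq => x _; rewrite ?cReD ?cImD.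
Qed.

Lemma csintZ a b c F : ccontinuous F -> csint a b (fun x => c * F x) = c * csint a b F.
Proof.
move=> [f1 f2]; apply: complex_ext; rewrite ?cReM ?cImM /=.
  transitivity (sint a b (fun x => complex.Re c * complex.Re (F x)
      + - complex.Im c * complex.Im (F x))).
    by apply: sint_eq => x _; rewrite cReM mulNr.
  by rewrite sintD ?sintZ ?mulNr //; exact: continuous_scale.
transitivity (sint a b (fun x => complex.Re c * complex.Im (F x)
    + complex.Im c * complex.Re (F x))).
  by apply: sint_eq => x _; rewrite cImM.
by rewrite sintD ?sintZ //; exact: continuous_scale.
Qed.

Lemma csint_eq a b F G : (forall x, a <= x <= b -> F x = G x) -> csint a b F = csint a b G.
Proof. by move=> FG; congr (_ +i* _); apply: sint_eq => x /FG ->. Qed.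

Lemma csint_sum a b n (F : nat -> R -> C) : (forall k, ccontinuous (F k)) ->
  csint a b (fun x => \sum_(k < n) F k x) = \sum_(k < n) csint a b (F k).
Proof.
move=> cF; have cS m : ccontinuous (fun x => \sum_(k < m) F k x).
  elim: m => [|m IH].
    by apply: ccontinuous_eq (ccontinuous_cst 0) => x; rewrite big_ord0.
  by apply: ccontinuous_eq (ccontinuousD IH (cF m)) => x; rewrite big_ord_recr.
elim: n => [|n IH].
  rewrite big_ord0 -[RHS](mul0r (csint a b (fun=> 1))) -csintZ; last exact: ccontinuous_cst.
  by apply: csint_eq => x _; rewrite big_ord0 mul0r.
rewrite big_ord_recr /= -IH -csintD //.
by apply: csint_eq => x _; rewrite big_ord_recr.
Qed.

Lemma cderiv_continuous F G : cderiv F G -> ccontinuous F.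
Proof.
by move=> dF; split => x; apply: differentiable_continuous; apply/derivable1_diffP;
  have [d1 d2] := dF x.
Qed.

Lemma csint_FTC a b F G : a < b -> ccontinuous G -> cderiv F G ->
  csint a b G = F b - F a.
Proof.
move=> ab [g1 g2] dF; apply: complex_ext; rewrite ?cReD ?cImD ?cReN ?cImN /=.
  by apply: (@sint_FTC R a b _ (fun x => complex.Re (F x)) ab g1) => x; have [] := dF x.
by apply: (@sint_FTC R a b _ (fun x => complex.Im (F x)) ab g2) => x; have [] := dF x.
Qed.

Lemma cderiv_eq F G F' G' : F =1 F' -> G =1 G' -> cderiv F G -> cderiv F' G'.
Proof. by move=> /funext -> /funext ->. Qed.

Lemma cderiv_cst c : cderiv (fun=> c) (fun=> 0).
Proof. by move=> x; split; apply: is_derive_cst. Qed.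

Lemma cderivD F G F' G' : cderiv F G -> cderiv F' G' ->
  cderiv (fun x => F x + F' x) (fun x => G x + G' x).
Proof.
move=> dF dF' x; have [f1 f2] := dF x; have [g1 g2] := dF' x; split.
  have -> : (fun x => complex.Re (F x + F' x)) =
      (fun x => complex.Re (F x)) \+ (fun x => complex.Re (F' x)).
    by apply/funext => y /=; rewrite cReD.
  by rewrite cReD; apply: is_deriveD.
have -> : (fun x => complex.Im (F x + F' x)) =
    (fun x => complex.Im (F x)) \+ (fun x => complex.Im (F' x)).
  by apply/funext => y /=; rewrite cImD.
by rewrite cImD; apply: is_deriveD.
Qed.

Lemma cderivM F G F' G' : cderiv F G -> cderiv F' G' ->
  cderiv (fun x => F x * F' x) (fun x => G x * F' x + F x * G' x).
Proof.
move=> dF dF' x; have [f1 f2] := dF x; have [g1 g2] := dF' x; split.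
  have -> : (fun x => complex.Re (F x * F' x)) =
      ((fun x => complex.Re (F x)) * (fun x => complex.Re (F' x))) -
      ((fun x => complex.Im (F x)) * (fun x => complex.Im (F' x))).
    by apply/funext => y /=; rewrite cReM.
  apply: (is_derive_eq (is_deriveB (is_deriveM f1 g1) (is_deriveM f2 g2))).
  rewrite /= /GRing.scale /= !(cReD, cReM).
  move: (complex.Re (F x)) (complex.Im (F x)) (complex.Re (F' x)) (complex.Im (F' x))
    (complex.Re (G x)) (complex.Im (G x)) (complex.Re (G' x)) (complex.Im (G' x)).
  by move=> *; ring.
have -> : (fun x => complex.Im (F x * F' x)) =
    ((fun x => complex.Re (F x)) * (fun x => complex.Im (F' x))) +
    ((fun x => complex.Im (F x)) * (fun x => complex.Re (F' x))).
  by apply/funext => y /=; rewrite cImM.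
apply: (is_derive_eq (is_deriveD (is_deriveM f1 g2) (is_deriveM f2 g1))).
rewrite /= /GRing.scale /= !(cImD, cImM).
move: (complex.Re (F x)) (complex.Im (F x)) (complex.Re (F' x)) (complex.Im (F' x))
  (complex.Re (G x)) (complex.Im (G x)) (complex.Re (G' x)) (complex.Im (G' x)).
by move=> *; ring.
Qed.

Lemma cderivZ c F G : cderiv F G -> cderiv (fun x => c * F x) (fun x => c * G x).
Proof.
move=> dF; apply: cderiv_eq (cderivM (cderiv_cst c) dF) => // x.
by rewrite mul0r add0r.
Qed.

Lemma cderivX F G n : cderiv F G ->
  cderiv (fun x => F x ^+ n) (fun x => n%:R * F x ^+ n.-1 * G x).
Proof.
move=> dF; elim: n => [|n IH].
  by apply: cderiv_eq (cderiv_cst 1) => x; rewrite ?mul0r.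
apply: cderiv_eq (cderivM dF IH) => x; first by rewrite exprS.
case: n {IH} => [|n] /=; first by ring.
by rewrite exprS -[n.+2%:R]natr1; ring.
Qed.

Definition expi (x : R) : C := cos x +i* sin x.

Lemma cderiv_expi : cderiv expi (fun x => 'i%C * expi x).
Proof.
by move=> x; split; rewrite /expi ?cReM ?cImM /= !(mul0r, mul1r, add0r, sub0r, addr0); apply: is_derive_eq.
Qed.

Lemma cderiv_expiJ : cderiv (fun x => conjc (expi x)) (fun x => - 'i%C * conjc (expi x)).
Proof.
move=> x; split; rewrite /expi ?cReM ?cImM /= !(mul0r, mul1r, add0r, sub0r, addr0, oppr0, mulNr, mulrN, opprK).
  exact: is_derive_eq.
by apply: is_derive_eq; rewrite /= ?scaleN1r.
Qed.

Lemma expiJ (x : R) : expi x * conjc (expi x) = 1.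
Proof.
apply: complex_ext; rewrite ?cReM ?cImM /=; last by ring.
by rewrite mulrN opprK -!expr2 cos2Dsin2.
Qed.

Lemma expi_2pi : expi (pi *+ 2) = expi 0.
Proof. by rewrite /expi cos0 sin0 cos2pi sin2pi. Qed.

End ComplexIntegral.

Section TrigIntegral.
Variable R : realType.
Local Notation C := R[i].

Lemma ccontinuousZ (c : C) (F : R -> C) : ccontinuous F -> ccontinuous (fun x => c * F x).
Proof. by apply: ccontinuousM; exact: ccontinuous_cst. Qed.

Definition osc (a c : C) (x : R) : C := a * expi x + c * conjc (expi x).

Lemma cderiv_osc a c : cderiv (osc a c) (fun x => 'i%C * osc a (- c) x).
Proof.
apply: cderiv_eq (cderivD (cderivZ a (@cderiv_expi R)) (cderivZ c (@cderiv_expiJ R))) => //.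
by move=> x; rewrite /osc; ring.
Qed.

Lemma osc_2pi a c : osc a c (pi *+ 2) = osc a c 0.
Proof. by rewrite /osc expi_2pi. Qed.

Lemma ccontinuous_osc a c : ccontinuous (osc a c).
Proof. exact: cderiv_continuous (cderiv_osc a c). Qed.

Lemma ImI2 : 'i%C * 'i%C = -1 :> C.
Proof. by apply: complex_ext; rewrite ?cReM ?cImM /=; ring. Qed.

Definition oscint k a c : C := csint 0 (pi *+ 2) (fun x => osc a c x ^+ k).

Lemma oscint0 a c : oscint 0 a c = (pi *+ 2)%:C.
Proof.
have p0 := twopi_gt0 R.
transitivity (sint 0 (pi *+ 2) (fun=> 1 : R) +i* sint 0 (pi *+ 2) (fun=> 0 : R)) => //.
by rewrite !sint_cst ?ltW // mul1r mul0r subr0.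
Qed.

Lemma osc_sqr a c x : osc a (- c) x ^+ 2 = osc a c x ^+ 2 - 4 * (a * c).
Proof.
transitivity (osc a c x ^+ 2 - 4 * (a * c) * (expi x * conjc (expi x))).
  by rewrite /osc; ring.
by rewrite expiJ mulr1.
Qed.

Lemma ccont_oscX k a c : ccontinuous (fun x => osc a c x ^+ k).
Proof. by apply: ccontinuousX; exact: ccontinuous_osc. Qed.

Lemma ImI_neq0 : 'i%C != 0 :> C.
Proof. by rewrite eq_complex /= oner_eq0 andbF. Qed.

(** Integrate over a period the derivative of [osc a c ^+ k.+1 * osc a (- c)]: each of [osc a c] and
    [osc a (- c)] has derivative ['i] times the other, and [osc_sqr] removes the square of the
    second. *)
Lemma oscint_rec k a c :
  k.+2%:R * oscint k.+2 a c = 4 * (a * c) * k.+1%:R * oscint k a c.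
Proof.
pose F x := osc a c x ^+ k.+1 * osc a (- c) x.
pose G x := 'i%C * (k.+2%:R * osc a c x ^+ k.+2 + - (4 * (a * c) * k.+1%:R) * osc a c x ^+ k).
have cG' : ccontinuous (fun x => k.+2%:R * osc a c x ^+ k.+2 +
    - (4 * (a * c) * k.+1%:R) * osc a c x ^+ k).
  by apply: ccontinuousD; apply: ccontinuousZ; exact: ccont_oscX.
have cG : ccontinuous G by apply: ccontinuousZ.
have FG : cderiv F G.
  apply: cderiv_eq (cderivM (cderivX k.+1 (cderiv_osc a c)) (cderiv_osc a (- c))) => // x.
  rewrite /= opprK /G !exprS -[k.+2%:R]natr1.
  have := osc_sqr a c x; move: (osc a c x) (osc a (- c) x) (_ ^+ k) => u v w e.
  have -> : 4 * (a * c) = u ^+ 2 - v ^+ 2 by rewrite e; ring.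
  ring.
have := csint_FTC (twopi_gt0 R) cG FG.
rewrite /F !osc_2pi subrr csintZ // => /eqP; rewrite mulf_eq0 (negbTE ImI_neq0) /=.
rewrite csintD; try by apply: ccontinuousZ; exact: ccont_oscX.
by rewrite !csintZ; try exact: ccont_oscX; rewrite mulNr subr_eq0 => /eqP.
Qed.

Lemma oscint1 a c : oscint 1 a c = 0.
Proof.
have cG : ccontinuous (fun x => 'i%C * osc a c x ^+ 1).
  by apply: ccontinuousZ; exact: ccont_oscX.
have FG : cderiv (osc a (- c)) (fun x => 'i%C * osc a c x ^+ 1).
  by apply: cderiv_eq (cderiv_osc a (- c)) => // x; rewrite opprK.
have := csint_FTC (twopi_gt0 R) cG FG.
rewrite osc_2pi subrr csintZ; last exact: ccont_oscX.
by move/eqP; rewrite mulf_eq0 (negbTE ImI_neq0) => /eqP.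
Qed.

(** Equal to [2 * pi] times the central binomial coefficient ['C(k.*2, k)], in the recursive form
    that [oscint_rec] delivers. *)
Fixpoint oscnum (k : nat) : C :=
  if k is j.+1 then 2 * (j.*2.+1)%:R / j.+1%:R * oscnum j else (pi *+ 2)%:C.

Lemma oscint_even k a c : oscint k.*2 a c = (a * c) ^+ k * oscnum k.
Proof.
elim: k => [|k IH]; first by rewrite oscint0 mul1r.
have k2 : k.*2.+2%:R = 2 * k.+1%:R :> C by rewrite -natrM mul2n doubleS.
have k1 : k.+1%:R != 0 :> C by rewrite pnatr_eq0.
have k2n : k.*2.+2%:R != 0 :> C by rewrite pnatr_eq0.
rewrite doubleS; apply: (mulfI k2n); rewrite oscint_rec IH k2 exprS /=.
by move: (k.*2.+1%:R) (_ ^+ k) => m u; field.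
Qed.

Lemma oscint_odd k a c : oscint k.*2.+1 a c = 0.
Proof.
elim: k => [|k IH]; first exact: oscint1.
have k2n : k.*2.+3%:R != 0 :> C by rewrite pnatr_eq0.
by apply: (mulfI k2n); rewrite doubleS oscint_rec IH !mulr0.
Qed.

(** The successors in the exponents absorb the volume density [sin * cos]. *)
Definition wallis p q : C :=
  csint 0 (pi / 2) (fun x => (cos x)%:C ^+ p.+1 * (sin x)%:C ^+ q.+1).

Lemma cderiv_cos : cderiv (fun x : R => (cos x)%:C) (fun x => - (sin x)%:C).
Proof.
move=> x; split => /=; first exact: is_derive_eq.
by rewrite oppr0; apply: is_derive_cst.
Qed.

Lemma cderiv_sin : cderiv (fun x : R => (sin x)%:C) (fun x => (cos x)%:C).
Proof. by move=> x; split => /=; [exact: is_derive_eq|apply: is_derive_cst]. Qed.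

Lemma ccontinuous_cossin p q :
  ccontinuous (fun x : R => (cos x)%:C ^+ p * (sin x)%:C ^+ q).
Proof.
apply: ccontinuousM; apply: ccontinuousX.
  exact: cderiv_continuous cderiv_cos.
exact: cderiv_continuous cderiv_sin.
Qed.

(** Integrate the derivative of [cos ^+ p.+2 * sin ^+ q.+2], a function that vanishes at 0 and at
    [pi / 2]. *)
Lemma wallis_rec p q : p.+2%:R * wallis p q.+2 = q.+2%:R * wallis p.+2 q.
Proof.
pose F (x : R) := (cos x)%:C ^+ p.+2 * (sin x)%:C ^+ q.+2.
pose G (x : R) := q.+2%:R * ((cos x)%:C ^+ p.+3 * (sin x)%:C ^+ q.+1) +
  - p.+2%:R * ((cos x)%:C ^+ p.+1 * (sin x)%:C ^+ q.+3).
have cG : ccontinuous G.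
  by apply: ccontinuousD; apply: ccontinuousZ; exact: ccontinuous_cossin.
have FG : cderiv F G.
  apply: cderiv_eq (cderivM (cderivX p.+2 cderiv_cos) (cderivX q.+2 cderiv_sin)) => // x.
  rewrite /G /= !exprS; move: (_ ^+ p) (_ ^+ q) (p.+2%:R) (q.+2%:R) => *; ring.
have p2 : 0 < (pi : R) / 2 by have := pi_gt0 R; lra.
have := csint_FTC p2 cG FG.
rewrite /F sin0 cos_pihalf !expr0n /= mul0r mulr0 subrr /G.
rewrite csintD; try by apply: ccontinuousZ; exact: ccontinuous_cossin.
rewrite !csintZ; try exact: ccontinuous_cossin.
by rewrite mulNr => /eqP; rewrite subr_eq0 => /eqP.
Qed.

Definition su2_cint (f : SU2 R -> C) : C :=
  su2_integral (fun g => complex.Re (f g)) +i* su2_integral (fun g => complex.Im (f g)).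

Lemma su2_cint_hopf f : su2_cint f = csint 0 (pi / 2) (fun n =>
  (sin n * cos n)%:C * csint 0 (pi *+ 2) (fun x =>
    csint 0 (pi *+ 2) (fun y => f (hopf n x y)))).
Proof.
apply: complex_ext; rewrite /= su2_integralE; apply: sint_eq => n _.
  by rewrite mul0r subr0.
by rewrite mul0r addr0.
Qed.

Lemma bil_hopf s t x y (n u v : R) : bil s t x y (hopf n u v) =
  (cos n)%:C * osc (s * x) (t * y) u + (sin n)%:C * osc (s * y) (- (t * x)) v.
Proof.
rewrite /bil /rowL /rowR /osc [in LHS]/= quat_row4 !mx2E.
have -> : (cos n * cos u) +i* (cos n * sin u) = (cos n)%:C * expi u.
  by apply: complex_ext; rewrite ?cReM ?cImM /=; ring.
have -> : (cos n * cos u) -i* (cos n * sin u) = (cos n)%:C * conjc (expi u).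
  by apply: complex_ext; rewrite ?cReM ?cImM /=; ring.
have -> : (sin n * cos v) +i* (sin n * sin v) = (sin n)%:C * expi v.
  by apply: complex_ext; rewrite ?cReM ?cImM /=; ring.
have -> : (- (sin n * cos v)) +i* (sin n * sin v) = - (sin n)%:C * conjc (expi v).
  by apply: complex_ext; rewrite ?cReM ?cImM ?cReN ?cImN /=; ring.
ring.
Qed.

Lemma sum_even (w : nat -> C) m : (forall j, w j.*2.+1 = 0) ->
  \sum_(k < m.*2.+1) w k = \sum_(j < m.+1) w j.*2.
Proof.
move=> w0; elim: m => [|m IH]; first by rewrite !big_ord_recr !big_ord0.
by rewrite doubleS big_ord_recr big_ord_recr /= IH w0 addr0 [RHS]big_ord_recr.
Qed.

Lemma csint_torus (A B : R) a b c d n :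
  csint 0 (pi *+ 2) (fun x => csint 0 (pi *+ 2) (fun y =>
     (A%:C * osc a c x + B%:C * osc b d y) ^+ n)) =
  \sum_(k < n.+1) (A%:C ^+ (n - k) * B%:C ^+ k) *
     ('C(n, k)%:R * oscint (n - k) a c * oscint k b d).
Proof.
transitivity (csint 0 (pi *+ 2) (fun x => \sum_(k < n.+1)
    (A%:C ^+ (n - k) * B%:C ^+ k * 'C(n, k)%:R * oscint k b d) * osc a c x ^+ (n - k))).
  apply: csint_eq => x _.
  transitivity (csint 0 (pi *+ 2) (fun y => \sum_(k < n.+1)
    (A%:C ^+ (n - k) * B%:C ^+ k * 'C(n, k)%:R * osc a c x ^+ (n - k)) * osc b d y ^+ k)).
    apply: csint_eq => y _; rewrite exprDn; apply: eq_bigr => k _.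
    rewrite -[_ *+ _]mulr_natr !exprMn.
    move: (osc a c x ^+ _) (osc b d y ^+ _) ('C(n, k)%:R) (A%:C ^+ _) (B%:C ^+ _) => *; ring.
  rewrite (csint_sum _ _ n.+1 (F := fun k y => (A%:C ^+ (n - k) * B%:C ^+ k * 'C(n, k)%:R *
    osc a c x ^+ (n - k)) * osc b d y ^+ k)); last first.
    by move=> k; apply: ccontinuousZ; exact: ccont_oscX.
  apply: eq_bigr => k _; rewrite csintZ; last exact: ccont_oscX.
  rewrite -/(oscint k b d).
  move: (osc a c x ^+ _) (oscint _ _ _) ('C(n, k)%:R) (A%:C ^+ _) (B%:C ^+ _) => *; ring.
rewrite (csint_sum _ _ n.+1 (F := fun k x => (A%:C ^+ (n - k) * B%:C ^+ k * 'C(n, k)%:R *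
    oscint k b d) * osc a c x ^+ (n - k))); last first.
  by move=> k; apply: ccontinuousZ; exact: ccont_oscX.
apply: eq_bigr => k _; rewrite csintZ; last exact: ccont_oscX.
rewrite -/(oscint (n - k) a c).
move: (oscint (n - k) _ _) (oscint _ _ _) ('C(n, k)%:R) (A%:C ^+ _) (B%:C ^+ _) => *; ring.
Qed.

(* In Hopf coordinates the angular integrals annihilate the terms of odd degree
   in either entry of r = (s, t) g; the others are the terms of the expansion of
   q ^+ m * V 0 * (1 - 1) ^+ m. *)
Lemma su2_cint_bilX n s t x y : (0 < n)%N ->
  su2_cint (fun g => bil s t x y g ^+ n) = 0.
Proof.
move=> n0; pose q := s * x * (t * y).
pose w k := 'C(n, k)%:R * oscint (n - k) (s * x) (t * y)
  * oscint k (s * y) (- (t * x)) * wallis (n - k) k.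
have -> : su2_cint (fun g => bil s t x y g ^+ n) = \sum_(k < n.+1) w k.
  rewrite su2_cint_hopf.
  transitivity (csint 0 (pi / 2) (fun z => \sum_(k < n.+1)
     ('C(n, k)%:R * oscint (n - k) (s * x) (t * y) * oscint k (s * y) (- (t * x))) *
     ((cos z)%:C ^+ (n - k).+1 * (sin z)%:C ^+ k.+1))).
    apply: csint_eq => z _.
    transitivity ((sin z * cos z)%:C * \sum_(k < n.+1) ((cos z)%:C ^+ (n - k) * (sin z)%:C ^+ k) *
     ('C(n, k)%:R * oscint (n - k) (s * x) (t * y) * oscint k (s * y) (- (t * x)))).
      rewrite -(csint_torus (cos z) (sin z) (s * x) (s * y) (t * y) (- (t * x)) n).
      apply: (congr1 (fun v => _ * v)); apply: csint_eq => u _; apply: csint_eq => v _.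
      by rewrite bil_hopf.
    rewrite mulr_sumr; apply: eq_bigr => k _; rewrite !exprS rmorphM /=.
    move: (oscint k _ _) (oscint (n - k) _ _) ('C(n, k)%:R) ((sin z)%:C ^+ k)
      ((cos z)%:C ^+ (n - k)) => *; ring.
  rewrite (csint_sum _ _ n.+1 (F := fun k z =>
     ('C(n, k)%:R * oscint (n - k) (s * x) (t * y) * oscint k (s * y) (- (t * x))) *
     ((cos z)%:C ^+ (n - k).+1 * (sin z)%:C ^+ k.+1))); last first.
    by move=> k; apply: ccontinuousZ; exact: ccontinuous_cossin.
  by apply: eq_bigr => k _; rewrite csintZ; last exact: ccontinuous_cossin.
case: (boolP (odd n)) => on.
  rewrite big1 // => k _; rewrite /w.
  case: (boolP (odd k)) => ok.
    have -> : nat_of_ord k = (k./2).*2.+1 by rewrite -[LHS]odd_double_half ok.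
    by rewrite oscint_odd mulr0 mul0r.
  have -> : (n - k)%N = ((n - k)./2).*2.+1.
    by rewrite -[LHS]odd_double_half oddB ?on ?(negbTE ok) // -ltnS.
  by rewrite oscint_odd mulr0 !mul0r.
have [m nE] : exists m, n = m.*2 by exists n./2; rewrite -[LHS]odd_double_half (negbTE on).
have w_odd j : w j.*2.+1 = 0 by rewrite /w oscint_odd mulr0 mul0r.
rewrite nE (sum_even m w_odd).
pose V j := 'C(m.*2, j.*2)%:R * (oscnum (m - j) * oscnum j * wallis (m - j).*2 j.*2).
(* The recursions of the binomial, of [oscnum] and of [wallis] combine into that of ['C(m, j)], so
   [V j] is ['C(m, j)] times [V 0]. *)
have VS j : (j < m)%N -> j.+1%:R * V j.+1 = (m - j)%:R * V j.
  move=> jm; rewrite /V.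
  have [l ml] : exists l, (m - j)%N = l.+1 by exists (m - j).-1; rewrite prednK // subn_gt0.
  have -> : (m - j.+1)%N = l by rewrite subnS ml.
  rewrite ml doubleS [(l.+1).*2]doubleS.
  have h1 : (j.*2.+2 * 'C(m.*2, j.*2.+2) = l.*2.+1 * 'C(m.*2, j.*2.+1))%N.
    by rewrite mul_bin_left; congr (_ * _)%N; rewrite subnS -doubleB ml doubleS.
  have h2 : (j.*2.+1 * 'C(m.*2, j.*2.+1) = l.*2.+2 * 'C(m.*2, j.*2))%N.
    by rewrite mul_bin_left -doubleB ml doubleS.
  have {}h1 := congr1 (fun k => k%:R : C) h1; have {}h2 := congr1 (fun k => k%:R : C) h2.
  have h3 := wallis_rec l.*2 j.*2.
  have e k : k.*2.+2%:R = 2 * k.+1%:R :> C by rewrite -natrM mul2n doubleS.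
  rewrite /= !natrM !e in h1 h2 h3 *.
  have n1 : j.+1%:R != 0 :> C by rewrite pnatr_eq0.
  have n2 : l.+1%:R != 0 :> C by rewrite pnatr_eq0.
  have n3 : j.*2.+1%:R != 0 :> C by rewrite pnatr_eq0.
  move: ('C(m.*2, j.*2.+2)%:R) ('C(m.*2, j.*2.+1)%:R) ('C(m.*2, j.*2)%:R) (wallis _ _)
    (wallis _ _) (oscnum l) (oscnum j) (j.+1%:R) (l.+1%:R) (j.*2.+1%:R) (l.*2.+1%:R)
    n1 n2 n3 h1 h2 h3 => c2 c1 c0 k0 k2 ol oj a b d e' n1 n2 n3 h1 h2 h3.
  have two : 2 != 0 :> C by rewrite pnatr_eq0.
  have -> : k2 = a * k0 / b by apply: (mulfI (mulf_neq0 two n2)); rewrite h3; field.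
  have -> : c2 = e' * (2 * b * c0 / d) / (2 * a).
    apply: (mulfI (mulf_neq0 two n1)); rewrite h1.
    have -> : c1 = 2 * b * c0 / d by apply: (mulfI n3); rewrite h2; field.
    by field; rewrite n1 n3.
  by field; rewrite n1 n2 n3.
have VE j : (j <= m)%N -> V j = 'C(m, j)%:R * V 0.
  elim: j => [|j IH] jm; first by rewrite bin0 mul1r.
  have n1 : j.+1%:R != 0 :> C by rewrite pnatr_eq0.
  apply: (mulfI n1); rewrite VS // IH ?(ltnW jm) // !mulrA -!natrM.
  by rewrite mul_bin_left.
transitivity (q ^+ m * V 0 * (1 - 1) ^+ m); last first.
  have m0 : m != 0%N by apply: contraTneq n0 => m0; rewrite nE m0.
  by rewrite subrr expr0n (negbTE m0) mulr0.
rewrite exprBn mulr_sumr; apply: eq_bigr => j _.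
have jm : (j <= m)%N by rewrite -ltnS.
rewrite /w nE -doubleB !oscint_even -/q.
have -> : (-1) ^+ j * 1 ^+ (m - j) * 1 ^+ j *+ 'C(m, j) = (-1) ^+ j * 'C(m, j)%:R :> C.
  by rewrite !expr1n !mulr1 mulr_natr.
have -> : s * y * - (t * x) = - q by rewrite /q; ring.
have qE : q ^+ m = q ^+ (m - j) * q ^+ j by rewrite -exprD subnK.
have VEj : 'C(m.*2, j.*2)%:R * (oscnum (m - j) * oscnum j * wallis (m - j).*2 j.*2) =
  'C(m, j)%:R * V 0 := VE j jm.
rewrite qE (exprNn q).
transitivity (q ^+ (m - j) * q ^+ j * (-1) ^+ j * ('C(m, j)%:R * V 0)); last by ring.
rewrite -VEj.
move: ('C(_, _)%:R) (oscnum _) (oscnum _) (wallis _ _) (q ^+ (m - j)) (q ^+ j) => *; ring.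
Qed.

End TrigIntegral.

(** * Uniform approximation by polynomials *)

(* Unification would otherwise unfold the integrals. *)
Opaque su2_integral su2_volume.

Section Bernstein.
Variable R : realType.
Implicit Types (t c : R) (g h : nat -> R).

(* The value at t of the N-th Bernstein polynomial of k / N |-> g k. *)
Fixpoint bern t (N : nat) g : R :=
  if N is M.+1 then t * bern t M (fun k => g k.+1) + (1 - t) * bern t M g else g 0%N.

Lemma bern_le t N g h : 0 <= t <= 1 -> (forall k, g k <= h k) -> bern t N g <= bern t N h.
Proof.
move=> /andP[t0 t1]; elim: N g h => [|N IH] g h gh //=.
by apply: lerD; apply: ler_wpM2l; rewrite ?subr_ge0 //; apply: IH.
Qed.

(** For [t] in [[0, 1]], [bern t N g] is the expectation of [g] at a binomial variable with [N]
    trials and probability [t]; the formula is the variance plus the square of the shifted mean. *)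
Lemma bern_sq t N a b c : bern t N (fun k => a + b * (k%:R + c) ^+ 2) =
  a + b * (N%:R * t * (1 - t) + (N%:R * t + c) ^+ 2).
Proof.
elim: N c => [|N IH] c /=; first by ring.
rewrite IH; under eq_fun do rewrite -natr1 -addrA.
by rewrite IH -natr1; ring.
Qed.

(** The rescaled node [2 k / (N + 1) - 1] has mean [x] and variance [4 t (1 - t) / (N + 1)], at most
    [1 / (N + 1)]. Positivity of [bern] thus turns a quadratic majorant at the nodes into a bound at
    [x]. *)
Lemma bern_sq_le t N g a b x : 0 <= t <= 1 -> 0 <= b -> x = 2 * t - 1 ->
  (forall k, g k <= a + b * (2 * k%:R / N.+1%:R - 1 - x) ^+ 2) ->
  bern t N.+1 g <= a + b / N.+1%:R.
Proof.
move=> t01 b0 -> gP.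
have N0 : N.+1%:R != 0 :> R by rewrite pnatr_eq0.
apply: (@le_trans _ _ (bern t N.+1 (fun k => a + (4 * b / N.+1%:R ^+ 2) *
    (k%:R + - (N.+1%:R * t)) ^+ 2))).
  apply: bern_le => // k; apply: (le_trans (gP k)).
  rewrite le_eqVlt; apply/orP; left; apply/eqP.
  by move: (N.+1%:R) (k%:R) N0 => n k' n0; field.
rewrite bern_sq subrr expr0n /= addr0 lerD2l.
have -> : 4 * b / N.+1%:R ^+ 2 * (N.+1%:R * t * (1 - t)) =
    b / N.+1%:R * (4 * t * (1 - t)).
  by move: (N.+1%:R) N0 => n n0; field.
rewrite ler_piMr //; first by rewrite divr_ge0.
by have := sqr_ge0 (2 * t - 1); rewrite expr2; nra.
Qed.

End Bernstein.

Section Density.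
Variable R : realType.
Local Notation C := R[i].
Implicit Types (f : SU2 R -> R).

Definition grid (N k : nat) : R := 2 * k%:R / N.+1%:R - 1.

Definition bern4 (F : R -> R -> R -> R -> R) N (x : 'rV[R]_4) : R :=
  let t i := (x 0 (inord i) + 1) / 2 in
  bern (t 0%N) N.+1 (fun k0 => bern (t 1%N) N.+1 (fun k1 =>
    bern (t 2%N) N.+1 (fun k2 => bern (t 3%N) N.+1 (fun k3 =>
      F (grid N k0) (grid N k1) (grid N k2) (grid N k3))))).

(** One application of [bern_sq_le] per coordinate; each trades a quadratic term for [b / N.+1]. *)
Lemma bern4_le F N x a b : sqn x = 1 -> 0 <= b ->
  (forall y0 y1 y2 y3, F y0 y1 y2 y3 <= a + b * (y0 - x 0 (inord 0)) ^+ 2 +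
     b * (y1 - x 0 (inord 1)) ^+ 2 + b * (y2 - x 0 (inord 2)) ^+ 2 +
     b * (y3 - x 0 (inord 3)) ^+ 2) ->
  bern4 F N x <= a + b / N.+1%:R *+ 4.
Proof.
move=> x1 b0 FP; rewrite /bern4.
have t01 i : 0 <= (x 0 (inord i) + 1) / 2 <= 1.
  by have := sqn_coord_le (inord i) x1; rewrite ler_norml; lra.
have tE i : x 0 (inord i) = 2 * ((x 0 (inord i) + 1) / 2) - 1 by field.
have -> : a + b / N.+1%:R *+ 4 =
  (a + b / N.+1%:R + b / N.+1%:R + b / N.+1%:R) + b / N.+1%:R by rewrite -mulr_natr; ring.
set e := b / N.+1%:R.
apply: (bern_sq_le _ b0 (tE 0)) => // k0.
rewrite addrAC; apply: (bern_sq_le _ b0 (tE 1)) => // k1.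
rewrite (addrAC (a + e) e) (addrAC _ e); apply: (bern_sq_le _ b0 (tE 2)) => // k2.
rewrite (addrAC a e) (addrAC _ e) (addrAC _ e).
apply: (bern_sq_le _ b0 (tE 3)) => // k3; exact: FP.
Qed.

(** The second row of [g] is conjugate to the first up to order and sign, so real and imaginary
    parts of the first row are complex combinations of the four entries, and [trig_mul_bil]
    applies. *)
Lemma trig_mul_coord i (f : SU2 R -> C) : trig f -> trig (fun g => (co g 0 i)%:C * f g).
Proof.
move=> tf.
have e00 := trig_mul_bil 1 0 1 0 tf; have e01 := trig_mul_bil 1 0 0 1 tf.
have e10 := trig_mul_bil 0 1 1 0 tf; have e11 := trig_mul_bil 0 1 0 1 tf.
have i2 := @ImI2 R.
have n2 : 2 != 0 :> C by rewrite pnatr_eq0.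
move: i; apply: ord4P.
- apply: trig_eq (trigZ 2^-1 (trigD e00 e11)) => g.
  rewrite row4E /bil /rowL /rowR su2_11 ReJ_add; by field.
- apply: trig_eq (trigZ (- 'i%C / 2) (trigD e00 (trigZ (-1) e11))) => g.
  rewrite row4E /bil /rowL /rowR su2_11 ImJ_sub; by field.
- apply: trig_eq (trigZ 2^-1 (trigD e01 (trigZ (-1) e10))) => g.
  rewrite row4E /bil /rowL /rowR su2_10 ReJ_add; by field.
- apply: trig_eq (trigZ (- 'i%C / 2) (trigD e01 e10)) => g.
  rewrite row4E /bil /rowL /rowR su2_10 ImJ_sub; by field.
Qed.

Lemma trig_bern i N (h : nat -> SU2 R -> R) : (forall k, trig (fun g => (h k g)%:C)) ->
  trig (fun g => (bern ((co g 0 i + 1) / 2) N (fun k => h k g))%:C).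
Proof.
elim: N h => [|N IH] h th /=; first exact: th.
have h1 := IH _ (fun k => th k.+1); have h2 := IH _ th.
apply: trig_eq (trigZ 2^-1 (trigD (trigD h1 (trig_mul_coord i h1))
  (trigD h2 (trigZ (-1) (trig_mul_coord i h2))))) => g.
rewrite rmorphD !rmorphM rmorphB !rmorphM rmorphD /= fmorphV /= !rmorph_nat rmorph1.
have n2 : 2 != 0 :> C by rewrite pnatr_eq0.
by field.
Qed.

Lemma trig_bern4 F N : trig (fun g : SU2 R => (bern4 F N (co g))%:C).
Proof.
rewrite /bern4; do 4 (apply: trig_bern => ?).
exact: trig_cst.
Qed.

(** The Bernstein nodes lie in a cube, off the sphere in general, so [f] is extended to be constant
    along rays from the origin. At the origin the inverse of 0 is 0 and [pt] takes its default
    value. *)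
Definition radial f (y : 'rV[R]_4) : R := f (pt ((Num.sqrt (sqn y))^-1 *: y)).

Lemma sqnZ a (y : 'rV[R]_4) : sqn (a *: y) = a ^+ 2 * sqn y.
Proof. rewrite /sqn !mxE; ring. Qed.

Lemma sqn_ge0 (z : 'rV[R]_4) : 0 <= sqn z.
Proof. by rewrite /sqn !addr_ge0 ?sqr_ge0. Qed.

(** The bound 1/4 keeps the norm [n] of [y] above 1/2; the squared distance after normalisation is
    then [(D - (n - 1)^2) / n], at most [2 D]. *)
Lemma normalize_close (x y : 'rV[R]_4) (d : R) : 0 < d -> sqn x = 1 ->
  sqn (y - x) < 1 / 4 -> sqn (y - x) < d ^+ 2 / 2 ->
  sqn ((Num.sqrt (sqn y))^-1 *: y) = 1 /\ `|x - (Num.sqrt (sqn y))^-1 *: y| < d.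
Proof.
move=> d0 x1 D14 Dd; set D := sqn (y - x) in D14 Dd.
pose n := Num.sqrt (sqn y).
have nn : n ^+ 2 = sqn y by rewrite sqr_sqrtr ?sqn_ge0.
have n12 : 1 / 2 <= n.
  have n0 : 0 <= n by exact: sqrtr_ge0.
  suff : 1 / 4 <= n ^+ 2 by nra.
  rewrite nn; move: x1 D14; rewrite /D /sqn !mxE.
  move: (y 0 _) (y 0 _) (y 0 _) (y 0 _) (x 0 _) (x 0 _) (x 0 _) (x 0 _).
  move=> y0 y1 y2 y3 x0 x1' x2 x3 e1 e2.
  have q (a c : R) : a ^+ 2 / 2 - (c - a) ^+ 2 <= c ^+ 2.
    by have := sqr_ge0 (a + 2 * (c - a)); rewrite !expr2; lra.
  have := q x0 y0; have := q x1' y1; have := q x2 y2; have := q x3 y3; lra.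
have n0 : n != 0 by rewrite gt_eqF //; lra.
have z1 : sqn (n^-1 *: y) = 1 by rewrite sqnZ -nn -exprMn mulVf // expr1n.
have : sqn (n^-1 *: y - x) <= 2 * D.
  have -> : sqn (n^-1 *: y - x) = (D - (n - 1) ^+ 2) / n.
    have hn : n ^+ 2 = sqn y := nn.
    apply: (mulIf n0); rewrite divfK //.
    move: hn x1; rewrite /D /sqn !mxE.
    move: (y 0 _) (y 0 _) (y 0 _) (y 0 _) (x 0 _) (x 0 _) (x 0 _) (x 0 _).
    move=> y3 y2 y1 y0 x3 x2 x1' x0 hn e1.
    apply: (mulIf n0); apply/eqP; rewrite -subr_eq0; apply/eqP.
    transitivity ((y0 ^+ 2 + y1 ^+ 2 + y2 ^+ 2 + y3 ^+ 2 - n ^+ 2) * (1 - n)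
      + (x0 ^+ 2 + x1' ^+ 2 + x2 ^+ 2 + x3 ^+ 2 - 1) * (n ^+ 2 - n)).
      by field.
    by rewrite hn e1 !subrr !mul0r addr0.
  rewrite ler_pdivrMr; last lra.
  have D0 : 0 <= D by exact: sqn_ge0.
  have := sqr_ge0 (n - 1); nra.
rewrite -/n => hD; split => //.
apply: norm_lt_rV => // i.
have : (x 0 i - (n^-1 *: y) 0 i) ^+ 2 < d ^+ 2.
  apply: (@le_lt_trans _ _ (2 * D)); last lra.
  apply: le_trans hD; rewrite -[X in X <= _]sqrrN opprB.
  have -> : (n^-1 *: y) 0 i - x 0 i = (n^-1 *: y - x) 0 i by rewrite !mxE.
  move: (n^-1 *: y - x) i => z; rewrite /sqn.
  have := sqr_ge0 (z 0 (inord 0)); have := sqr_ge0 (z 0 (inord 1)).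
  have := sqr_ge0 (z 0 (inord 2)); have := sqr_ge0 (z 0 (inord 3)).
  by move=> h0 h1 h2 h3; apply: ord4P; lra.
rewrite -real_normK ?num_real // ltr_sqr ?nnegrE ?(ltW d0) //.
by rewrite !mxE.
Qed.

(** Near [co g], uniform continuity gives [e]. Where the squared distance is at least [h], the
    difference is at most [2 M], hence at most [2 M / h] times that distance. Both cases fit one
    quadratic majorant with [b] independent of [g], the input of [bern4_le]. *)
Lemma radial_close f : cont f -> forall e : R, 0 < e -> exists2 b : R, 0 <= b &
  forall g y, `|f g - radial f y| <= e + b * sqn (y - co g).
Proof.
move=> cf e e0; have [d d0 dP] := cont_unif cf e0; have [M M0 MP] := cont_bounded cf.
pose h := Num.min (1 / 4) (d ^+ 2 / 2).
have h0 : 0 < h by rewrite lt_min; apply/andP; split; [lra|rewrite divr_gt0 ?exprn_gt0].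
exists (2 * M / h) => [|g y].
  by rewrite divr_ge0 ?ltW // mulr_gt0.
have [Dh|hD] := ltP (sqn (y - co g)) h; last first.
  apply: (@le_trans _ _ (2 * M)).
    by rewrite (le_trans (ler_normB _ _)) // mulr_natl mulr2n; apply: lerD; exact: MP.
  apply: ler_wpDl; first exact: ltW.
  rewrite -(mulrA (2 * M)) ler_peMr //; first by rewrite mulr_ge0 // ltW.
  by rewrite mulrC ler_pdivlMr // mul1r.
apply: (@le_trans _ _ e); last first.
  by rewrite lerDl mulr_ge0 ?sqn_ge0 // divr_ge0 ?ltW // mulr_gt0.
apply/ltW/dP.
have D14 : sqn (y - co g) < 1 / 4 by rewrite (lt_le_trans Dh) // ge_min lexx.
have Dd : sqn (y - co g) < d ^+ 2 / 2 by rewrite (lt_le_trans Dh) // ge_min lexx orbT.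
have [z1 zd] := normalize_close d0 (sqn_co g) D14 Dd.
by rewrite co_pt.
Qed.

Lemma density f : cont f -> forall e : R, 0 < e -> exists2 q : SU2 R -> R,
  trig (fun g => (q g)%:C) & forall g, `|f g - q g| <= e.
Proof.
move=> cf e e0; have e2 : 0 < e / 2 by lra.
have [b b0 bP] := radial_close cf e2.
pose F y0 y1 y2 y3 := radial f (row4 y0 y1 y2 y3).
have [N NP] : exists N, b / N.+1%:R *+ 4 <= e / 2.
  pose N := Num.truncn (b * 8 / e); exists N.
  have : b * 8 / e < N.+1%:R by exact: truncnS_gt.
  rewrite ltr_pdivrMr // => h.
  have n0 : 0 < N.+1%:R :> R by rewrite ltr0n.
  rewrite -[_ *+ 4]mulr_natr mulrAC ler_pdivrMr //; lra.
exists (fun g => bern4 F N (co g)); first exact: trig_bern4.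
move=> g.
have FP y0 y1 y2 y3 : `|f g - F y0 y1 y2 y3| <= e / 2 +
     (b * (y0 - co g 0 (inord 0)) ^+ 2 + b * (y1 - co g 0 (inord 1)) ^+ 2 +
     b * (y2 - co g 0 (inord 2)) ^+ 2 + b * (y3 - co g 0 (inord 3)) ^+ 2).
  apply: (le_trans (bP g _)); rewrite lerD2l -!mulrDr /sqn.
  have rvB (u v : 'rV[R]_4) i : (u - v) 0 i = u 0 i - v 0 i by rewrite !mxE.
  by rewrite !rvB !row4E.
have ub : bern4 F N (co g) <= (f g + e / 2) + b / N.+1%:R *+ 4.
  apply: bern4_le (sqn_co g) b0 _ => y0 y1 y2 y3.
  by have := FP y0 y1 y2 y3; rewrite ler_norml; lra.
(* The majorant of the opposite function yields the bound from below. *)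
have lb : bern4 (fun y0 y1 y2 y3 => - F y0 y1 y2 y3) N (co g) <=
    (- f g + e / 2) + b / N.+1%:R *+ 4.
  apply: bern4_le (sqn_co g) b0 _ => y0 y1 y2 y3.
  by have := FP y0 y1 y2 y3; rewrite ler_norml; lra.
have bN t M (h : nat -> R) : bern t M (fun k => - h k) = - bern t M h.
  by elim: M h => [|M IH] h //=; rewrite !IH; ring.
have b4N : bern4 (fun y0 y1 y2 y3 => - F y0 y1 y2 y3) N (co g) = - bern4 F N (co g).
  rewrite /bern4 -bN; congr bern; apply/funext => k0; rewrite -bN; congr bern.
  apply/funext => k1; rewrite -bN; congr bern; apply/funext => k2; exact: bN.
rewrite b4N in lb; move: (bern4 F N (co g)) (b / _ *+ 4) NP ub lb => w z h1 h2 h3.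
rewrite ler_norml; apply/andP; split; lra.
Qed.

End Density.

(** * Invariance of the integral under right translations *)

Section Invariance.
Variable R : realType.
Local Notation C := R[i].

Lemma trig_mulr (f : SU2 R -> C) (k : SU2 R) : trig f -> trig (fun g => f (su2mul g k)).
Proof.
elim => [|n s t x y|f1 f2 _ h1 _ h2|c f1 _ h1].
- exact: trig0.
- by apply: trig_eq (trigG n s t _ _) => g; rewrite su2mulE bil_mul.
- exact: trigD.
- exact: trigZ.
Qed.

Lemma su2_int_eq (f h : SU2 R -> R) : f =1 h -> su2_integral f = su2_integral h.
Proof. by move/funext => ->. Qed.

Lemma su2_cintD (f h : SU2 R -> C) : ccont f -> ccont h ->
  su2_cint (fun g => f g + h g) = su2_cint f + su2_cint h.
Proof.
move=> [f1 f2] [h1 h2]; apply: complex_ext; rewrite ?cReD ?cImD /=.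
  by rewrite (su2_int_eq (fun g => cReD (f g) (h g))); exact: su2_intD.
by rewrite (su2_int_eq (fun g => cImD (f g) (h g))); exact: su2_intD.
Qed.

Lemma su2_cintZ c (f : SU2 R -> C) : ccont f ->
  su2_cint (fun g => c * f g) = c * su2_cint f.
Proof.
move=> [f1 f2]; apply: complex_ext; rewrite ?cReM ?cImM /=.
  rewrite (su2_int_eq (fun g => cReM c (f g))).
  by rewrite su2_intB ?su2_intZ //; exact: contZ.
rewrite (su2_int_eq (fun g => cImM c (f g))).
by rewrite su2_intD ?su2_intZ //; exact: contZ.
Qed.

(** A right translation gives a generator another column, and every generator with positive exponent
    has integral 0; exponent 0 gives a constant. *)
Lemma trig_cint_mulr (f : SU2 R -> C) (k : SU2 R) : trig f ->
  su2_cint (fun g => f (su2mul g k)) = su2_cint f.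
Proof.
elim => [|n s t x y|f1 f2 t1 h1 t2 h2|c f1 t1 h1].
- by [].
- case: n => [//|n].
  rewrite (su2_cint_bilX s t x y (ltn0Sn n)).
  under eq_fun do rewrite su2mulE bil_mul.
  exact: su2_cint_bilX.
- rewrite (su2_cintD (trig_ccont t1) (trig_ccont t2)) -h1 -h2.
  exact: su2_cintD (trig_ccont (trig_mulr k t1)) (trig_ccont (trig_mulr k t2)).
- rewrite (su2_cintZ c (trig_ccont t1)) -h1.
  exact: su2_cintZ (trig_ccont (trig_mulr k t1)).
Qed.

Lemma dist_le2 (x y z d : R) : `|z - y| <= d -> `|x - y| <= d -> `|z - x| <= d + d.
Proof. by rewrite !ler_norml => /andP[? ?] /andP[? ?]; apply/andP; split; lra. Qed.

(** Both sides are continuous in the uniform norm and agree on the dense space [trig]. *)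
Lemma su2_int_mulr (f : SU2 R -> R) (k : SU2 R) : cont f ->
  su2_integral (fun g => f (su2mul g k)) = su2_integral f.
Proof.
move=> cf; apply/eqP; rewrite -subr_eq0 -normr_le0.
have cfk := cont_mulr (k := k) cf; have v0 := su2_volume_gt0 R.
apply/ler_addgt0Pr => e e0; rewrite add0r.
have e1 : 0 < e / (su2_volume R *+ 2) by rewrite divr_gt0 // pmulrn_lgt0.
have [q tq qP] := density cf e1.
have cq : cont q := (trig_ccont tq).1.
have cqk := cont_mulr (k := k) cq.
have qE : su2_integral (fun g => q (su2mul g k)) = su2_integral q.
  by have := congr1 (@complex.Re R) (trig_cint_mulr k tq).
have h1 := su2_int_close cfk cqk (fun g => qP (su2mul g k)).
have h2 := su2_int_close cf cq qP.
rewrite qE in h1.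
have eE : e = e / (su2_volume R *+ 2) * su2_volume R + e / (su2_volume R *+ 2) * su2_volume R.
  by rewrite -mulr_natr; field; rewrite gt_eqF.
move: (e / (su2_volume R *+ 2) * su2_volume R) (su2_integral _) (su2_integral _)
  (su2_integral _) h1 h2 eE => d x y z h1 h2 ->.
exact: dist_le2 h1 h2.
Qed.

Lemma special_unitary_adj (g : SU2 R) : special_unitary (adjmx g).
Proof.
have := su2_det g; rewrite -det2E => d.
case: g d => g /= /andP[/eqP g1 _] d; apply/andP; split.
  have -> : adjmx (adjmx g) = g.
    by apply/matrixP => i j; rewrite !mxE conjcK.
  by rewrite (mulmx1C g1).
by rewrite /adjmx det_tr det_map_mx d rmorph1.
Qed.

Definition su2inv (g : SU2 R) : SU2 R := MkSU2 (special_unitary_adj g).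

Lemma su2_mulgV (g : SU2 R) : (g : 'M[C]_2) *m su2inv g = 1%:M.
Proof. by case: g => g /= /andP[/eqP g1 _]. Qed.

Lemma su2_mulVKg (g h : SU2 R) : su2mul g (su2mul (su2inv g) h) = h.
Proof. by apply: su2_inj; rewrite !su2mulE mulmxA su2_mulgV mul1mx. Qed.

Lemma su2_int_eq0_all (f : SU2 R -> R) : cont f -> (forall g, 0 <= f g) ->
  su2_integral f = 0 -> forall g, f g = 0.
Proof.
move=> cf f0 i0 g; pose h := hopf (pi / 4) pi pi : SU2 R.
pose k := su2mul (su2inv h) g.
have := su2_int_eq0 (cont_mulr (k := k) cf) (fun g => f0 _); rewrite su2_int_mulr // => /(_ i0).
by rewrite /k su2_mulVKg.
Qed.

End Invariance.

Transparent su2_integral su2_volume.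

(** * Derivatives along the frame *)

Opaque su2_cint.

Lemma is_derive_line (R : realType) (V : normedModType R) (F : V -> R) (z v : V)
  (phi : R -> R) (t0 d : R) : (forall h, phi (h + t0) = F (h *: v + z)) ->
  is_derive z v F d -> is_derive t0 1 phi d.
Proof.
move=> phiE [dF DF].
have E : (fun h : R => h^-1 *: ((phi \o shift t0) (h *: (1 : R)) - phi t0)) =
         (fun h : R => h^-1 *: ((F \o shift z) (h *: v) - F z)).
  apply/funext => h /=; congr (_ *: (_ - _)).
    by rewrite -phiE [h *: _]mulr1.
  by rewrite -[t0]add0r phiE scale0r add0r.
split; first by rewrite /derivable E.
by rewrite /derive E.
Qed.

Lemma is_derive_line_inv (R : realType) (V : normedModType R) (F : V -> R) (z v : V)
  (phi : R -> R) (t0 d : R) : (forall h, phi (h + t0) = F (h *: v + z)) ->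
  is_derive t0 1 phi d -> is_derive z v F d.
Proof.
move=> phiE [dF DF].
have E : (fun h : R => h^-1 *: ((phi \o shift t0) (h *: (1 : R)) - phi t0)) =
         (fun h : R => h^-1 *: ((F \o shift z) (h *: v) - F z)).
  apply/funext => h /=; congr (_ *: (_ - _)).
    by rewrite -phiE [h *: _]mulr1.
  by rewrite -[t0]add0r phiE scale0r add0r.
split; first by rewrite /derivable -E.
by rewrite /derive -E.
Qed.

Section OneParameter.
Variable R : realType.
Local Notation C := R[i].
Implicit Types (a : 'I_3) (g h : SU2 R) (s t : R).

Lemma exp_frameE a t : (exp_frame a t : 'M[C]_2) =
  (cos t)%:C *: 1%:M + (sin t)%:C *: frame R a.
Proof. by rewrite /= (mexp_root t (frame_sqr R a)). Qed.

Lemma exp_frameD a s t : su2mul (exp_frame a s) (exp_frame a t) = exp_frame a (s + t).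
Proof.
apply: su2_inj; rewrite su2mulE !exp_frameE cosD sinD.
rewrite mulmxDl !mulmxDr -!scalemxAl -!scalemxAr !mulmx1 !mul1mx frame_sqr !scalerA.
rewrite scalerN -!rmorphM !rmorphB !rmorphD /= scalerBl scalerDl.
rewrite -!addrA; congr (_ + _).
move: ((cos s * sin t)%:C *: frame R a) ((sin s * cos t)%:C *: frame R a)
  ((sin s * sin t)%:C *: 1%:M) => X Y Z.
by rewrite addrA [RHS]addrC [X + Y]addrC.
Qed.

Lemma su2mulA g h (k : SU2 R) : su2mul (su2mul g h) k = su2mul g (su2mul h k).
Proof. by apply: su2_inj; rewrite !su2mulE mulmxA. Qed.

Lemma exp_frame0 a : exp_frame a 0 = one2 R.
Proof. by apply: su2_inj; rewrite exp_frameE cos0 sin0 scale1r scale0r addr0. Qed.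

Lemma su2mulg1 g : su2mul g (one2 R) = g.
Proof. by apply: su2_inj; rewrite su2mulE mulmx1. Qed.

(** At time [pi / 2] the exponential is the frame matrix itself, so the tangent vector is again a
    point of the unit sphere and its coordinates are bounded by 1. *)
Definition tangent a g : 'rV[R]_4 := co (su2mul g (exp_frame a (pi / 2))).

Lemma tangentE a g : tangent a g = co ((g : 'M[C]_2) *m frame R a).
Proof. by rewrite /tangent su2mulE exp_frameE cos_pihalf sin_pihalf scale0r add0r scale1r. Qed.

Lemma coD (M N : 'M[C]_2) : co (M + N) = co M + co N.
Proof. by apply/rowP; apply: ord4P; rewrite [RHS]mxE !row4E mxE ?cReD ?cImD. Qed.

Lemma coZ s (M : 'M[C]_2) : co (s%:C *: M) = s *: co M.
Proof.
by apply/rowP; apply: ord4P; rewrite [RHS]mxE !row4E mxE ?cReM ?cImM /= mul0r ?subr0 ?addr0.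
Qed.

Lemma co_curve a g t : co (su2mul g (exp_frame a t)) = cos t *: co g + sin t *: tangent a g.
Proof.
by rewrite su2mulE exp_frameE mulmxDr -!scalemxAr mulmx1 coD !coZ tangentE.
Qed.

Lemma co_norm_le g i : `|co g 0 i| <= 1.
Proof. exact: sqn_coord_le (sqn_co g). Qed.

Lemma rvBE (u v : 'rV[R]_4) i : (u - v) 0 i = u 0 i - v 0 i.
Proof. by rewrite !mxE. Qed.
Lemma rvDE (u v : 'rV[R]_4) i : (u + v) 0 i = u 0 i + v 0 i.
Proof. by rewrite !mxE. Qed.
Lemma rvZE s (u : 'rV[R]_4) i : (s *: u) 0 i = s * u 0 i.
Proof. by rewrite !mxE. Qed.

Lemma curve_coord_le a g t i : `|co (su2mul g (exp_frame a t)) 0 i - co g 0 i| <= 2 * `|t|.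
Proof.
have -> : co (su2mul g (exp_frame a t)) 0 i - co g 0 i =
    (cos t - cos 0) * co g 0 i + (sin t - sin 0) * tangent a g 0 i.
  by rewrite co_curve rvDE !rvZE cos0 sin0; ring.
rewrite (le_trans (ler_normD _ _)) // !normrM mulr_natl mulr2n; apply: lerD.
  have := cos_lipschitz t 0; rewrite subr0; apply: le_trans.
  by rewrite ler_piMr // co_norm_le.
have := sin_lipschitz t 0; rewrite subr0; apply: le_trans.
by rewrite ler_piMr // co_norm_le.
Qed.

Lemma curve_close a g t d : 0 < d -> `|t| < d / 2 ->
  `|co g - co (su2mul g (exp_frame a t))| < d.
Proof.
move=> d0 td; apply: norm_lt_rV => // i; rewrite rvBE distrC.
by apply: (le_lt_trans (curve_coord_le a g t i)); lra.
Qed.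

End OneParameter.

Definition dX (R : realType) (a : 'I_3) (f : SU2 R -> R) (g : SU2 R) : R :=
  derive1 (fun t : R => f (su2mul g (exp_frame a t))) 0.

(** The regularity on which integration by parts rests; smooth functions on SU(2) have it by
    [smooth_cont1]. *)
Definition cont1 (R : realType) (f : SU2 R -> R) : Prop :=
  cont f /\ forall a, (forall g, derivable (fun t : R => f (su2mul g (exp_frame a t))) 0 1)
    /\ cont (dX a f).

Section FrameDerivative.
Variable R : realType.
Local Notation C := R[i].
Implicit Types (a : 'I_3) (g h : SU2 R) (f : SU2 R -> R).

Lemma cont1_cont f : cont1 f -> cont f. Proof. by case. Qed.

Lemma dX_is_derive a f g (t : R) : cont1 f ->
  is_derive t 1 (fun t : R => f (su2mul g (exp_frame a t)))
    (dX a f (su2mul g (exp_frame a t))).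
Proof.
move=> [_ /(_ a)[df _]]; have := df (su2mul g (exp_frame a t)).
move/derivableP; rewrite -derive1E -/(dX a f _).
apply: is_derive_line => h /=.
by rewrite su2mulA exp_frameD [h *: _]mulr1 addr0 addrC.
Qed.

Lemma dX_is_derive0 a f g : cont1 f ->
  is_derive (0 : R) 1 (fun t : R => f (su2mul g (exp_frame a t))) (dX a f g).
Proof. by move=> cf; have := dX_is_derive a g 0 cf; rewrite exp_frame0 su2mulg1. Qed.

Lemma dXP a f g d : is_derive (0 : R) 1 (fun t : R => f (su2mul g (exp_frame a t))) d ->
  dX a f g = d.
Proof. by move=> df; rewrite /dX derive1E; apply: derive_val. Qed.

Lemma cont1I f (D : 'I_3 -> SU2 R -> R) : cont f ->
  (forall a g, is_derive (0 : R) 1 (fun t : R => f (su2mul g (exp_frame a t))) (D a g)) ->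
  (forall a, cont (D a)) -> cont1 f /\ forall a g, dX a f g = D a g.
Proof.
move=> cf dD cD; have E a g : dX a f g = D a g by apply: dXP; exact: dD.
split=> //; split => // a; split => [g|]; first by have [] := dD a g.
by apply: cont_eq (cD a) => g; rewrite E.
Qed.

Lemma cont1_cst (c : R) : cont1 (fun _ : SU2 R => c).
Proof.
have [] // := @cont1I (fun=> c) (fun _ _ => 0) (@cont_cst R c).
by move=> a; exact: cont_cst.
Qed.

Lemma dXD_aux f1 f2 : cont1 f1 -> cont1 f2 -> cont1 (fun g => f1 g + f2 g) /\
  forall a g, dX a (fun g => f1 g + f2 g) g = dX a f1 g + dX a f2 g.
Proof.
move=> c1 c2; apply: cont1I.
- by apply: contD; exact: cont1_cont.
- by move=> a g; exact: is_deriveD (dX_is_derive0 a g c1) (dX_is_derive0 a g c2).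
- by move=> a; have [_ /(_ a)[_ ?]] := c1; have [_ /(_ a)[_ ?]] := c2; exact: contD.
Qed.

Lemma dXM_aux f1 f2 : cont1 f1 -> cont1 f2 -> cont1 (fun g => f1 g * f2 g) /\
  forall a g, dX a (fun g => f1 g * f2 g) g = dX a f1 g * f2 g + f1 g * dX a f2 g.
Proof.
move=> c1 c2; apply: cont1I.
- by apply: contM; exact: cont1_cont.
- move=> a g.
  apply: (is_derive_eq (is_deriveM (dX_is_derive0 a g c1) (dX_is_derive0 a g c2))).
  by rewrite /= exp_frame0 su2mulg1 /GRing.scale /= addrC mulrC.
- move=> a; have [? /(_ a)[_ ?]] := c1; have [? /(_ a)[_ ?]] := c2.
  by apply: contD; apply: contM.
Qed.

(** The difference quotients for right translation by [exp_frame a t] have integral 0 by invariance,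
    and by the mean value theorem they are uniformly close to [dX a f] when [t] is small. *)
Lemma int_dX a f : cont1 f -> su2_integral (dX a f) = 0.
Proof.
move=> cf; have cdf : cont (dX a f) by have [_ /(_ a)[]] := cf.
have cf0 := cont1_cont cf; have v0 := su2_volume_gt0 R.
apply/eqP; rewrite -normr_le0; apply/ler_addgt0Pr => e e0; rewrite add0r.
have e1 : 0 < e / su2_volume R by rewrite divr_gt0.
have [d d0 dP] := cont_unif cdf e1.
pose t := d / 4; have t0 : 0 < t by rewrite /t; lra.
pose ft g := f (su2mul g (exp_frame a t)).
have cft : cont ft by apply: cont_mulr.
have ift : su2_integral (fun g => ft g - f g) = 0.
  by rewrite (su2_intB cft cf0) (su2_int_mulr _ cf0) subrr.
have cq := @contZ R t^-1 _ (contB cft cf0).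
have iq : su2_integral (fun g => t^-1 * (ft g - f g)) = 0.
  by rewrite (su2_intZ t^-1 (contB cft cf0)) ift mulr0.
have := su2_int_close cdf cq (e := e / su2_volume R).
rewrite iq subr0 divfK ?gt_eqF //; apply => g.
pose phi s := f (su2mul g (exp_frame a s)).
have dphi (s : R) : is_derive s 1 phi (dX a f (su2mul g (exp_frame a s))) by exact: dX_is_derive.
have cphi s : {for s, continuous phi}.
  by apply: differentiable_continuous; apply/derivable1_diffP.
have [c c0t] := MVT t0 (fun s _ => dphi s) (continuous_subspaceT cphi).
rewrite subr0 {1 2}/phi exp_frame0 su2mulg1 -/(ft g) => ->.
rewrite mulrC mulfK ?gt_eqF // ltW //; apply: dP; apply: curve_close => //.
move: c0t d0; rewrite /t in_itv /=; clear => /andP[c0 ct] d0.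
by rewrite ger0_norm ?ltW //; lra.
Qed.

End FrameDerivative.

Transparent su2_cint.

(** * From smooth extensions on R^4 to derivatives along the frame *)

Section Differentiability.
Variable R : realType.
Implicit Types (F : 'rV[R]_4 -> R) (x y z : 'rV[R]_4).

Let del i : 'rV[R]_4 := delta_mx 0 i.

Lemma delE i j s z : (s *: del i + z) 0 j = (j == i)%:R * s + z 0 j.
Proof. by rewrite !mxE eqxx mulrC. Qed.

Lemma convex_lt (p q d t : R) : 0 <= t <= 1 -> p < d -> q < d -> (1 - t) * p + t * q < d.
Proof.
move=> /andP[t0 t1] pd qd; have m : Num.max p q < d by rewrite gt_max pd.
apply: le_lt_trans m; have t1' : 0 <= 1 - t by lra.
have := ler_wpM2l t1' (_ : p <= Num.max p q); rewrite le_max lexx => /(_ isT) h1.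
have := ler_wpM2l t0 (_ : q <= Num.max p q); rewrite le_max lexx orbT => /(_ isT) h2.
by move: (Num.max p q) h1 h2 => M h1 h2; lra.
Qed.

(** The mean value theorem along a coordinate segment, which stays in the ball of the maximum norm
    because its end points do. *)
Lemma partial_step F x z i (s d e : R) : 0 < d ->
  (forall y, `|x - y| < d -> derivable F y (del i)) ->
  (forall y, `|x - y| < d -> `|'D_(del i) F y - 'D_(del i) F x| <= e) ->
  `|x - z| < d -> `|x - (s *: del i + z)| < d ->
  `|F (s *: del i + z) - F z - s * 'D_(del i) F x| <= e * `|s|.
Proof.
move=> d0 dF De xz xsz.
have seg t : 0 <= t <= 1 -> `|x - ((t * s) *: del i + z)| < d.
  move=> /andP[t0 t1]; apply: norm_lt_rV => // j; rewrite rvBE delE.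
  have h1 := le_lt_trans (coord_norm_le _ j) xz.
  have h2 := le_lt_trans (coord_norm_le _ j) xsz.
  rewrite rvBE in h1; rewrite rvBE delE in h2.
  move: h1 h2; case: (j == i); rewrite ?mul1r ?mul0r ?add0r //.
  move: (x 0 j) (z 0 j) => p q; rewrite !ltr_norml => /andP[u1 u2] /andP[u3 u4].
  have -> : p - (t * s + q) = (1 - t) * (p - q) + t * (p - (s + q)) by ring.
  have t01 : 0 <= t <= 1 by rewrite t0 t1.
  rewrite convex_lt // andbT ltrNl opprD -!mulrN; apply: convex_lt => //; lra.
pose phi t := F ((t * s) *: del i + z).
have dphi t : 0 <= t <= 1 ->
    is_derive (t : R) 1 phi (s * 'D_(del i) F ((t * s) *: del i + z)).
  move=> t01.
  have h1 : is_derive (t * s) 1 (fun u => F (u *: del i + z))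
      ('D_(del i) F ((t * s) *: del i + z)).
    apply: (is_derive_line _ (derivableP (dF _ (seg t t01)))) => h.
    by rewrite scalerDl addrA.
  have dm : is_derive (t : R) 1 (fun u => u * s) s.
    apply: (is_derive_eq (is_deriveM (is_derive_id (t : R) 1) (is_derive_cst s (t : R) 1))).
    by rewrite scaler0 add0r [LHS]mulr1.
  rewrite mulrC; exact: (@is_derive1_comp R (fun u => F (u *: del i + z)) (fun u => u * s) t _ _ h1 dm).
have cphi : {within `[0, 1], continuous phi}.
  apply: derivable_within_continuous => t; rewrite in_itv /= => t01.
  by have [] := dphi t t01.
have dphi' t : t \in `]0, 1[%R -> is_derive (t : R) 1 phi
    (s * 'D_(del i) F ((t * s) *: del i + z)).
  by rewrite in_itv /= => /andP[t0 t1]; apply: dphi; rewrite !ltW.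
have [c c01] := MVT ltr01 dphi' cphi.
rewrite subr0 mulr1 /phi mul1r mul0r scale0r add0r => ->.
rewrite -mulrBr normrM mulrC ler_wpM2r //; apply: De; apply: seg.
by move: c01; rewrite in_itv /= => /andP[? ?]; rewrite !ltW.
Qed.

Definition gradient F x y : R := \sum_(i < 4) y 0 i * 'D_(del i) F x.

Lemma sum4E (u : 'I_4 -> R) :
  \sum_(i < 4) u i = u (inord 0) + u (inord 1) + u (inord 2) + u (inord 3).
Proof.
rewrite !big_ord_recl big_ord0 addr0 !addrA.
by congr (_ + _ + _ + _); congr u; apply: val_inj; rewrite /= inordK.
Qed.

Lemma telescope4 (a b c d e p q r s : R) : e - a - (p + q + r + s) =
  (b - a - p) + (c - b - q) + (d - c - r) + (e - d - s).
Proof. ring. Qed.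

(** Going from [x] to [y] one coordinate at a time never leaves the ball of the maximum norm, so
    [partial_step] applies four times. This is how continuous partial derivatives give total
    differentiability. *)
Lemma partial_close F x (d e : R) : 0 < d -> 0 <= e ->
  (forall i y, `|x - y| < d -> derivable F y (del i)) ->
  (forall i y, `|x - y| < d -> `|'D_(del i) F y - 'D_(del i) F x| <= e) ->
  forall y, `|x - y| < d ->
  `|F y - F x - gradient F x (y - x)| <= e * \sum_(i < 4) `|(y - x) 0 i|.
Proof.
move=> d0 e0 dF De y xy.
pose h i := (y - x) 0 (inord i) : R.
have hd i : `|h i| < d.
  by rewrite /h (le_lt_trans (coord_norm_le _ _)) // distrC.
pose z1 := h 0%N *: del (inord 0) + x.
pose z2 := h 1%N *: del (inord 1) + z1.
pose z3 := h 2%N *: del (inord 2) + z2.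
pose z4 := h 3%N *: del (inord 3) + z3.
have zc (z : 'rV[R]_4) : (forall k, (k < 4)%N -> `|(x - z) 0 (inord k)| < d) -> `|x - z| < d.
  by move=> zk; apply: norm_lt_rV => //; apply: ord4P; exact: zk.
have neq j k : (j < 4)%N -> (k < 4)%N -> (inord j == inord k :> 'I_4) = (j == k).
  by move=> j4 k4; rewrite -val_eqE /= !inordK.
have hN k : `|x 0 (inord k) - (1%:R * h k + x 0 (inord k))| < d.
  by rewrite mul1r opprD addrCA subrr addr0 normrN.
have hZ (k : nat) : `|x 0 (inord k) - x 0 (inord k)| < d by rewrite subrr normr0.
have x1 : `|x - z1| < d.
  apply: zc => k k4; rewrite rvBE !delE.
  by case: k k4 => [|[|[|[|//]]]] _; rewrite !neq //= ?(mul0r, add0r).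
have x2 : `|x - z2| < d.
  apply: zc => k k4; rewrite rvBE !delE.
  by case: k k4 => [|[|[|[|//]]]] _; rewrite !neq //= ?(mul0r, add0r).
have x3 : `|x - z3| < d.
  apply: zc => k k4; rewrite rvBE !delE.
  by case: k k4 => [|[|[|[|//]]]] _; rewrite !neq //= ?(mul0r, add0r).
have z4y : z4 = y.
  apply/rowP; apply: ord4P; rewrite !delE !neq //= !(mul0r, add0r, mul1r) /h rvBE subrK //.
have x4 : `|x - z4| < d by rewrite z4y.
have x0 : `|x - x| < d by rewrite subrr normr0.
have s1 := partial_step d0 (dF (inord 0)) (De (inord 0)) x0 x1.
have s2 := partial_step d0 (dF (inord 1)) (De (inord 1)) x1 x2.
have s3 := partial_step d0 (dF (inord 2)) (De (inord 2)) x2 x3.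
have s4 := partial_step d0 (dF (inord 3)) (De (inord 3)) x3 x4.
rewrite /gradient !sum4E -z4y -/z1 -/z2 -/z3 -/z4 in s1 s2 s3 s4 *; rewrite z4y.
rewrite -!/(h _).
have E : F y - F x - (h 0%N * 'D_(del (inord 0)) F x + h 1%N * 'D_(del (inord 1)) F x +
   h 2%N * 'D_(del (inord 2)) F x + h 3%N * 'D_(del (inord 3)) F x) =
   (F z1 - F x - h 0%N * 'D_(del (inord 0)) F x) +
   (F z2 - F z1 - h 1%N * 'D_(del (inord 1)) F x) +
   (F z3 - F z2 - h 2%N * 'D_(del (inord 2)) F x) +
   (F z4 - F z3 - h 3%N * 'D_(del (inord 3)) F x).
  by rewrite z4y; exact: telescope4.
rewrite E !mulrDr.
do 3 (rewrite (le_trans (ler_normD _ _)) // lerD //).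
Qed.

Lemma is_derive_little_o (u : R -> R) : u 0 = 0 ->
  (forall e : R, 0 < e -> \forall t \near (0 : R), `|u t| <= e * `|t|) ->
  is_derive (0 : R) 1 u 0.
Proof.
move=> u0 uo.
have L : (fun h : R => h^-1 *: ((u \o shift 0) (h *: (1 : R)) - u 0)) @ 0^' --> (0 : R).
  apply/cvgrPdist_le => e e0; have un := uo e e0.
  rewrite /dnbhs near_withinE; move: un; apply: filterS => t ut t0.
  rewrite sub0r normrN u0 subr0 /= addr0 [t *: _]mulr1 normrM normfV.
  by rewrite mulrC ler_pdivrMr ?normr_gt0.
split; first by apply/cvg_ex; exists 0.
exact: cvg_lim.
Qed.

Lemma is_derive_curve F x y (d0 : R) : 0 < d0 ->
  (forall i z, `|x - z| < d0 -> derivable F z (del i)) ->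
  (forall i, {for x, continuous ('D_(del i) F)}) ->
  (forall i, `|x 0 i| <= 1) -> (forall i, `|y 0 i| <= 1) ->
  is_derive (0 : R) 1 (fun t => F (cos t *: x + sin t *: y)) (gradient F x y).
Proof.
move=> d00 dF cD x1 y1.
pose ga t := cos t *: x + sin t *: y : 'rV[R]_4.
have ga0 : ga 0 = x by rewrite /ga cos0 sin0 scale1r scale0r addr0.
have gax t i : `|(ga t - x) 0 i| <= 2 * `|t|.
  have -> : (ga t - x) 0 i = (cos t - cos 0) * x 0 i + (sin t - sin 0) * y 0 i.
    by rewrite rvBE rvDE !rvZE cos0 sin0; ring.
  rewrite (le_trans (ler_normD _ _)) // !normrM mulr_natl mulr2n; apply: lerD.
    have := cos_lipschitz t 0; rewrite subr0; apply: le_trans.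
    by rewrite ler_piMr.
  have := sin_lipschitz t 0; rewrite subr0; apply: le_trans.
  by rewrite ler_piMr.
have dl : is_derive (0 : R) 1 (fun t => gradient F x (ga t - x)) (gradient F x y).
  have -> : (fun t => gradient F x (ga t - x)) =
      gradient F x x *: (cos - cst 1 : R -> R) + gradient F x y *: (sin : R -> R).
    apply/funext => t.
    transitivity (gradient F x x * (cos t - 1) + gradient F x y * sin t) => //.
    rewrite /gradient !mulr_suml -big_split /=.
    apply: eq_bigr => i _; rewrite rvBE rvDE !rvZE; ring.
  apply: (is_derive_eq (is_deriveD
    (is_deriveZ (gradient F x x) (is_deriveB (is_derive_cos 0) (is_derive_cst (1 : R) (0 : R) 1)))
    (is_deriveZ (gradient F x y) (is_derive_sin 0)))).
  by rewrite sin0 cos0 oppr0 addr0 scaler0 add0r [LHS]mulr1.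
have dr : is_derive (0 : R) 1 (fun t => F (ga t) - F x - gradient F x (ga t - x)) 0.
  apply: is_derive_little_o.
    by rewrite ga0 !subrr /gradient big1 ?subrr // => i _; rewrite mxE mul0r.
  (* Each of the four coordinates moves by at most [2 * |t|], whence the 8. *)
  move=> e e0; have e8 : 0 < e / 8 by lra.
  have [d dpos [dd0 dP]] : exists2 d, 0 < d & d <= d0 /\ forall i z, `|x - z| < d ->
      `|'D_(del i) F z - 'D_(del i) F x| <= e / 8.
    have D i : exists2 d, 0 < d & forall z, `|x - z| < d ->
        `|'D_(del i) F z - 'D_(del i) F x| <= e / 8.
      have /cvgrPdist_le /(_ _ e8) := cD i.
      rewrite -nbhs_nearE => /nbhs_ballP[d /= dp dB]; exists d => // z xz.
      by rewrite distrC; apply: dB; rewrite -ball_normE.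
    have [d1 p1 P1] := D (inord 0); have [d2 p2 P2] := D (inord 1).
    have [d3 p3 P3] := D (inord 2); have [d4 p4 P4] := D (inord 3).
    exists (Num.min d0 (Num.min (Num.min d1 d2) (Num.min d3 d4))).
      by rewrite !lt_min d00 p1 p2 p3.
    split; first by rewrite ge_min lexx.
    move=> i z; rewrite !lt_min => /andP[_ /andP[/andP[h1 h2] /andP[h3 h4]]].
    by move: i; apply: ord4P; auto.
  have Pc := partial_close dpos (ltW e8) (fun i z zd => dF i z (lt_le_trans zd dd0)) dP.
  apply/nbhs_ballP; exists (d / 2) => /=; first by rewrite divr_gt0.
  move=> t; rewrite /ball /= sub0r normrN => td.
  have := Pc (ga t); have -> : `|x - ga t| < d.
    apply: norm_lt_rV => // i; rewrite rvBE distrC -rvBE.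
    apply: (le_lt_trans (gax t i)); rewrite mulrC -ltr_pdivlMr //.
  move=> /(_ isT) /le_trans; apply.
  have S : \sum_(i < 4) `|(ga t - x) 0 i| <= 8 * `|t|.
    have -> : 8 * `|t| = \sum_(i < 4) 2 * `|t| by rewrite sumr_const card_ord -mulr_natr; ring.
    by apply: ler_sum => i _.
  have -> : e * `|t| = e / 8 * (8 * `|t|) by field.
  by rewrite ler_pM2l.
have -> : (fun t => F (cos t *: x + sin t *: y)) =
    (fun t => F (ga t) - F x - gradient F x (ga t - x)) +
    (fun t => gradient F x (ga t - x)) + cst (F x).
  apply/funext => t.
  transitivity (F (ga t) - F x - gradient F x (ga t - x) + gradient F x (ga t - x) + F x) => //.
  by rewrite !subrK.
by apply: (is_derive_eq (is_deriveD (is_deriveD dr dl) (is_derive_cst (F x) (0 : R) 1)));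
  rewrite add0r addr0.
Qed.

Lemma continuous_entry i x : {for x, continuous (fun z : 'rV[R]_4 => z 0 i)}.
Proof. exact: (@coord_continuous R 1 4 0 i x). Qed.

Lemma near_sphere (f : SU2 R -> R) (g : SU2 R) (G : 'rV[R]_4 -> R) (U : set 'rV[R]_4) :
  open U -> U (co g) -> {for co g, continuous G} ->
  (forall h : SU2 R, U (co h) -> G (co h) = f h) ->
  forall e : R, 0 < e -> exists2 d : R, 0 < d &
    forall h : SU2 R, `|co g - co h| < d -> `|f g - f h| < e.
Proof.
move=> oU Ug cG GE e e0.
have /cvgrPdist_lt /(_ _ e0) := cG; rewrite -nbhs_nearE => /nbhs_ballP[d1 /= p1 P1].
have /nbhs_ballP[d2 /= p2 P2] : nbhs (co g) U by exact: open_nbhs_nbhs.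
exists (Num.min d1 d2); first by rewrite lt_min p1.
move=> h; rewrite lt_min => /andP[h1 h2].
have Uh : U (co h) by apply: P2; rewrite -ball_normE.
by rewrite -!GE //; apply: P1; rewrite -ball_normE.
Qed.

Lemma co_comb_mul (r0 r1 r2 r3 : R) (A0 A1 A2 A3 B : 'M[R[i]]_2) i :
  co ((r0%:C *: A0 + r1%:C *: A1 + r2%:C *: A2 + r3%:C *: A3) *m B) 0 i =
  r0 * co (A0 *m B) 0 i + r1 * co (A1 *m B) 0 i + r2 * co (A2 *m B) 0 i + r3 * co (A3 *m B) 0 i.
Proof.
rewrite !mulmxDl -!scalemxAl; move: (A0 *m B) (A1 *m B) (A2 *m B) (A3 *m B) => M0 M1 M2 M3.
by rewrite !coD !rvDE !coZ !rvZE.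
Qed.

(** The chain rule along the great circle through [g] expresses [dX a f] by the first partial
    derivatives of a local extension, which are continuous. *)
Lemma smooth_cont1 (f : SU2 R -> R) : smooth f -> cont1 f.
Proof.
move=> sf.
have loc (g : SU2 R) : exists (U : set 'rV[R]_4) (F : 'rV[R]_4 -> R), [/\ open U, U (co g),
    (forall x, U x -> {for x, continuous F}),
    (forall i x, U x -> derivable F x (del i) /\ {for x, continuous ('D_(del i) F)})
    & forall h : SU2 R, U (co h) -> F (co h) = f h].
  have [U [F [oU [x Ux xg] CF FE]]] := sf g; exists U, F; split => //.
  - by rewrite -xg quatK.
  - by have [] := CF 0%N.
  - by move=> i y Uy; have [_ /(_ i)[dF [cF _]]] := CF 1%N; split; [exact: dF|exact: cF].
  - by move=> h Uh; apply: FE => //; rewrite coK.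
have dU (U : set 'rV[R]_4) (F : 'rV[R]_4 -> R) a (g : SU2 R) : open U -> U (co g) ->
    (forall i x, U x -> derivable F x (del i) /\ {for x, continuous ('D_(del i) F)}) ->
    (forall h : SU2 R, U (co h) -> F (co h) = f h) ->
    is_derive (0 : R) 1 (fun t => f (su2mul g (exp_frame a t)))
      (gradient F (co g) (tangent a g)).
  move=> oU Ug dF FE.
  have /nbhs_ballP[d /= d0 dU] : nbhs (co g) U by exact: open_nbhs_nbhs.
  have D := @is_derive_curve F (co g) (tangent a g) d d0.
  have {}D : is_derive (0 : R) 1 (fun t => F (cos t *: co g + sin t *: tangent a g))
      (gradient F (co g) (tangent a g)).
    apply: D => i; [move=> z zd|..].
    - by have [] := dF i z (dU z _) => //; rewrite -ball_normE.
    - by have [] := dF i (co g) Ug.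
    - exact: co_norm_le.
    - exact: co_norm_le.
  (* The extension agrees with [f] only near [g], so the two curves are compared through a
     difference that vanishes for small [t]. *)
  have z0 : is_derive (0 : R) 1 (fun t => f (su2mul g (exp_frame a t)) -
      F (cos t *: co g + sin t *: tangent a g)) 0.
    apply: is_derive_little_o.
      by rewrite -co_curve exp_frame0 su2mulg1 FE // subrr.
    move=> e e0; apply/nbhs_ballP; exists (d / 2) => /=; first by rewrite divr_gt0.
    move=> t; rewrite /ball /= sub0r normrN => td; rewrite -co_curve FE; last first.
      by apply: dU; rewrite -ball_normE /=; apply: curve_close.
    by rewrite subrr normr0 mulr_ge0 // ltW.
  have -> : (fun t => f (su2mul g (exp_frame a t))) =
      (fun t => f (su2mul g (exp_frame a t)) - F (cos t *: co g + sin t *: tangent a g)) +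
      (fun t => F (cos t *: co g + sin t *: tangent a g)).
    by apply/funext => t /=; rewrite [RHS]/= subrK.
  by apply: (is_derive_eq (is_deriveD z0 D)); rewrite add0r.
split.
  apply/contP => g; have [U [F [oU Ug cF dF FE]]] := loc g.
  exact: near_sphere oU Ug (cF _ Ug) FE.
move=> a; split => [g|].
  by have [U [F [oU Ug cF dF FE]]] := loc g; have [] := dU U F a g oU Ug dF FE.
apply/contP => g; have [U [F [oU Ug cF dF FE]]] := loc g.
have dE (h : SU2 R) : U (co h) -> dX a f h = gradient F (co h) (tangent a h).
  by move=> Uh; apply: dXP; exact: (dU U F a h oU Uh dF FE).
(* A linear extension of the tangent field to R^4, so that continuity of the derivative can be
   checked there. *)
pose tl (x : 'rV[R]_4) : 'rV[R]_4 := co (quat x *m frame R a).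
have tlE (h : SU2 R) : tl (co h) = tangent a h by rewrite /tl coK tangentE.
have ctl i x : {for x, continuous (fun z => tl z 0 i)}.
  have tlD (z : 'rV[R]_4) : tl z 0 i = z 0 (inord 0) * co (1%:M *m frame R a) 0 i
      + z 0 (inord 1) * co (mxI R *m frame R a) 0 i
      + z 0 (inord 2) * co (mxJ R *m frame R a) 0 i
      + z 0 (inord 3) * co (mxK R *m frame R a) 0 i.
    exact: co_comb_mul.
  rewrite (funext tlD).
  have cM k (c : R) : (z : 'rV[R]_4) 0 k * c @[z --> x] --> x 0 k * c.
    have ce : (z : 'rV[R]_4) 0 k @[z --> x] --> x 0 k by exact: continuous_entry.
    exact: (cvgM ce (cvg_cst c)).
  exact: (cvgD (cvgD (cvgD (cM _ _) (cM _ _)) (cM _ _)) (cM _ _)).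
apply: (near_sphere (G := fun x => gradient F x (tl x)) oU Ug) => [|h Uh]; last first.
  by rewrite dE // tlE.
have -> : (fun x => gradient F x (tl x)) = (fun x =>
    tl x 0 (inord 0) * 'D_(del (inord 0)) F x + tl x 0 (inord 1) * 'D_(del (inord 1)) F x +
    tl x 0 (inord 2) * 'D_(del (inord 2)) F x + tl x 0 (inord 3) * 'D_(del (inord 3)) F x).
  by apply/funext => x; exact: sum4E.
have cE i : {for co g, continuous (fun x => tl x 0 i * 'D_(del i) F x)}.
  by have [_ c] := dF i (co g) Ug; exact: (cvgM (ctl i (co g)) c).
exact: (cvgD (cvgD (cvgD (cE _) (cE _)) (cE _)) (cE _)).
Qed.

End Differentiability.

(** * Polynomials are smooth on SU(2) *)

Inductive polyfun (R : realType) : ('rV[R]_4 -> R) -> Prop :=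
| polyfun_cst c : polyfun (fun=> c)
| polyfun_coord i : polyfun (fun x => x 0 i)
| polyfunD F G : polyfun F -> polyfun G -> polyfun (fun x => F x + G x)
| polyfunM F G : polyfun F -> polyfun G -> polyfun (fun x => F x * G x).

Section PolynomialsAreSmooth.
Variable R : realType.
Local Notation C := R[i].
Implicit Types (F G : 'rV[R]_4 -> R).

Lemma polyfun_eq F G : F =1 G -> polyfun F -> polyfun G.
Proof. by move/funext => ->. Qed.

Lemma polyfun_continuous F : polyfun F -> forall x, {for x, continuous F}.
Proof.
elim => [c|i|F1 G1 _ h1 _ h2|F1 G1 _ h1 _ h2] x.
- by apply: cst_continuous.
- exact: continuous_entry.
- exact: (cvgD (h1 x) (h2 x)).
- exact: (cvgM (h1 x) (h2 x)).
Qed.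

Lemma is_derive_coord i (x v : 'rV[R]_4) : is_derive x v (fun y : 'rV[R]_4 => y 0 i : R) (v 0 i).
Proof.
apply: (@is_derive_line_inv R _ (fun y : 'rV[R]_4 => y 0 i) x v
  (fun h => h * v 0 i + x 0 i) 0 (v 0 i)).
  by move=> h; rewrite addr0 !mxE.
apply: (is_derive_eq (is_deriveD (is_deriveM (is_derive_id (0 : R) 1)
  (is_derive_cst (v 0 i) (0 : R) 1)) (is_derive_cst (x 0 i) (0 : R) 1))).
by rewrite scaler0 add0r addr0 [LHS]mulr1.
Qed.

Lemma polyfun_derive F (v : 'rV[R]_4) : polyfun F ->
  (forall x, derivable F x v) /\ polyfun ('D_v F).
Proof.
elim => [c|i|F1 G1 p1 [d1 e1] p2 [d2 e2]|F1 G1 p1 [d1 e1] p2 [d2 e2]].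
- split => [x|]; first exact: derivable_cst.
  by apply: polyfun_eq (polyfun_cst 0) => x; rewrite derive_cst.
- split => [x|]; first by have [] := is_derive_coord i x v.
  by apply: polyfun_eq (polyfun_cst (v 0 i)) => x; have [_ ->] := is_derive_coord i x v.
- split => [x|]; first exact: derivableD.
  by apply: polyfun_eq (polyfunD e1 e2) => x; rewrite deriveD.
- split => [x|]; first exact: derivableM.
  by apply: polyfun_eq (polyfunD (polyfunM p1 e2) (polyfunM p2 e1)) => x; rewrite deriveM.
Qed.

Lemma polyfun_Ck F n (U : set 'rV[R]_4) : polyfun F -> Ck n U F.
Proof.
elim: n F => [|n IH] F pF; split => //; try by move=> x _; exact: polyfun_continuous.
move=> i; have [dF pD] := polyfun_derive (delta_mx 0 i) pF.
by split; [move=> x _; exact: dF|exact: IH].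
Qed.

Lemma polyfun_smooth F (f : SU2 R -> R) : polyfun F ->
  (forall g : SU2 R, F (co g) = f g) -> smooth f.
Proof.
move=> pF FE g; exists setT, F; split => //.
- exact: openT.
- by exists (co g) => //; rewrite coK.
- by move=> n; exact: polyfun_Ck.
- by move=> x h _ xh; rewrite -FE -xh quatK.
Qed.

Definition cpol (f : SU2 R -> C) : Prop := exists2 F : 'rV[R]_4 -> C,
  polyfun (fun x => complex.Re (F x)) /\ polyfun (fun x => complex.Im (F x)) &
  forall g : SU2 R, F (co g) = f g.

Lemma cpol_eq f h : f =1 h -> cpol f -> cpol h.
Proof. by move/funext => ->. Qed.

Lemma cpol_cst c : cpol (fun=> c).
Proof. by exists (fun=> c) => //; split; exact: polyfun_cst. Qed.

Lemma cpolD f h : cpol f -> cpol h -> cpol (fun g => f g + h g).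
Proof.
move=> [F [F1 F2] FE] [H [H1 H2] HE]; exists (fun x => F x + H x); last by move=> g; rewrite FE HE.
split; first by apply: polyfun_eq (polyfunD F1 H1) => x; rewrite cReD.
by apply: polyfun_eq (polyfunD F2 H2) => x; rewrite cImD.
Qed.

Lemma cpolM f h : cpol f -> cpol h -> cpol (fun g => f g * h g).
Proof.
move=> [F [F1 F2] FE] [H [H1 H2] HE]; exists (fun x => F x * H x); last by move=> g; rewrite FE HE.
split.
  apply: polyfun_eq (polyfunD (polyfunM F1 H1)
    (polyfunM (polyfun_cst (-1)) (polyfunM F2 H2))) => x.
  by rewrite cReM mulN1r.
by apply: polyfun_eq (polyfunD (polyfunM F1 H2) (polyfunM F2 H1)) => x; rewrite cImM.
Qed.

Lemma cpolX f n : cpol f -> cpol (fun g => f g ^+ n).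
Proof.
move=> pf; elim: n => [|n IH]; first exact: cpol_cst.
by apply: cpol_eq (cpolM pf IH) => g; rewrite exprS.
Qed.

Lemma cpol_entry (i j : 'I_2) : cpol (fun g : SU2 R => (g : 'M[C]_2) i j).
Proof.
exists (fun x => quat x i j); last by move=> g; rewrite coK.
have E (x : 'rV[R]_4) : quat x = mx2 (x 0 (inord 0) +i* x 0 (inord 1)) (x 0 (inord 2) +i* x 0 (inord 3))
    (- x 0 (inord 2) +i* x 0 (inord 3)) (x 0 (inord 0) -i* x 0 (inord 1)).
  by rewrite {1}[x]row4_eta quat_row4.
have N k : polyfun (fun x : 'rV[R]_4 => - x 0 k).
  apply: polyfun_eq (polyfunM (@polyfun_cst R (-1)) (@polyfun_coord R k)) => x.
  by rewrite mulN1r.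
have P := @polyfun_coord R.
move: i j; apply: ord2P; apply: ord2P; split; under eq_fun do rewrite E mx2E /=;
  by [exact: P|exact: N].
Qed.

Lemma cpol_bil s t x y : cpol (fun g : SU2 R => bil s t x y g).
Proof.
have c z := cpol_cst z.
by apply: cpolD; apply: cpolM (c _); apply: cpolD; apply: cpolM (c _) _; exact: cpol_entry.
Qed.

Lemma cpol_smooth f : cpol f ->
  smooth (fun g => complex.Re (f g)) /\ smooth (fun g => complex.Im (f g)).
Proof.
move=> [F [F1 F2] FE]; split.
  by apply: polyfun_smooth F1 _ => g; rewrite FE.
by apply: polyfun_smooth F2 _ => g; rewrite FE.
Qed.

End PolynomialsAreSmooth.

Definition ccont1 (R : realType) (f : SU2 R -> R[i]) : Prop :=
  cont1 (fun g => complex.Re (f g)) /\ cont1 (fun g => complex.Im (f g)).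

Definition cX (R : realType) (a : 'I_3) (f : SU2 R -> R[i]) (g : SU2 R) : R[i] :=
  dX a (fun g => complex.Re (f g)) g +i* dX a (fun g => complex.Im (f g)) g.

Section ComplexFrameDerivative.
Variable R : realType.
Local Notation C := R[i].
Implicit Types (f h : SU2 R -> C) (g : SU2 R) (a : 'I_3).

Lemma ccont1_eq f h : f =1 h -> ccont1 f -> ccont1 h.
Proof. by move/funext => ->. Qed.

Lemma ccont1_ccont f : ccont1 f -> ccont f.
Proof. by move=> [a b]; split; exact: cont1_cont. Qed.

Lemma ccont_cX a f : ccont1 f -> ccont (cX a f).
Proof. by move=> [[_ /(_ a)[_ c]] [_ /(_ a)[_ d]]]. Qed.

Lemma ccont1_cst c : ccont1 (fun _ : SU2 R => c).
Proof. by split; exact: cont1_cst. Qed.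

Lemma cont1_eq (f h : SU2 R -> R) : f =1 h -> cont1 f -> cont1 h.
Proof. by move/funext => ->. Qed.

Lemma dX_eq a (f h : SU2 R -> R) : f =1 h -> dX a f =1 dX a h.
Proof. by move/funext => ->. Qed.

Lemma dX_cst a c g : dX a (fun _ : SU2 R => c) g = 0.
Proof. by apply: dXP; exact: is_derive_cst. Qed.

Lemma cX_cst a c g : cX a (fun _ : SU2 R => c) g = 0.
Proof. by rewrite /cX !dX_cst. Qed.

Lemma cXD_aux f h : ccont1 f -> ccont1 h -> ccont1 (fun g => f g + h g) /\
  forall a g, cX a (fun g => f g + h g) g = cX a f g + cX a h g.
Proof.
move=> [f1 f2] [h1 h2]; have [a1 b1] := dXD_aux f1 h1; have [a2 b2] := dXD_aux f2 h2.
split=> [|a g].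
  by split; [apply: cont1_eq a1 => g; rewrite cReD|apply: cont1_eq a2 => g; rewrite cImD].
apply: complex_ext; rewrite ?cReD ?cImD /=.
  by rewrite -b1; apply: dX_eq => k; rewrite cReD.
by rewrite -b2; apply: dX_eq => k; rewrite cImD.
Qed.

Lemma cXM_aux f h : ccont1 f -> ccont1 h -> ccont1 (fun g => f g * h g) /\
  forall a g, cX a (fun g => f g * h g) g = cX a f g * h g + f g * cX a h g.
Proof.
move=> [f1 f2] [h1 h2].
have [p1 q1] := dXM_aux f1 h1; have [p2 q2] := dXM_aux f2 h2.
have [p3 q3] := dXM_aux f1 h2; have [p4 q4] := dXM_aux f2 h1.
have [r1 s1] := dXM_aux (cont1_cst (-1)) p2.
have [u1 v1] := dXD_aux p1 r1; have [u2 v2] := dXD_aux p3 p4.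
split=> [|a g].
  split; first by apply: cont1_eq u1 => g; rewrite cReM mulN1r.
  by apply: cont1_eq u2 => g; rewrite cImM.
apply: complex_ext.
  have -> : complex.Re (cX a (fun g => f g * h g) g) =
      dX a (fun g => complex.Re (f g) * complex.Re (h g) +
        -1 * (complex.Im (f g) * complex.Im (h g))) g.
    by apply: dX_eq => k; rewrite cReM mulN1r.
  rewrite v1 q1 s1 q2 dX_cst cReD !cReM /=; ring.
have -> : complex.Im (cX a (fun g => f g * h g) g) =
    dX a (fun g => complex.Re (f g) * complex.Im (h g) +
      complex.Im (f g) * complex.Re (h g)) g.
  by apply: dX_eq => k; rewrite cImM.
rewrite v2 q3 q4 cImD !cImM /=; ring.
Qed.

Lemma ccont1D f h : ccont1 f -> ccont1 h -> ccont1 (fun g => f g + h g).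
Proof. by move=> a b; have [] := cXD_aux a b. Qed.
Lemma ccont1M f h : ccont1 f -> ccont1 h -> ccont1 (fun g => f g * h g).
Proof. by move=> a b; have [] := cXM_aux a b. Qed.
Lemma cXD a f h g : ccont1 f -> ccont1 h ->
  cX a (fun g => f g + h g) g = cX a f g + cX a h g.
Proof. by move=> cf ch; have [_] := cXD_aux cf ch. Qed.
Lemma cXM a f h g : ccont1 f -> ccont1 h ->
  cX a (fun g => f g * h g) g = cX a f g * h g + f g * cX a h g.
Proof. by move=> cf ch; have [_] := cXM_aux cf ch. Qed.

Lemma ccont1Z c f : ccont1 f -> ccont1 (fun g => c * f g).
Proof. by apply: ccont1M; exact: ccont1_cst. Qed.
Lemma cXZ a c f g : ccont1 f -> cX a (fun g => c * f g) g = c * cX a f g.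
Proof. by move=> cf; rewrite (cXM a g (ccont1_cst c) cf) cX_cst mul0r add0r. Qed.

Lemma cX_eq a f h : f =1 h -> cX a f =1 cX a h.
Proof. by move/funext => ->. Qed.

Lemma cXJ_aux f : ccont1 f -> ccont1 (fun g => conjc (f g)) /\
  forall a g, cX a (fun g => conjc (f g)) g = conjc (cX a f g).
Proof.
move=> [f1 f2]; have [r1 s1] := dXM_aux (cont1_cst (-1)) f2.
split=> [|a g].
  split; first by apply: cont1_eq f1 => g; rewrite cReJ.
  by apply: cont1_eq r1 => g; rewrite cImJ mulN1r.
apply: complex_ext; rewrite ?cReJ ?cImJ /=.
  by apply: dX_eq => k; rewrite cReJ.
rewrite -mulN1r; transitivity (dX a (fun g => -1 * complex.Im (f g)) g).
  by apply: dX_eq => k; rewrite cImJ mulN1r.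
by rewrite s1 dX_cst mul0r add0r.
Qed.

Lemma ccont1X f n : ccont1 f -> ccont1 (fun g => f g ^+ n) /\
  forall a g, cX a (fun g => f g ^+ n) g = n%:R * f g ^+ n.-1 * cX a f g.
Proof.
move=> cf; elim: n => [|n [c1 IH]].
  split; first exact: ccont1_cst.
  by move=> a g; rewrite !mul0r; apply: cX_cst.
have e g : f g * f g ^+ n = f g ^+ n.+1 by rewrite exprS.
split; first by apply: ccont1_eq (ccont1M cf c1) => g.
move=> a g; rewrite -(cX_eq a e) cXM // IH.
case: n {IH c1 e} => [|n] /=; first by rewrite expr0; ring.
by rewrite exprS -[n.+2%:R]natr1; ring.
Qed.

(** The exponential is [cos] times the identity plus [sin] times the frame matrix, so
    differentiation at 0 applies the frame matrix to the column. *)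
Lemma cX_bil_aux s t x y : ccont1 (fun g : SU2 R => bil s t x y g) /\
  forall a g, cX a (fun g : SU2 R => bil s t x y g) g =
    bil s t (frame R a 0 0 * x + frame R a 0 1 * y) (frame R a 1 0 * x + frame R a 1 1 * y) g.
Proof.
pose B a (g : SU2 R) := bil s t (frame R a 0 0 * x + frame R a 0 1 * y)
  (frame R a 1 0 * x + frame R a 1 1 * y) g.
have cb (u v : C) : ccont (fun g : SU2 R => bil s t u v g) by exact: ccont_bil.
have D a g : cderiv (fun u : R => bil s t x y (su2mul g (exp_frame a u)))
    (fun u => - (sin u)%:C * bil s t x y g + (cos u)%:C * B a g).
  have d1 := cderivZ (bil s t x y g) (@cderiv_cos R).
  have d2 := cderivZ (B a g) (@cderiv_sin R).
  apply: cderiv_eq (cderivD d1 d2) => u; last by ring.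
  rewrite su2mulE exp_frameE mulmxDr -!scalemxAr mulmx1 /B -bil_mul.
  by rewrite /bil /rowL /rowR !mxE; ring.
have D0 a g := D a g 0.
have [a1 b1] := @cont1I R (fun g => complex.Re (bil s t x y g)) (fun a g => complex.Re (B a g))
  (cb x y).1 (fun a g => ltac:(have [h _] := D0 a g; move: h;
     rewrite sin0 cos0 oppr0 mul0r mul1r add0r; exact)) (fun a => (cb _ _).1).
have [a2 b2] := @cont1I R (fun g => complex.Im (bil s t x y g)) (fun a g => complex.Im (B a g))
  (cb x y).2 (fun a g => ltac:(have [_ h] := D0 a g; move: h;
     rewrite sin0 cos0 oppr0 mul0r mul1r add0r; exact)) (fun a => (cb _ _).2).
by split => // a g; apply: complex_ext; rewrite /= ?b1 ?b2.
Qed.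

Lemma int_cX a f : ccont1 f -> su2_cint (cX a f) = 0.
Proof. by move=> [f1 f2]; apply: complex_ext; rewrite /= int_dX. Qed.

End ComplexFrameDerivative.

(** * Symmetry of the Dirac operator *)

(* In MathComp-Analysis, dirac is the Dirac measure. *)
Local Notation dirac := Defs.dirac.

Definition sC1 (R : realType) (psi : SU2 R -> 'cV[R[i]]_2) : Prop :=
  forall j, ccont1 (fun g => psi g j 0).

Definition scont (R : realType) (psi : SU2 R -> 'cV[R[i]]_2) : Prop :=
  forall j, ccont (fun g => psi g j 0).

Section Dirac.
Variable R : realType.
Local Notation C := R[i].
Implicit Types (psi phi : SU2 R -> 'cV[C]_2) (g : SU2 R).

Let e0 : 'I_3 := @Ordinal 3 0 isT.
Let e1 : 'I_3 := @Ordinal 3 1 isT.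
Let e2 : 'I_3 := @Ordinal 3 2 isT.

Lemma frame0 : frame R e0 = mx2 'i%C 0 0 (- 'i%C). Proof. by []. Qed.
Lemma frame1 : frame R e1 = mx2 0 1 (-1) 0. Proof. by []. Qed.
Lemma frame2 : frame R e2 = mx2 0 'i%C 'i%C 0. Proof. by []. Qed.

Lemma sC1_scont psi : sC1 psi -> scont psi.
Proof. by move=> h j; exact: ccont1_ccont. Qed.

Lemma sumI3 (V : zmodType) (F : 'I_3 -> V) : \sum_(a < 3) F a = F e0 + F e1 + F e2.
Proof.
rewrite !big_ord_recl big_ord0 addr0 addrA.
by congr (_ + _ + _); congr F; apply: val_inj.
Qed.

Lemma frame_derivE a psi g j : frame_deriv a psi g j 0 = cX a (fun g => psi g j 0) g.
Proof. by rewrite mxE. Qed.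

Lemma colDE (u v : 'cV[C]_2) j : (u + v) j 0 = u j 0 + v j 0. Proof. by rewrite mxE. Qed.
Lemma colNE (u : 'cV[C]_2) j : (- u) j 0 = - u j 0. Proof. by rewrite mxE. Qed.
Lemma colZE c (u : 'cV[C]_2) j : (c *: u) j 0 = c * u j 0. Proof. by rewrite mxE. Qed.

Lemma diracE psi g j : dirac psi g j 0 =
  frame R e0 j 0 * cX e0 (fun g => psi g 0 0) g + frame R e0 j 1 * cX e0 (fun g => psi g 1 0) g
  + (frame R e1 j 0 * cX e1 (fun g => psi g 0 0) g + frame R e1 j 1 * cX e1 (fun g => psi g 1 0) g)
  + (frame R e2 j 0 * cX e2 (fun g => psi g 0 0) g + frame R e2 j 1 * cX e2 (fun g => psi g 1 0) g)
  - (3 / 2 : R)%:C * psi g j 0.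
Proof. by rewrite /Defs.dirac sumI3 !colDE colNE colZE !mulmx_col2E !frame_derivE. Qed.

Opaque Defs.dirac.

Lemma dirac_0 psi g : dirac psi g 0 0 =
  'i%C * cX e0 (fun g => psi g 0 0) g + cX e1 (fun g => psi g 1 0) g
  + 'i%C * cX e2 (fun g => psi g 1 0) g - (3 / 2 : R)%:C * psi g 0 0.
Proof. by rewrite diracE frame0 frame1 frame2 !mx2E; ring. Qed.

Lemma dirac_1 psi g : dirac psi g 1 0 =
  - 'i%C * cX e0 (fun g => psi g 1 0) g - cX e1 (fun g => psi g 0 0) g
  + 'i%C * cX e2 (fun g => psi g 0 0) g - (3 / 2 : R)%:C * psi g 1 0.
Proof. by rewrite diracE frame0 frame1 frame2 !mx2E; ring. Qed.

Lemma scont_dirac psi : sC1 psi -> scont (dirac psi).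
Proof.
move=> h.
have c a j : ccont (fun g => cX a (fun g => psi g j 0) g) by apply: ccont_cX; exact: h.
have p j : ccont (fun g => psi g j 0) by apply: ccont1_ccont; exact: h.
have s2 : ccont (fun g => - (3 / 2 : R)%:C * psi g 0 0) by apply: ccontZ; exact: p.
have s3 : ccont (fun g => - (3 / 2 : R)%:C * psi g 1 0) by apply: ccontZ; exact: p.
apply: ord2P.
  apply: (ccont_eq _ (ccontD (ccontD (ccontD (ccontZ 'i%C (c e0 0)) (c e1 1))
    (ccontZ 'i%C (c e2 1))) s2)) => g.
  by rewrite dirac_0 mulNr.
apply: (ccont_eq _ (ccontD (ccontD (ccontD (ccontZ (- 'i%C) (c e0 1)) (ccontZ (-1) (c e1 0)))
  (ccontZ 'i%C (c e2 0))) s3)) => g.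
by rewrite dirac_1 mulN1r !mulNr.
Qed.

Lemma sC1D psi phi : sC1 psi -> sC1 phi -> sC1 (fun g => psi g + phi g).
Proof.
move=> h k j; apply: ccont1_eq (ccont1D (h j) (k j)) => g; by rewrite mxE.
Qed.

Lemma sC1_0 : sC1 (fun _ : SU2 R => 0).
Proof. by move=> j; apply: (ccont1_eq _ (@ccont1_cst R 0)) => g; rewrite mxE. Qed.

Lemma scontD psi phi : scont psi -> scont phi -> scont (fun g => psi g + phi g).
Proof. by move=> h k j; apply: ccont_eq (ccontD (h j) (k j)) => g; rewrite mxE. Qed.

Lemma scontZ c psi : scont psi -> scont (fun g => c *: psi g).
Proof. by move=> h j; apply: ccont_eq (ccontZ c (h j)) => g; rewrite mxE. Qed.

Lemma scont_0 : scont (fun _ : SU2 R => 0).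
Proof. exact: sC1_scont sC1_0. Qed.

Lemma diracD psi phi g : sC1 psi -> sC1 phi ->
  dirac (fun g => psi g + phi g) g = dirac psi g + dirac phi g.
Proof.
move=> h k.
have E a j : cX a (fun g => (psi g + phi g) j 0) g =
    cX a (fun g => psi g j 0) g + cX a (fun g => phi g j 0) g.
  by rewrite -cXD //; apply: cX_eq => u; rewrite mxE.
by apply: col2P; rewrite [RHS](colDE (dirac psi g));
  [rewrite !dirac_0 !E|rewrite !dirac_1 !E]; rewrite colDE; ring.
Qed.

Lemma diracZ c psi g : sC1 psi -> dirac (fun g => c *: psi g) g = c *: dirac psi g.
Proof.
move=> h.
have E a j : cX a (fun g => (c *: psi g) j 0) g = c * cX a (fun g => psi g j 0) g.
  by rewrite -cXZ //; apply: cX_eq => u; rewrite mxE.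
by apply: col2P; rewrite [RHS](colZE c (dirac psi g));
  [rewrite !dirac_0 !E|rewrite !dirac_1 !E]; rewrite colZE; ring.
Qed.

Lemma dirac_zero g : dirac (fun _ : SU2 R => 0) g = 0.
Proof.
have -> : (fun _ : SU2 R => 0 : 'cV[C]_2) = (fun _ => 0 *: 0).
  by apply/funext => u; rewrite scale0r.
by rewrite diracZ ?scale0r //; exact: sC1_0.
Qed.

Definition herm (v w : 'cV[C]_2) : C := v 0 0 * conjc (w 0 0) + v 1 0 * conjc (w 1 0).

Definition ip psi phi : C := su2_cint (fun g => herm (psi g) (phi g)).

Lemma ccont_herm psi phi : scont psi -> scont phi -> ccont (fun g => herm (psi g) (phi g)).
Proof.
by move=> h k; apply: ccontD; apply: ccontM; [exact: h|apply: ccontJ; exact: k|exact: h|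
  apply: ccontJ; exact: k].
Qed.

Lemma conj_comb1 (a b c d : C) (r : R) :
  conjc ('i%C * a + b + 'i%C * c - r%:C * d) =
  - 'i%C * conjc a + conjc b - 'i%C * conjc c - r%:C * conjc d.
Proof.
by case: a b c d => [a a'] [b b'] [c c'] [d d']; apply: complex_ext => /=; ring.
Qed.

Lemma conj_comb2 (a b c d : C) (r : R) :
  conjc (- 'i%C * a - b + 'i%C * c - r%:C * d) =
  'i%C * conjc a - conjc b - 'i%C * conjc c - r%:C * conjc d.
Proof.
by case: a b c d => [a a'] [b b'] [c c'] [d d']; apply: complex_ext => /=; ring.
Qed.

Lemma cXJ a (f : SU2 R -> C) g : ccont1 f -> cX a (fun g => conjc (f g)) g = conjc (cX a f g).
Proof. by move=> h; have [_] := cXJ_aux h. Qed.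
Lemma ccont1J (f : SU2 R -> C) : ccont1 f -> ccont1 (fun g => conjc (f g)).
Proof. by move=> h; have [] := cXJ_aux h. Qed.

Lemma cX_bilinear a c1 c2 (u w u' w' : SU2 R -> C) :
  ccont1 u -> ccont1 w -> ccont1 u' -> ccont1 w' ->
  ccont1 (fun g => c1 * (u g * w g) + c2 * (u' g * w' g)) /\
  forall g, cX a (fun g => c1 * (u g * w g) + c2 * (u' g * w' g)) g =
    c1 * (cX a u g * w g + u g * cX a w g) + c2 * (cX a u' g * w' g + u' g * cX a w' g).
Proof.
move=> hu hw hu' hw'; have m := ccont1M hu hw; have m' := ccont1M hu' hw'.
have z := ccont1Z c1 m; have z' := ccont1Z c2 m'.
split=> [|g]; first exact: ccont1D.
by rewrite (cXD a g z z') (cXZ a c1 g m) (cXZ a c2 g m') (cXM a g hu hw) (cXM a g hu' hw').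
Qed.

(** The frame matrices are skew-Hermitian, so the two pointwise products differ by the divergence of
    [B0], [B1], [B2], the Hermitian products of [psi] with the frame matrices applied to [phi]; each
    frame derivative integrates to 0. The zeroth order term has a real coefficient and cancels. *)
Lemma dirac_symmetric psi phi : sC1 psi -> sC1 phi ->
  ip (dirac psi) phi = ip psi (dirac phi).
Proof.
move=> h k.
pose u j g := psi g j 0; pose v j g := phi g j 0; pose w j g := conjc (v j g).
have hu j : ccont1 (u j) by exact: h.
have hv j : ccont1 (v j) by exact: k.
have hw j : ccont1 (w j) by apply: ccont1J; exact: k.
have W a j g : cX a (w j) g = conjc (cX a (v j) g) := cXJ a g (hv j).
pose B0 g := - 'i%C * (u 0 g * w 0 g) + 'i%C * (u 1 g * w 1 g).
pose B1 g := 1 * (u 0 g * w 1 g) + -1 * (u 1 g * w 0 g).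
pose B2 g := - 'i%C * (u 0 g * w 1 g) + - 'i%C * (u 1 g * w 0 g).
have [c0 x0] := cX_bilinear e0 (- 'i%C) 'i%C (hu 0) (hw 0) (hu 1) (hw 1).
have [c1 x1] := cX_bilinear e1 1 (-1) (hu 0) (hw 1) (hu 1) (hw 0).
have [c2 x2] := cX_bilinear e2 (- 'i%C) (- 'i%C) (hu 0) (hw 1) (hu 1) (hw 0).
have d0 := ccont_cX e0 c0; have d1 := ccont_cX e1 c1; have d2 := ccont_cX e2 c2.
pose S g := cX e0 B0 g + cX e1 B1 g + cX e2 B2 g.
have cS : ccont S := ccontD (ccontD d0 d1) d2.
have S0 : su2_cint S = 0.
  rewrite (su2_cintD (ccontD d0 d1) d2) (su2_cintD d0 d1).
  by rewrite (int_cX e0 c0) (int_cX e1 c1) (int_cX e2 c2) !addr0.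
have E g : herm (dirac psi g) (phi g) = herm (psi g) (dirac phi g) + (-1) * S g.
  rewrite /S (x0 g) (x1 g) (x2 g) !W /herm !dirac_0 !dirac_1 -/(u 0) -/(u 1) -/(v 0) -/(v 1).
  rewrite -/(u 0 g) -/(u 1 g) -/(w 0 g) -/(w 1 g).
  rewrite conj_comb1 conj_comb2 -/(v 0 g) -/(v 1 g) -/(w 0 g) -/(w 1 g).
  move: (cX e0 (u 0) g) (cX e0 (u 1) g) (cX e1 (u 0) g) (cX e1 (u 1) g) (cX e2 (u 0) g)
    (cX e2 (u 1) g) (u 0 g) (u 1 g) (w 0 g) (w 1 g) => a1 a2 a3 a4 a5 a6 a7 a8 a9 a10.
  move: (conjc (cX e0 (v 0) g)) (conjc (cX e0 (v 1) g)) (conjc (cX e1 (v 0) g))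
    (conjc (cX e1 (v 1) g)) (conjc (cX e2 (v 0) g)) (conjc (cX e2 (v 1) g)) => *; ring.
have cH := ccont_herm (sC1_scont h) (scont_dirac k).
rewrite /ip (_ : (fun g => herm (dirac psi g) (phi g)) = (fun g => herm (psi g) (dirac phi g) + (-1) * S g));
  last by apply/funext => g; exact: E.
by rewrite (su2_cintD cH (ccontZ (-1) cS)) (su2_cintZ (-1) cS) S0 mulr0 addr0.
Qed.

Lemma ipD psi1 psi2 phi : scont psi1 -> scont psi2 -> scont phi ->
  ip (fun g => psi1 g + psi2 g) phi = ip psi1 phi + ip psi2 phi.
Proof.
move=> h1 h2 k; rewrite /ip -(su2_cintD (ccont_herm h1 k) (ccont_herm h2 k)).
by apply: (congr1 (@su2_cint R)); apply/funext => g; rewrite /herm !colDE; ring.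
Qed.

Lemma ipZ c psi phi : scont psi -> scont phi -> ip (fun g => c *: psi g) phi = c * ip psi phi.
Proof.
move=> h k; rewrite /ip -(su2_cintZ c (ccont_herm h k)).
by apply: (congr1 (@su2_cint R)); apply/funext => g; rewrite /herm !colZE; ring.
Qed.

Lemma conjcM (a b : C) : conjc (a * b) = conjc a * conjc b.
Proof. by case: a b => [a a'] [b b']; apply: complex_ext => /=; ring. Qed.
Lemma conjcD (a b : C) : conjc (a + b) = conjc a + conjc b.
Proof. by case: a b => [a a'] [b b']; apply: complex_ext => /=; ring. Qed.

Lemma ipC psi phi : scont psi -> scont phi -> ip phi psi = conjc (ip psi phi).
Proof.
move=> h k; have [_ c2] := ccont_herm h k.
have J (v w : 'cV[C]_2) : herm w v = conjc (herm v w).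
  by rewrite /herm conjcD !conjcM !conjcK ![conjc _ * _]mulrC.
apply: complex_ext; rewrite ?cReJ ?cImJ /=.
  by apply: su2_int_eq => g; rewrite J cReJ.
by rewrite -(su2_intN c2); apply: su2_int_eq => g; rewrite J cImJ.
Qed.

Lemma ipDr psi phi1 phi2 : scont psi -> scont phi1 -> scont phi2 ->
  ip psi (fun g => phi1 g + phi2 g) = ip psi phi1 + ip psi phi2.
Proof.
move=> h k1 k2; rewrite (ipC (scontD k1 k2) h) (ipD k1 k2 h) conjcD.
by rewrite (ipC k1 h) (ipC k2 h).
Qed.

Lemma ipZr c psi phi : scont psi -> scont phi -> ip psi (fun g => c *: phi g) = conjc c * ip psi phi.
Proof. by move=> h k; rewrite (ipC (scontZ c k) h) ipZ // conjcM -(ipC k h). Qed.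

Definition normsq (v : 'cV[C]_2) : R :=
  \sum_(j < 2) (complex.Re (v j 0) ^+ 2 + complex.Im (v j 0) ^+ 2).

Lemma normsq_ge0 v : 0 <= normsq v.
Proof. by apply: sumr_ge0 => j _; rewrite addr_ge0 ?sqr_ge0. Qed.

Lemma herm_normsq v : herm v v = (normsq v)%:C.
Proof.
rewrite /herm /normsq !big_ord_recl big_ord0 addr0.
rewrite (_ : lift ord0 ord0 = 1); last exact: val_inj.
by case: (v 0 0) (v 1 0) => [a b] [c d]; apply: complex_ext => /=; ring.
Qed.

Lemma cont_normsq psi : scont psi -> cont (fun g => normsq (psi g)).
Proof.
move=> h; have [c _] := ccont_herm h h.
by apply: cont_eq c => g; rewrite herm_normsq.
Qed.

Lemma L2norm2E psi : L2norm2 psi = su2_integral (fun g => normsq (psi g)).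
Proof. by []. Qed.

Lemma ip_L2norm2 psi : ip psi psi = (L2norm2 psi)%:C.
Proof.
apply: complex_ext; rewrite /= ?L2norm2E.
  by apply: su2_int_eq => g; rewrite herm_normsq.
transitivity (su2_integral (fun _ : SU2 R => 0 : R)).
  by apply: su2_int_eq => g; rewrite herm_normsq.
by rewrite su2_int_cst mul0r.
Qed.

Lemma L2norm2_ge0 psi : scont psi -> 0 <= L2norm2 psi.
Proof.
by move=> h; rewrite L2norm2E; apply: su2_int_ge0 (cont_normsq h) _ => g; exact: normsq_ge0.
Qed.

Lemma sum4sqr_eq0 (a b c d : R) : a ^+ 2 + b ^+ 2 + (c ^+ 2 + d ^+ 2) = 0 ->
  [/\ a = 0, b = 0, c = 0 & d = 0].
Proof.
move=> h; have a0 := sqr_ge0 a; have b0 := sqr_ge0 b; have c0 := sqr_ge0 c.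
have d0 := sqr_ge0 d.
by split; apply/eqP; rewrite -sqrf_eq0; apply/eqP; lra.
Qed.

Lemma normsq_eq0 v : normsq v = 0 -> v = 0.
Proof.
rewrite /normsq !big_ord_recl big_ord0 addr0 (_ : lift ord0 ord0 = 1); last exact: val_inj.
move=> /sum4sqr_eq0[h1 h2 h3 h4].
by apply: col2P; rewrite [RHS]mxE; apply: complex_ext.
Qed.

Lemma L2norm2_eq0 psi : scont psi -> L2norm2 psi = 0 -> forall g, psi g = 0.
Proof.
move=> h h0 g; apply: normsq_eq0.
exact: (su2_int_eq0_all (cont_normsq h) (fun g => normsq_ge0 _) h0).
Qed.

End Dirac.

Transparent Defs.dirac.

(** * Eigenspinors on SU(2) *)

Definition eigval (R : realType) (pos : bool) (n : nat) : R :=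
  if pos then n%:R + 3 / 2 else - (n%:R + 3 / 2).

(* With r = (s, t) g and tau = (x, y): the spinors (r tau)^n r^perp and (r tau)^n tau. *)
Definition egen (R : realType) (pos : bool) (n : nat) (s t x y : R[i]) (g : SU2 R) :
    'cV[R[i]]_2 :=
  bil s t x y g ^+ n *:
    (if pos then col2 (bil s t 0 1 g) (- bil s t 1 0 g) else col2 x y).

Inductive eigspan (R : realType) (pos : bool) (n : nat) : (SU2 R -> 'cV[R[i]]_2) -> Prop :=
| eigspan0 : eigspan pos n (fun=> 0)
| eigspanG s t x y : eigspan pos n (egen pos n s t x y)
| eigspanD psi phi : eigspan pos n psi -> eigspan pos n phi ->
    eigspan pos n (fun g => psi g + phi g)
| eigspanZ c psi : eigspan pos n psi -> eigspan pos n (fun g => c *: psi g).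

Section EigenSpinors.
Variable R : realType.
Local Notation C := R[i].
Implicit Types (psi phi : SU2 R -> 'cV[C]_2) (g : SU2 R).

Lemma eigspan_eq pos n psi phi : psi =1 phi -> eigspan pos n psi -> eigspan pos n phi.
Proof. by move/funext => ->. Qed.

Lemma egen_cpol pos n s t x y j : cpol (fun g : SU2 R => egen pos n s t x y g j 0).
Proof.
have pb := cpolX n (@cpol_bil R s t x y).
have p0 : cpol (fun g : SU2 R => (if pos then bil s t 0 1 g else x)).
  by case: pos; [exact: cpol_bil|exact: cpol_cst].
have p1 : cpol (fun g : SU2 R => (if pos then -1 * bil s t 1 0 g else y)).
  by case: pos {p0}; [apply: cpolM; [exact: cpol_cst|exact: cpol_bil]|exact: cpol_cst].
move: j; apply: ord2P.
  by apply: cpol_eq (cpolM pb p0) => g; rewrite /egen colZE; case: pos {p0 p1}; rewrite col2_0.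
apply: cpol_eq (cpolM pb p1) => g; rewrite /egen colZE.
by case: pos {p0 p1}; rewrite col2_1 ?mulN1r.
Qed.

Lemma eigspan_cpol pos n psi : eigspan pos n psi -> forall j, cpol (fun g => psi g j 0).
Proof.
elim => [|s t x y|f1 f2 _ h1 _ h2|c f _ h] j.
- by apply: (cpol_eq _ (@cpol_cst R 0)) => g; rewrite mxE.
- exact: egen_cpol.
- by apply: cpol_eq (cpolD (h1 j) (h2 j)) => g; rewrite mxE.
- by apply: cpol_eq (cpolM (@cpol_cst R c) (h j)) => g; rewrite mxE.
Qed.

Lemma eigspan_smooth pos n psi : eigspan pos n psi -> forall j,
  smooth (fun g => complex.Re (psi g j 0)) /\ smooth (fun g => complex.Im (psi g j 0)).
Proof. by move=> h j; apply: cpol_smooth; exact: eigspan_cpol h j. Qed.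

Lemma eigspan_sC1 pos n psi : eigspan pos n psi -> sC1 psi.
Proof. by move=> h j; have [s1 s2] := eigspan_smooth h j; split; exact: smooth_cont1. Qed.

Lemma ccont1_bil s t x y : ccont1 (fun g : SU2 R => bil s t x y g).
Proof. by have [] := @cX_bil_aux R s t x y. Qed.

Lemma cX_bilX a n s t x y u v g :
  cX a (fun g : SU2 R => bil s t x y g ^+ n * bil s t u v g) g =
  n%:R * bil s t x y g ^+ n.-1 * cX a (fun g : SU2 R => bil s t x y g) g * bil s t u v g +
  bil s t x y g ^+ n * cX a (fun g : SU2 R => bil s t u v g) g.
Proof.
have [cn dn] := ccont1X n (ccont1_bil s t x y).
by rewrite (cXM a g cn (ccont1_bil s t u v)) dn.
Qed.

Lemma cX_bil a s t x y g : cX a (fun g : SU2 R => bil s t x y g) g =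
  bil s t (frame R a 0 0 * x + frame R a 0 1 * y) (frame R a 1 0 * x + frame R a 1 1 * y) g.
Proof. by have [_] := @cX_bil_aux R s t x y. Qed.

Lemma three_halves : (3 / 2 : R)%:C + (3 / 2 : R)%:C = 3 :> C.
Proof. by apply: complex_ext => /=; [field|ring]. Qed.

Lemma eigval_plus n : (eigval R true n)%:C = n%:R + (3 / 2 : R)%:C.
Proof. by rewrite /eigval rmorphD /= rmorph_nat. Qed.

Lemma eigval_minus n : (eigval R false n)%:C = - (n%:R + (3 / 2 : R)%:C).
Proof. by rewrite -eigval_plus /eigval -rmorphN. Qed.

(** With [E_a] the frame matrices, the sum over [a] of [(r E_a tau) E_a v] is
    [(r tau) v - 2 (r v) tau]. For [v = r^perp] the last term is 0, so differentiating the power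
    gives [n]. Since [X_a r^perp = - E_a r^perp] and [E_a^2 = -1], differentiating [r^perp] gives 3,
    from which 3/2 is subtracted. *)
Lemma dirac_egen_plus n s t x y g :
  dirac (egen true n s t x y) g = (eigval R true n)%:C *: egen true n s t x y g.
Proof.
set psi := egen true n s t x y.
have E0 : (fun g => psi g 0 0) = (fun g : SU2 R => bil s t x y g ^+ n * bil s t 0 1 g).
  by apply/funext => h; rewrite /psi /egen colZE col2_0.
have E1 : (fun g => psi g 1 0) = (fun g : SU2 R => bil s t x y g ^+ n * bil s t (-1) 0 g).
  apply/funext => h; rewrite /psi /egen colZE col2_1; congr (_ * _).
  by rewrite /bil; ring.
have E0g : psi g 0 0 = bil s t x y g ^+ n * bil s t 0 1 g by exact: (congr1 (fun f => f g) E0).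
have E1g : psi g 1 0 = bil s t x y g ^+ n * bil s t (-1) 0 g by exact: (congr1 (fun f => f g) E1).
have i2 := @ImI2 R; have h2 := three_halves.
(* For [n = 0] the predecessor is 0, but the factor [n] removes the term. *)
have hQ : n%:R * bil s t x y g ^+ n.-1 * bil s t x y g = n%:R * bil s t x y g ^+ n.
  by case: n {psi E0 E1 E0g E1g} => [|n] /=; rewrite ?mul0r // exprS; ring.
apply: col2P; rewrite colZE ?dirac_0 ?dirac_1 E0 E1 ?E0g ?E1g !cX_bilX !cX_bil frame0 frame1 frame2 !mx2E
   eigval_plus.
  move: hQ h2; rewrite /bil; move: (rowL s t g) (rowR s t g) (_ ^+ n) (_ ^+ n.-1) ((3 / 2 : R)%:C).
  move=> l r p q h hQ h2; have hQ' := congr1 (fun z => z * r) hQ.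
  transitivity (n%:R * q * (l * x + r * y) * r + (h + h) * (p * r) - h * (p * r)).
    rewrite h2; ring: i2.
  by rewrite hQ; ring.
move: hQ h2; rewrite /bil; move: (rowL s t g) (rowR s t g) (_ ^+ n) (_ ^+ n.-1) ((3 / 2 : R)%:C).
move=> l r p q h hQ h2.
transitivity (- (n%:R * q * (l * x + r * y) * l) - (h + h) * (p * l) + h * (p * l)).
  rewrite h2; ring: i2.
by rewrite hQ; ring.
Qed.

(** The identity behind [dirac_egen_plus] with [v = tau] leaves [- (r tau) tau], so the power
    contributes [- n] and the constant term [- 3/2]. *)
Lemma dirac_egen_minus n s t x y g :
  dirac (egen false n s t x y) g = (eigval R false n)%:C *: egen false n s t x y g.
Proof.
set psi := egen false n s t x y.
have [cn dn] := ccont1X n (ccont1_bil s t x y).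
have E0 : (fun g => psi g 0 0) = (fun g : SU2 R => x * bil s t x y g ^+ n).
  by apply/funext => h; rewrite /psi /egen colZE col2_0 mulrC.
have E1 : (fun g => psi g 1 0) = (fun g : SU2 R => y * bil s t x y g ^+ n).
  by apply/funext => h; rewrite /psi /egen colZE col2_1 mulrC.
have E0g : psi g 0 0 = x * bil s t x y g ^+ n by exact: (congr1 (fun f => f g) E0).
have E1g : psi g 1 0 = y * bil s t x y g ^+ n by exact: (congr1 (fun f => f g) E1).
have i2 := @ImI2 R.
have hQ : n%:R * bil s t x y g ^+ n.-1 * bil s t x y g = n%:R * bil s t x y g ^+ n.
  by case: n {psi E0 E1 E0g E1g cn dn} => [|n] /=; rewrite ?mul0r // exprS; ring.
apply: col2P; rewrite colZE ?dirac_0 ?dirac_1 E0 E1 ?E0g ?E1g !(cXZ _ _ _ cn) !dn !cX_bil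
    frame0 frame1 frame2 !mx2E eigval_minus.
  move: hQ; rewrite /bil; move: (rowL s t g) (rowR s t g) (_ ^+ n) (_ ^+ n.-1) ((3 / 2 : R)%:C).
  move=> l r p q h hQ.
  transitivity (- (n%:R * q * (l * x + r * y) * x) - h * (x * p)); first by ring: i2.
  by rewrite hQ; ring.
move: hQ; rewrite /bil; move: (rowL s t g) (rowR s t g) (_ ^+ n) (_ ^+ n.-1) ((3 / 2 : R)%:C).
move=> l r p q h hQ.
transitivity (- (n%:R * q * (l * x + r * y) * y) - h * (y * p)); first by ring: i2.
by rewrite hQ; ring.
Qed.

Lemma eigspan_dirac pos n psi : eigspan pos n psi ->
  forall g, dirac psi g = (eigval R pos n)%:C *: psi g.
Proof.
elim => [|s t x y|f1 f2 e1' h1 e2' h2|c f e h] g.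
- by rewrite dirac_zero scaler0.
- by case: pos; [exact: dirac_egen_plus|exact: dirac_egen_minus].
- by rewrite (diracD g (eigspan_sC1 e1') (eigspan_sC1 e2')) h1 h2 scalerDr.
- by rewrite (diracZ c g (eigspan_sC1 e)) h !scalerA mulrC.
Qed.

Inductive spinpoly : (SU2 R -> 'cV[C]_2) -> Prop :=
| spinpoly_eig pos n psi : eigspan pos n psi -> spinpoly psi
| spinpolyD psi phi : spinpoly psi -> spinpoly phi -> spinpoly (fun g => psi g + phi g).

Lemma spinpoly_eq psi phi : psi =1 phi -> spinpoly psi -> spinpoly phi.
Proof. by move/funext => ->. Qed.

Lemma spinpolyZ c psi : spinpoly psi -> spinpoly (fun g => c *: psi g).
Proof.
elim => [pos n f e|f1 f2 _ h1 _ h2]; first by apply: spinpoly_eig; exact: eigspanZ e.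
by apply: spinpoly_eq (spinpolyD h1 h2) => g; rewrite scalerDr.
Qed.

(** Polarising [(r tau)^n tau] in tau along [v] gives [(r tau)^n v + n (r tau)^(n-1) (r v) tau]. As
    [(r v) tau - (r tau) v] is a constant multiple of [r^perp], adding a multiple of
    [(r tau)^(n-1) r^perp], an eigenspinor of the other sign, leaves [n.+1] times the goal. *)
Lemma spinpoly_gen n s t x y v0 v1 :
  spinpoly (fun g => bil s t x y g ^+ n *: col2 v0 v1).
Proof.
pose f k (g : SU2 R) := col2 (polar_coef (bil s t x y g) (bil s t v0 v1 g) x v0 n k)
  (polar_coef (bil s t x y g) (bil s t v0 v1 g) y v1 n k).
have h (u : C) : eigspan false n (fun g : SU2 R => \sum_(k < n.+2) u ^+ k *: f k g).
  apply: eigspan_eq (eigspanG false n s t (x + u * v0) (y + u * v1)) => g.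
  rewrite /egen bilDr bilZr.
  by apply: col2P; rewrite colZE summxE ?col2_0 ?col2_1 polar_expand;
    apply: eq_bigr => k _; rewrite colZE /f ?col2_0 ?col2_1.
have e1' : eigspan false n (f 1%N).
  apply: (@vandermonde_components R 'cV[C]_2 (SU2 R) (@eigspan R false n) n.+1) => //.
  - exact: eigspan0.
  - exact: eigspanD.
  - by move=> c k; exact: eigspanZ.
have n1 : n.+1%:R != 0 :> C by rewrite pnatr_eq0.
have := spinpolyZ n.+1%:R^-1 (spinpolyD (spinpoly_eig e1') (spinpolyZ (n%:R * (v0 * y - v1 * x))
  (spinpoly_eig (eigspanG true n.-1 s t x y)))).
apply: spinpoly_eq => g; apply: (scalerI n1); rewrite scalerA mulfV // scale1r.
rewrite /f /egen /polar_coef bin1 bin0 subn0 subn1 expr1 expr0.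
by case: n {h e1' n1 f} => [|n]; apply: col2P;
  rewrite !colDE !colZE ?col2_0 ?col2_1 /= -?natr1 ?exprS /bil;
  move: (rowL s t g) (rowR s t g) => l r; rewrite !mulr1n; ring.
Qed.

Lemma spinpoly_trig (f : SU2 R -> C) v0 v1 : trig f -> spinpoly (fun g => f g *: col2 v0 v1).
Proof.
elim => [|n s t x y|f1 f2 _ h1 _ h2|c f1 _ h1].
- by apply: (spinpoly_eq _ (spinpoly_eig (@eigspan0 R true 0))) => g; rewrite scale0r.
- exact: spinpoly_gen.
- by apply: spinpoly_eq (spinpolyD h1 h2) => g; rewrite scalerDl.
- by apply: spinpoly_eq (spinpolyZ c h1) => g; rewrite scalerA.
Qed.

Definition uclose (e : R) psi phi : Prop := forall g j,
  `|complex.Re (psi g j 0 - phi g j 0)| <= e /\ `|complex.Im (psi g j 0 - phi g j 0)| <= e.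

Lemma col2_comb (a b c d : C) : a *: col2 1 0 + b *: col2 'i%C 0 +
  (c *: col2 0 1 + d *: col2 0 'i%C) = col2 (a + b * 'i%C) (c + d * 'i%C).
Proof.
by apply: col2P; rewrite !colDE !colZE ?col2_0 ?col2_1; ring.
Qed.

Lemma spinor_density psi : scont psi -> forall e : R, 0 < e ->
  exists2 phi, spinpoly phi & uclose e psi phi.
Proof.
move=> h e e_gt0.
have [q0 t0 h0] := density (h 0).1 e_gt0; have [q1 t1 h1] := density (h 0).2 e_gt0.
have [q2 t2 h2] := density (h 1).1 e_gt0; have [q3 t3 h3] := density (h 1).2 e_gt0.
have s0 := spinpolyD (spinpoly_trig 1 0 t0) (spinpoly_trig 'i%C 0 t1).
have s1 := spinpolyD (spinpoly_trig 0 1 t2) (spinpoly_trig 0 'i%C t3).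
exists (fun g => col2 ((q0 g)%:C + (q1 g)%:C * 'i%C) ((q2 g)%:C + (q3 g)%:C * 'i%C)).
  by apply: spinpoly_eq (spinpolyD s0 s1) => g; exact: col2_comb.
have ri (z : C) (a b d : R) : `|complex.Re z - a| <= d -> `|complex.Im z - b| <= d ->
    `|complex.Re (z - (a%:C + b%:C * 'i%C))| <= d /\ `|complex.Im (z - (a%:C + b%:C * 'i%C))| <= d.
  case: z => z z' /=.
  by rewrite !(mulr0, mul0r, mulr1, addr0, add0r, subr0, sub0r, oppr0).
by move=> g; apply: ord2P; rewrite ?col2_0 ?col2_1; apply: ri.
Qed.

Lemma uclose_L2 e psi phi : 0 <= e -> scont psi -> scont phi -> uclose e psi phi ->
  L2norm2 (fun g => psi g - phi g) <= 4 * e ^+ 2 * su2_volume R.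
Proof.
move=> e_ge0 h k c; rewrite L2norm2E -su2_int_cst; apply: su2_int_le.
- apply: cont_normsq; apply: scontD => // j.
  by apply: ccont_eq (ccontZ (-1) (k j)) => g; rewrite mxE mulN1r.
- exact: cont_cst.
move=> g; rewrite /normsq !big_ord_recl big_ord0 addr0.
have [a1 a2] := c g ord0; have [b1 b2] := c g (lift ord0 ord0).
rewrite !colDE !colNE.
have sq (z : R) : `|z| <= e -> z ^+ 2 <= e ^+ 2.
  by move=> ze; rewrite -real_normK ?num_real // ler_sqr ?nnegrE.
have := sq _ a1; have := sq _ a2; have := sq _ b1; have := sq _ b2.
move: (_ ^+ 2) (_ ^+ 2) (_ ^+ 2) (_ ^+ 2) (e ^+ 2) => *; lra.
Qed.

End EigenSpinors.

(** * The resolvent *)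

(* An enumeration of the eigenvalues of the Dirac operator on SU(2). *)
Definition alpha (R : realType) (k : nat) : R := eigval R (odd k) k./2.

Section Resolvent.
Variable R : realType.
Local Notation C := R[i].
Local Notation alpha := (alpha R).
Implicit Types (psi phi : SU2 R -> 'cV[C]_2) (g : SU2 R) (e : nat -> SU2 R -> 'cV[C]_2).

Definition bigspin M e : SU2 R -> 'cV[C]_2 := fun g => \sum_(k < M) e k g.

Lemma bigspin0 e : bigspin 0 e = fun=> 0.
Proof. by apply/funext => g; rewrite /bigspin big_ord0. Qed.

Lemma bigspinS M e : bigspin M.+1 e = fun g => bigspin M e g + e M g.
Proof. by apply/funext => g; rewrite /bigspin big_ord_recr. Qed.

Lemma bigspin_sC1 M e : (forall k, sC1 (e k)) -> sC1 (bigspin M e).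
Proof.
move=> h; elim: M => [|M IH]; first by rewrite bigspin0; exact: sC1_0.
by rewrite bigspinS; exact: sC1D.
Qed.

Lemma bigspin_dirac M e g : (forall k, sC1 (e k)) ->
  dirac (bigspin M e) g = bigspin M (fun k => dirac (e k)) g.
Proof.
move=> h; elim: M => [|M IH]; first by rewrite !bigspin0 dirac_zero.
by rewrite !bigspinS (diracD g (bigspin_sC1 M h) (h M)) IH.
Qed.

Lemma ip0l phi : scont phi -> ip (fun=> 0) phi = 0.
Proof.
move=> h; have := ipZ 0 (@scont_0 R) h.
by rewrite (_ : (fun g => 0 *: 0) = fun=> 0) ?mul0r //; apply/funext => g; rewrite scale0r.
Qed.

Lemma bigspin_ip M e phi : (forall k, scont (e k)) -> scont phi ->
  ip (bigspin M e) phi = \sum_(k < M) ip (e k) phi.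
Proof.
move=> h hp; elim: M => [|M IH]; first by rewrite bigspin0 big_ord0 ip0l.
rewrite bigspinS big_ord_recr /= -IH ipD //.
elim: M {IH} => [|M IH]; first by rewrite bigspin0; exact: scont_0.
by rewrite bigspinS; exact: scontD.
Qed.

Lemma bigspin_scont M e : (forall k, scont (e k)) -> scont (bigspin M e).
Proof.
move=> h; elim: M => [|M IH]; first by rewrite bigspin0; exact: scont_0.
by rewrite bigspinS; exact: scontD.
Qed.

Lemma conjc_sum M (z : nat -> C) : conjc (\sum_(k < M) z k) = \sum_(k < M) conjc (z k).
Proof.
elim: M => [|M IH]; first by rewrite !big_ord0; apply: complex_ext; rewrite /= ?oppr0.
by rewrite !big_ord_recr /= -IH conjcD.
Qed.

Lemma bigspin_ipr M e phi : (forall k, scont (e k)) -> scont phi ->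
  ip phi (bigspin M e) = \sum_(k < M) ip phi (e k).
Proof.
move=> h hp; rewrite (ipC (bigspin_scont M h) hp) (bigspin_ip M h hp).
rewrite (conjc_sum M (fun k => ip (e k) phi)).
by apply: eq_bigr => k _; rewrite -(ipC (h k) hp).
Qed.

Lemma conjcR (r : R) : conjc r%:C = r%:C :> C.
Proof. by apply: complex_ext => /=; rewrite ?oppr0. Qed.

Lemma eigspan_scont pos n psi : eigspan pos n psi -> scont psi.
Proof. by move=> h; apply: sC1_scont; exact: eigspan_sC1 h. Qed.

Lemma ip_eigenfunction (l l' : R) psi phi : sC1 psi -> sC1 phi ->
  (forall g, dirac psi g = l%:C *: psi g) -> (forall g, dirac phi g = l'%:C *: phi g) ->
  l != l' -> ip psi phi = 0.
Proof.
move=> h k hl hl' ne; have := dirac_symmetric h k.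
have -> : dirac psi = (fun g => l%:C *: psi g) by apply/funext.
have -> : dirac phi = (fun g => l'%:C *: phi g) by apply/funext.
have hs := sC1_scont h; have ks := sC1_scont k.
rewrite (ipZ _ hs ks) (ipZr _ hs ks) conjcR.
move/eqP; rewrite -subr_eq0 -mulrBl mulf_eq0 -rmorphB /= => /orP[|/eqP //].
by rewrite fmorph_eq0 subr_eq0 (negbTE ne).
Qed.

Lemma eigspan_orth p n p' n' psi phi : eigspan p n psi -> eigspan p' n' phi ->
  eigval R p n != eigval R p' n' -> ip psi phi = 0.
Proof.
move=> h k; apply: (ip_eigenfunction (eigspan_sC1 h) (eigspan_sC1 k)).
  exact: eigspan_dirac.
exact: eigspan_dirac.
Qed.

Lemma eigval_neq p n p' n' : (p, n) != (p', n') -> eigval R p n != eigval R p' n'.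
Proof.
rewrite /eigval xpair_eqE => ne.
have n0 := ler0n R n; have n0' := ler0n R n'.
have [pp|pp] := eqVneq p p'; last first.
  by case: p p' pp {ne} => [] [] // _; apply/eqP; lra.
move: ne; rewrite -{p'}pp eqxx /= => ne.
have nr : (n%:R : R) != n'%:R by rewrite eqr_nat.
by case: p; apply: contra_neq nr; lra.
Qed.

Lemma alpha_neq (k l : nat) : k != l -> alpha k != alpha l.
Proof.
move=> kl; apply: eigval_neq; apply: contra_neq kl => -[od hf].
by rewrite -(odd_double_half k) od hf odd_double_half.
Qed.

(** Index [k] is reserved for the eigenvalue [alpha k], so members of distinct index are orthogonal
    and Pythagoras applies. *)
Definition alpha_family e := forall k, eigspan (odd k) k./2 (e k).

Lemma alpha_familyZ (c : nat -> C) e : alpha_family e -> alpha_family (fun k g => c k *: e k g).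
Proof. by move=> h k; exact: eigspanZ. Qed.

Lemma alpha_family_sC1 e : alpha_family e -> forall k, sC1 (e k).
Proof. by move=> h k; exact: eigspan_sC1 (h k). Qed.

Lemma alpha_family_scont e : alpha_family e -> forall k, scont (e k).
Proof. by move=> h k; exact: eigspan_scont (h k). Qed.

Lemma spinpoly_decomposition psi : spinpoly psi -> exists M e, alpha_family e /\
  forall K, (M <= K)%N -> forall g, psi g = bigspin K e g.
Proof.
elim => [pos n f h|f1 f2 _ [M1 [e1 [a1 h1]]] _ [M2 [e2 [a2 h2]]]].
  pose k0 := (pos + n.*2)%N.
  have [od hf] : odd k0 = pos /\ k0./2 = n by rewrite /k0 oddD odd_double addbF oddb half_bit_double.
  exists k0.+1, (fun k => if k == k0 then f else fun=> 0); split.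
    move=> k; case: (eqVneq k k0) => [->|_]; last exact: eigspan0.
    by rewrite od hf.
  move=> K kK g; rewrite /bigspin (bigD1 (Ordinal kK)) //= eqxx big1 ?addr0 // => i ik.
  by rewrite ifN.
exists (maxn M1 M2), (fun k g => e1 k g + e2 k g); split; first by move=> k; exact: eigspanD.
move=> K; rewrite geq_max => /andP[k1 k2] g.
by rewrite (h1 K k1) (h2 K k2) /bigspin -big_split.
Qed.

Lemma pythagoras M e : alpha_family e ->
  L2norm2 (bigspin M e) = \sum_(k < M) L2norm2 (e k).
Proof.
move=> h; have hc := alpha_family_scont h.
apply: (complexI (R := R)); rewrite -ip_L2norm2 rmorph_sum /= (bigspin_ip M hc (bigspin_scont M hc)).
apply: eq_bigr => k _; rewrite (bigspin_ipr M hc (hc k)) (bigD1 k) //= ip_L2norm2 big1 ?addr0 //.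
move=> l lk; apply: (eigspan_orth (h k) (h l)); apply: alpha_neq.
by rewrite eq_sym.
Qed.

Lemma L2norm2Z (c : C) psi : scont psi ->
  L2norm2 (fun g => c *: psi g) = (complex.Re c ^+ 2 + complex.Im c ^+ 2) * L2norm2 psi.
Proof.
move=> h; apply: (complexI (R := R)); rewrite -ip_L2norm2 (ipZ c h (scontZ c h)) (ipZr c h h) ip_L2norm2.
rewrite mulrA rmorphM /=; congr (_ * _).
by case: c => a b; apply: complex_ext => /=; ring.
Qed.

Lemma L2norm2_sub (t : R) psi phi : scont psi -> scont phi ->
  L2norm2 (fun g => psi g - t%:C *: phi g) =
  L2norm2 psi - 2 * t * complex.Re (ip psi phi) + t ^+ 2 * L2norm2 phi.
Proof.
move=> h k.
have -> : (fun g => psi g - t%:C *: phi g) = (fun g => psi g + (- t%:C) *: phi g).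
  by apply/funext => g; rewrite scaleNr.
have kz := scontZ (- t%:C) k.
apply: (complexI (R := R)); rewrite -ip_L2norm2 (ipD h kz (scontD h kz)) (ipDr h h kz) (ipDr kz h kz).
rewrite (ipZ _ k kz) (ipZ _ k h) (ipZr _ k k) (ipZr _ h k) !ip_L2norm2 (ipC h k).
move: (ip psi phi) (L2norm2 psi) (L2norm2 phi) => z x y {h k kz}.
case: z => a b; apply: complex_ext => /=; ring.
Qed.

Lemma shift_dirac_sC1 lambda psi : sC1 psi -> scont (fun g => dirac psi g - lambda *: psi g).
Proof.
move=> h; have : scont (fun g => dirac psi g + (- lambda) *: psi g).
  by apply: scontD; [exact: scont_dirac|apply: scontZ; exact: sC1_scont].
by congr (scont _); apply/funext => g; rewrite scaleNr.
Qed.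

Lemma ip_shift_dirac lambda psi pos n phi : sC1 psi -> eigspan pos n phi ->
  ip (fun g => dirac psi g - lambda *: psi g) phi = ((eigval R pos n)%:C - lambda) * ip psi phi.
Proof.
move=> h k; have hs := sC1_scont h; have kc := eigspan_scont k.
have -> : (fun g => dirac psi g - lambda *: psi g) = (fun g => dirac psi g + (- lambda) *: psi g).
  by apply/funext => g; rewrite scaleNr.
rewrite (ipD (scont_dirac h) (scontZ _ hs) kc) (ipZ _ hs kc) (dirac_symmetric h (eigspan_sC1 k)).
have -> : dirac phi = (fun g => (eigval R pos n)%:C *: phi g).
  by apply/funext => g; exact: eigspan_dirac.
by rewrite (ipZr _ hs kc) conjcR mulrBl mulNr.
Qed.

Lemma div_le1 (c q : R) : 0 < c -> c <= q -> c / q <= 1.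
Proof. by move=> c0 cq; rewrite ler_pdivrMr ?mul1r // (lt_le_trans c0). Qed.

(** Here [A], [u], [s] and [p] are the squared norms of [(D - lambda) psi], of the test spinor, of
    the approximation and of [psi], and [w] is the real part of the common inner product. Dividing
    the square by [c] and using [c * u <= s] eliminates [w]. *)
Lemma completed_square_le (A c e p s u w : R) : 0 < c ->
  0 <= A - 2 * c * w + c ^+ 2 * u -> c * u <= s -> p - 2 * w + s <= e -> p <= A / c + e.
Proof.
move=> c0 h1 h2 h3.
have h4 : 0 <= A / c - 2 * w + c * u.
  rewrite -(pmulr_rge0 _ c0) (_ : c * (_ + _) = A - 2 * c * w + c ^+ 2 * u) //.
  by field; rewrite gt_eqF.
lra.
Qed.

Lemma sqnorm_inv (z : C) : complex.Re z^-1 ^+ 2 + complex.Im z^-1 ^+ 2 =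
  (complex.Re z ^+ 2 + complex.Im z ^+ 2)^-1.
Proof.
have [->|z0] := eqVneq z 0; first by rewrite invr0 /= !expr0n addr0 invr0.
have q0 : complex.Re z ^+ 2 + complex.Im z ^+ 2 != 0.
  apply: contra_neq z0 => q0; have h := sqr_ge0 (complex.Re z); have k := sqr_ge0 (complex.Im z).
  by apply: complex_ext => /=; apply/eqP; rewrite -sqrf_eq0; apply/eqP; lra.
by move: z0 q0; case: z => a b /= _ q0; field.
Qed.

Lemma conj_inv_shift (x : R) (z : C) : conjc (x%:C - conjc z)^-1 = (x%:C - z)^-1.
Proof.
by rewrite conjc_inv; congr (_^-1); case: z => a b; apply: complex_ext => /=; ring.
Qed.

(* If s = sum_k e_k is close to psi and u = sum_k e_k / (alpha_k - conj lambda),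
   then <psi, s> = <(D - lambda) psi, u> and c |u|^2 <= |s|^2; complete the square. *)
Lemma resolvent_bound lambda (c : R) : 0 < c ->
  (forall k, c <= (alpha k - complex.Re lambda) ^+ 2 + complex.Im lambda ^+ 2) ->
  forall psi, sC1 psi -> c * L2norm2 psi <= L2norm2 (fun g => dirac psi g - lambda *: psi g).
Proof.
move=> c0 hc psi h; have hs := sC1_scont h.
set A := L2norm2 (fun g => dirac psi g - _).
have hA := shift_dirac_sC1 lambda h.
rewrite -ler_pdivlMl // mulrC; apply/ler_addgt0Pr => e e_gt0.
have [d d0 hd] : exists2 d : R, 0 < d & 4 * d ^+ 2 * su2_volume R <= e.
  have v0 := @su2_volume_gt0 R.
  exists (Num.sqrt (e / (4 * su2_volume R))).
    by rewrite sqrtr_gt0 divr_gt0 // mulr_gt0.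
  rewrite sqr_sqrtr; last by rewrite divr_ge0 ?mulr_ge0 // ltW.
  by rewrite mulrAC mulrCA divff ?mulr1 // mulf_neq0 ?gt_eqF // pnatr_eq0.
have [s ss us] := spinor_density hs d0.
have [M [e1 [a1 h1]]] := spinpoly_decomposition ss.
have sE : s = bigspin M e1 by apply/funext => g; exact: h1.
pose u k : SU2 R -> 'cV[C]_2 := fun g => ((alpha k)%:C - conjc lambda)^-1 *: e1 k g.
have au : alpha_family u := alpha_familyZ _ a1.
have c1 := alpha_family_scont a1; have cu := alpha_family_scont au.
have ne k : (alpha k)%:C - lambda != 0.
  apply/negP => /eqP e0; have := hc k; move: e0; case: lambda {A hA hc u au cu} => a b e0.
  have := congr1 (@complex.Re R) e0; have := congr1 (@complex.Im R) e0 => /= {e0} h2 h3.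
  have b0 : b = 0 by lra.
  by rewrite b0 h3; lra.
have E : ip psi s = ip (fun g => dirac psi g - lambda *: psi g) (bigspin M u).
  rewrite sE (bigspin_ipr M c1 hs) (bigspin_ipr M cu hA); apply: eq_bigr => k _.
  rewrite (ip_shift_dirac lambda h (au k)) (ipZr _ hs (c1 k)) mulrA.
  suff -> : ((eigval R (odd k) k./2)%:C - lambda) * conjc ((alpha k)%:C - conjc lambda)^-1 = 1.
    by rewrite mul1r.
  by rewrite conj_inv_shift mulfV //; exact: ne.
have N : c * L2norm2 (bigspin M u) <= L2norm2 s.
  rewrite sE (pythagoras M au) (pythagoras M a1) mulr_sumr; apply: ler_sum => k _.
  rewrite (L2norm2Z _ (c1 k)) mulrA; apply: ler_piMl; first exact: L2norm2_ge0 (c1 k).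
  rewrite sqnorm_inv; move: (hc k) => hk.
  have -> : complex.Re ((alpha k)%:C - conjc lambda) ^+ 2 + complex.Im ((alpha k)%:C - conjc lambda) ^+ 2
      = (alpha k - complex.Re lambda) ^+ 2 + complex.Im lambda ^+ 2.
    by case: (lambda) => a b /=; ring.
  exact: div_le1 c0 hk.
have Y := L2norm2_ge0 (scontD hA (scontZ (- c%:C) (bigspin_scont M cu))).
have := L2norm2_sub c hA (bigspin_scont M cu); rewrite -/A -E => Y2.
have Y1 : 0 <= A - 2 * c * complex.Re (ip psi s) + c ^+ 2 * L2norm2 (bigspin M u).
  rewrite -Y2; congr (0 <= L2norm2 _) : Y; apply/funext => g; by rewrite scaleNr.
have sc : scont s by rewrite sE; exact: bigspin_scont.
have Z := uclose_L2 (ltW d0) hs sc us.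
have Z2 := L2norm2_sub 1 hs sc.
have Z3 : L2norm2 psi - 2 * complex.Re (ip psi s) + L2norm2 s <= e.
  move: Z2; rewrite expr1n mulr1 mul1r => <-; apply: le_trans hd; apply: le_trans Z.
  by rewrite le_eqVlt; apply/orP; left; apply/eqP; congr L2norm2; apply/funext => g; rewrite scale1r.
exact: completed_square_le c0 Y1 N Z3.
Qed.

End Resolvent.

(* L enumerates the finite group Gamma, possibly with repetitions. *)
Definition enumerates (R : realType) (L : seq (SU2 R)) (Gamma : set (SU2 R)) : Prop :=
  [/\ forall g, Gamma g <-> g \in L, (0 < size L)%N &
      forall g, Gamma g -> perm_eq [seq su2mul g k | k <- L] L].

Definition average (R : realType) (L : seq (SU2 R)) (psi : SU2 R -> 'cV[R[i]]_2) :
    SU2 R -> 'cV[R[i]]_2 :=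
  fun g => (size L)%:R^-1 *: \sum_(k <- L) (k : 'M[R[i]]_2) *m psi (su2mul g k).

(** * Averaging over the group *)

Section Averaging.
Variables (R : realType) (L : seq (SU2 R)) (Gamma : set (SU2 R)).
Hypothesis LG : enumerates L Gamma.
Local Notation C := R[i].
Local Notation avg := (average L).
Implicit Types (psi phi : SU2 R -> 'cV[C]_2) (g : SU2 R).

Definition equivariant psi := forall g gamma, Gamma gamma ->
  psi (su2mul g gamma) = invmx gamma *m psi g.

Lemma average_equivariant psi : equivariant (avg psi).
Proof.
have [_ _ Lp] := LG; move=> g h Gh.
rewrite /avg -scalemxAr; congr (_ *: _).
transitivity (\sum_(k <- [seq su2mul h k | k <- L]) (invmx h *m ((k : 'M[C]_2) *m psi (su2mul g k)))).
  rewrite big_map; apply: eq_bigr => k _.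
  by rewrite su2mulE !mulmxA mulVmx ?su2_unit // mul1mx -su2mulA.
by rewrite (perm_big _ (Lp h Gh)) /= mulmx_sumr.
Qed.

Lemma size_neq0 : (size L)%:R != 0 :> C.
Proof. by have [_ s0 _] := LG; rewrite pnatr_eq0 -lt0n. Qed.

Lemma average_id psi : equivariant psi -> avg psi =1 psi.
Proof.
have [GL _ _] := LG; move=> h g; rewrite /average.
rewrite (eq_big_seq (fun=> psi g)); last first.
  by move=> k /GL Gk; rewrite (h g k Gk) mulmxA mulmxV ?su2_unit // mul1mx.
rewrite big_const_seq count_predT -Monoid.iteropE /= -[iterop _ _ _ _]/(psi g *+ size L).
by rewrite -(@scaler_nat C _ (size L) (psi g)) scalerA mulVf ?scale1r // size_neq0.
Qed.

Lemma average_bigspin M e g : avg (bigspin M e) g = bigspin M (fun k => avg (e k)) g.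
Proof.
rewrite /bigspin /average -scaler_sumr exchange_big /=; congr (_ *: _).
by apply: eq_bigr => k _; rewrite mulmx_sumr.
Qed.

Lemma eigspan_sum pos n (s : seq (SU2 R)) (f : SU2 R -> SU2 R -> 'cV[C]_2) :
  (forall k, eigspan pos n (f k)) -> eigspan pos n (fun g => \sum_(k <- s) f k g).
Proof.
move=> h; elim: s => [|k s IH].
  by apply: eigspan_eq (@eigspan0 R pos n) => g; rewrite big_nil.
by apply: eigspan_eq (eigspanD (h k) IH) => g; rewrite big_cons.
Qed.

(** A generator goes to the generator with column [k tau]: the power by associativity, and the
    vector factor, for the positive sign, because [k (r k)^perp = r^perp] when the determinant is
    1. *)
Lemma eigspan_translate pos n psi (k : SU2 R) : eigspan pos n psi ->
  eigspan pos n (fun g => (k : 'M[C]_2) *m psi (su2mul g k)).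
Proof.
have d := su2_det k.
elim => [|s t x y|f1 f2 _ h1 _ h2|c f _ h].
- by apply: eigspan_eq (@eigspan0 R pos n) => g; rewrite mulmx0.
- apply: eigspan_eq (eigspanG pos n s t (k 0 0 * x + k 0 1 * y) (k 1 0 * x + k 1 1 * y)) => g.
  rewrite /egen su2mulE -bil_mul -scalemxAr; congr (_ *: _).
  case: pos; apply: col2P; rewrite mulmx_col2E ?col2_0 ?col2_1 //.
    rewrite /bil /rowL /rowR !mulmx2E.
    by rewrite -[LHS]mul1r -d; ring.
  rewrite /bil /rowL /rowR !mulmx2E.
  by rewrite -[LHS]mul1r -d; ring.
- by apply: eigspan_eq (eigspanD h1 h2) => g; rewrite mulmxDr.
- by apply: eigspan_eq (eigspanZ c h) => g; rewrite scalemxAr.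
Qed.

Lemma eigspan_average pos n psi : eigspan pos n psi -> eigspan pos n (avg psi).
Proof.
move=> h; apply: eigspanZ; apply: eigspan_sum => k; exact: eigspan_translate.
Qed.

Lemma alpha_family_average e : alpha_family e -> alpha_family (fun k => avg (e k)).
Proof. by move=> h k; exact: eigspan_average. Qed.

Lemma cpol_sum M (f : nat -> SU2 R -> C) : (forall k, cpol (f k)) -> cpol (fun g => \sum_(k < M) f k g).
Proof.
move=> h; elim: M => [|M IH].
  by apply: (cpol_eq _ (@cpol_cst R 0)) => g; rewrite big_ord0.
by apply: cpol_eq (cpolD IH (h M)) => g; rewrite big_ord_recr.
Qed.

Lemma bigspin_smooth M e j : alpha_family e ->
  smooth (fun g => complex.Re (bigspin M e g j 0)) /\ smooth (fun g => complex.Im (bigspin M e g j 0)).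
Proof.
move=> h; apply: cpol_smooth; have := cpol_sum M (fun k => eigspan_cpol (h k) j).
by apply: cpol_eq => g; rewrite /bigspin summxE.
Qed.

Lemma su2_entry_le (k : SU2 R) (a b : 'I_2) :
  `|complex.Re ((k : 'M[C]_2) a b)| <= 1 /\ `|complex.Im ((k : 'M[C]_2) a b)| <= 1.
Proof.
have h := su2_rows k a a; rewrite eqxx in h.
have sq (x y u v : R) : x ^+ 2 + y ^+ 2 + u ^+ 2 + v ^+ 2 = 1 -> `|x| <= 1 /\ `|y| <= 1.
  move=> e1; have := sqr_ge0 x; have := sqr_ge0 y; have := sqr_ge0 u; have := sqr_ge0 v.
  by move=> *; split; rewrite -(ler_sqr (x := `|_|)) ?nnegrE // real_normK ?num_real // expr1n; lra.
have := congr1 (@complex.Re R) h; move: b; apply: ord2P.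
  by case: (k a 0) (k a 1) => [x y] [u v] /= e; apply: (sq x y u v); rewrite -e; ring.
by case: (k a 0) (k a 1) => [x y] [u v] /= e; apply: (sq u v x y); rewrite -e; ring.
Qed.

Lemma mul_part_le (e : R) (z w : C) : 0 <= e ->
  `|complex.Re z| <= 1 -> `|complex.Im z| <= 1 -> `|complex.Re w| <= e -> `|complex.Im w| <= e ->
  `|complex.Re (z * w)| <= 2 * e /\ `|complex.Im (z * w)| <= 2 * e.
Proof.
case: z w => [a b] [c d] /= e0 h1 h2 h3 h4.
have P (x y : R) : `|x| <= 1 -> `|y| <= e -> `|x * y| <= e.
  by move=> hx hy; rewrite normrM -[leRHS]mul1r; apply: ler_pM.
split.
  apply: le_trans (ler_normB _ _) _; have := P _ _ h1 h3; have := P _ _ h2 h4; lra.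
apply: le_trans (ler_normD _ _) _; have := P _ _ h1 h4; have := P _ _ h2 h3; lra.
Qed.

(** A component of [k *m v] is a sum of two products whose real and imaginary parts are at most
    [2 * e]; taking the mean over [L] keeps the bound. *)
Lemma uclose_average psi phi e : 0 <= e -> uclose e psi phi -> uclose (4 * e) (avg psi) (avg phi).
Proof.
move=> e0 h.
have s0 : 0 < (size L)%:R :> R by have [_ s0 _] := LG; rewrite ltr0n.
have B (s : seq (SU2 R)) g j :
    `|complex.Re ((\sum_(k <- s) (k : 'M[C]_2) *m (psi (su2mul g k) - phi (su2mul g k))) j 0)|
      <= (size s)%:R * (4 * e) /\
    `|complex.Im ((\sum_(k <- s) (k : 'M[C]_2) *m (psi (su2mul g k) - phi (su2mul g k))) j 0)|
      <= (size s)%:R * (4 * e).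
  elim: s => [|k s [IH1 IH2]]; first by rewrite big_nil mxE /= normr0 mul0r.
  rewrite big_cons colDE mulmx_col2E !colDE !colNE /= -natr1 mulrDl mul1r.
  have [p1 p2] := h (su2mul g k) 0; have [q1 q2] := h (su2mul g k) 1.
  have [a1 a2] := su2_entry_le k j 0; have [b1 b2] := su2_entry_le k j 1.
  have [c1 c2] := mul_part_le e0 a1 a2 p1 p2; have [d1 d2] := mul_part_le e0 b1 b2 q1 q2.
  rewrite !cReD !cImD; split.
    apply: le_trans (ler_normD _ _) _; rewrite addrC; apply: lerD; first exact: IH1.
    apply: le_trans (ler_normD _ _) _; apply: le_trans (lerD c1 d1) _; lra.
  apply: le_trans (ler_normD _ _) _; rewrite addrC; apply: lerD; first exact: IH2.
  apply: le_trans (ler_normD _ _) _; apply: le_trans (lerD c2 d2) _; lra.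
move=> g j.
have -> : avg psi g j 0 - avg phi g j 0 = ((size L)%:R^-1 : R)%:C *
    ((\sum_(k <- L) (k : 'M[C]_2) *m (psi (su2mul g k) - phi (su2mul g k))) j 0).
  rewrite -colNE -colDE /average -scalerBr colZE fmorphV /= rmorph_nat; congr (_ * _).
  rewrite [in RHS](eq_bigr (fun k : SU2 R => (k : 'M[C]_2) *m psi (su2mul g k) -
    (k : 'M[C]_2) *m phi (su2mul g k))); last by move=> k _; rewrite mulmxBr.
  by rewrite sumrB.
have [h1 h2] := B L g j; move: h1 h2; move: (\sum_(k <- L) _) => m; case: (m j 0) => a b /= h1 h2.
have i0 : `|(size L)%:R^-1 : R| = (size L)%:R^-1 by rewrite ger0_norm // invr_ge0 ltW.
rewrite !mul0r addr0 subr0 !normrM i0.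
by rewrite !ler_pdivrMl.
Qed.

Lemma dirac_bigspin_shift (lambda : C) M e g : alpha_family e ->
  (forall k, (alpha R k)%:C != lambda) ->
  let u := bigspin M (fun k g => ((alpha R k)%:C - lambda)^-1 *: e k g) in
  dirac u g - lambda *: u g = bigspin M e g.
Proof.
move=> ae ne u; pose v k (g : SU2 R) := ((alpha R k)%:C - lambda)^-1 *: e k g.
have av : alpha_family v := alpha_familyZ _ ae.
rewrite /u (bigspin_dirac M g (alpha_family_sC1 av)) /bigspin scaler_sumr -sumrB.
apply: eq_bigr => k _; rewrite (eigspan_dirac (av k)) -scalerBl scalerA mulfV ?scale1r //.
by rewrite subr_eq0 ne.
Qed.

(** Approximate [phi] by a finite sum of eigenspinors, average, which fixes [phi] and preserves each
    eigenspace, and divide every component by [alpha k - lambda]. *)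
Lemma resolvent_dense (lambda : C) phi : (forall k, (alpha R k)%:C != lambda) ->
  sC1 phi -> equivariant phi -> forall e : R, 0 < e ->
  exists2 psi, spinor_field Gamma psi &
    L2norm2 (fun g => dirac psi g - lambda *: psi g - phi g) < e.
Proof.
move=> ne hphi ephi e e_gt0; have hs := sC1_scont hphi.
have v0 := @su2_volume_gt0 R.
(* Averaging multiplies the uniform error by 4 and [uclose_L2] brings another 4; the constant 128
   then leaves [e / 2]. *)
pose d : R := Num.sqrt (e / (128 * su2_volume R)).
have d0 : 0 < d by rewrite sqrtr_gt0 divr_gt0 // mulr_gt0.
have hd : 4 * (4 * d) ^+ 2 * su2_volume R < e.
  rewrite exprMn sqr_sqrtr; last by rewrite divr_ge0 ?mulr_ge0 // ltW.
  have -> : 4 * (4 ^+ 2 * (e / (128 * su2_volume R))) * su2_volume R = e / 2.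
    by field; rewrite gt_eqF.
  lra.
have [s ss us] := spinor_density hs d0.
have [M [e1 [a1 h1]]] := spinpoly_decomposition ss.
have sE : s = bigspin M e1 by apply/funext => g; exact: h1.
have a2 := alpha_family_average a1.
have a3 := alpha_familyZ (fun k => ((alpha R k)%:C - lambda)^-1) a2.
have sA : avg s =1 bigspin M (fun k => avg (e1 k)) by move=> g; rewrite sE average_bigspin.
exists (bigspin M (fun k g => ((alpha R k)%:C - lambda)^-1 *: avg (e1 k) g)).
  split=> [g h Gh|j]; last exact: bigspin_smooth.
  rewrite /bigspin mulmx_sumr; apply: eq_bigr => k _.
  by rewrite (average_equivariant _ _ Gh) scalemxAr.
apply: le_lt_trans hd.
set F := (X in L2norm2 X); have {F}-> : F = (fun g => - (phi g - avg s g)).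
  apply/funext => g; rewrite /F (dirac_bigspin_shift M g a2 ne) sA.
  by rewrite opprB.
have u4 := uclose_average (ltW d0) us.
have cs : scont (avg s).
  have -> : avg s = bigspin M (fun k => avg (e1 k)) by apply/funext.
  exact: bigspin_scont (alpha_family_scont a2).
have u5 : uclose (4 * d) phi (avg s).
  by move=> g j; rewrite -(average_id ephi g); exact: u4.
have d4 : 0 <= 4 * d by rewrite mulr_ge0 // ltW.
apply: le_trans (uclose_L2 d4 hs cs u5).
rewrite le_eqVlt; apply/orP; left; apply/eqP; rewrite !L2norm2E; apply: su2_int_eq => g.
by rewrite /normsq; apply: eq_bigr => j _; rewrite colNE cReN cImN !sqrrN.
Qed.

End Averaging.

(** * Binary forms *)

(** The coefficients of the [d]-th power of a linear form. Such powers span all forms, so identities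
    linear in the coefficients are checked on them. *)
Definition power_form (R : realType) (d : nat) (x y : R[i]) : 'rV[R[i]]_d.+1 :=
  \row_l ('C(d, l)%:R * (x ^+ l * y ^+ (d - l))).

Definition binary_form (R : realType) (d : nat) (c : 'rV[R[i]]_d.+1) (x y : R[i]) : R[i] :=
  \sum_l c 0 l * (x ^+ l * y ^+ (d - l)).

Definition kernel_monomial (R : realType) (pos : bool) (d l : nat) (x y : R[i]) : 'cV[R[i]]_2 :=
  if pos then (x ^+ l * y ^+ (d - l)) *: col2 y (- x)
  else col2 (l%:R * (x ^+ l.-1 * y ^+ (d - l))) ((d - l)%:R * (x ^+ l * y ^+ (d - l).-1)).

(* For the binary form Q with coefficients c and r = (x, y): Q(r) r^perp, resp.
   the gradient of Q at r. *)
Definition kernel_form (R : realType) (pos : bool) (d : nat) (c : 'rV[R[i]]_d.+1) (x y : R[i]) :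
    'cV[R[i]]_2 :=
  \sum_l c 0 l *: kernel_monomial pos d l x y.

(** For binary forms of degree [d], [rot_degree] is the exponent [n] of the eigenspinors and
    [kernel_degree] the degree [e] in the row. On the negative side the kernel is a gradient, which
    vanishes for [d = 0]; hence the recurring assumption [pos || (0 < d)]. *)
Definition rot_degree (pos : bool) (d : nat) : nat := if pos then d else d.-1.
Definition kernel_degree (pos : bool) (d : nat) : nat := if pos then d.+1 else d.-1.

Section BinaryForms.
Variable R : realType.
Local Notation C := R[i].
Implicit Types (x y s t u v : C) (pos : bool).

Lemma kernel_formD pos d (c c' : 'rV[C]_d.+1) x y :
  kernel_form pos (c + c') x y = kernel_form pos c x y + kernel_form pos c' x y.
Proof.
rewrite /kernel_form -big_split /=; apply: eq_bigr => l _; by rewrite mxE scalerDl.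
Qed.

Lemma kernel_formZ pos d (a : C) (c : 'rV[C]_d.+1) x y :
  kernel_form pos (a *: c) x y = a *: kernel_form pos c x y.
Proof.
rewrite /kernel_form scaler_sumr; apply: eq_bigr => l _; by rewrite mxE scalerA.
Qed.

Lemma kernel_form0 pos d x y : kernel_form pos (0 : 'rV[C]_d.+1) x y = 0.
Proof. by rewrite -[X in kernel_form _ X](scale0r 0) kernel_formZ scale0r. Qed.

Lemma binary_formD d (c c' : 'rV[C]_d.+1) x y :
  binary_form (c + c') x y = binary_form c x y + binary_form c' x y.
Proof. by rewrite /binary_form -big_split /=; apply: eq_bigr => l _; rewrite mxE mulrDl. Qed.

Lemma binary_formZ d (a : C) (c : 'rV[C]_d.+1) x y :
  binary_form (a *: c) x y = a * binary_form c x y.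
Proof. by rewrite /binary_form mulr_sumr; apply: eq_bigr => l _; rewrite mxE -mulrA. Qed.

Lemma binary_form_power d x y u v :
  binary_form (power_form d x y) u v = (u * x + v * y) ^+ d.
Proof.
rewrite addrC exprDn /binary_form; apply: eq_bigr => l _.
by rewrite !mxE !exprMn -mulr_natl; ring.
Qed.

Lemma kernel_form_pos d (c : 'rV[C]_d.+1) x y :
  kernel_form true c x y = binary_form c x y *: col2 y (- x).
Proof. by rewrite /kernel_form /binary_form scaler_suml; apply: eq_bigr => l _; rewrite scalerA. Qed.

Lemma kernel_form_power pos d x y u v :
  kernel_form pos (power_form d x y) u v = (if pos then 1 else d%:R) *:
    ((u * x + v * y) ^+ rot_degree pos d *: (if pos then col2 v (- u) else col2 x y)).
Proof.
case: pos; first by rewrite kernel_form_pos binary_form_power scale1r.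
rewrite /rot_degree /kernel_form /kernel_monomial.
case: d => [|d].
  by rewrite big_ord_recl big_ord0 scale0r addr0; apply: col2P; rewrite colZE ?col2_0 ?col2_1 !mul0r !mulr0 mxE.
apply: col2P; rewrite summxE !colZE ?col2_0 ?col2_1 /=.
  rewrite big_ord_recl colZE col2_0 !mul0r mulr0 add0r.
  rewrite addrC exprDn mulr_suml mulr_sumr; apply: eq_bigr => l _.
  rewrite colZE col2_0 mxE /= /bump /= add1n subSS.
  have := mul_bin_diag d.+1 l; rewrite /= => /(congr1 (fun n => n%:R : C)); rewrite !natrM => e.
  transitivity ((l.+1%:R * 'C(d.+1, l.+1)%:R) * (x ^+ l.+1 * y ^+ (d - l) * (u ^+ l * v ^+ (d - l)))).
    by ring.
  by rewrite -e !exprMn -[_ *+ 'C(d, l)]mulr_natl exprS; ring.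
rewrite big_ord_recr colZE col2_1 /= subnn mul0r mulr0 addr0.
rewrite addrC exprDn mulr_suml mulr_sumr; apply: eq_bigr => l _.
rewrite colZE col2_1 mxE /=.
have ld : (l <= d)%N by rewrite -ltnS.
have := mul_bin_down d.+1 l; rewrite /= => /(congr1 (fun n => n%:R : C)); rewrite !natrM => e.
transitivity (((d.+1 - l)%:R * 'C(d.+1, l)%:R) * (x ^+ l * y ^+ (d.+1 - l) * (u ^+ l * v ^+ (d.+1 - l).-1))).
  by ring.
by rewrite -e !exprMn -[_ *+ 'C(d, l)]mulr_natl subSn //= exprS; ring.
Qed.

(** For the linear forms [(u, 1)] the coefficients are nonzero binomials times [u ^+ l], so
    Vandermonde inversion isolates each basis vector. *)
Lemma power_form_span d (S : 'rV[C]_d.+1 -> Prop) :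
  S 0 -> (forall c c', S c -> S c' -> S (c + c')) -> (forall a c, S c -> S (a *: c)) ->
  (forall u, S (power_form d u 1)) -> forall c, S c.
Proof.
move=> S0 SD SZ Sp c.
pose f (k : nat) (_ : unit) : 'rV[C]_d.+1 := 'C(d, k)%:R *: delta_mx 0 (inord k).
have Sf k : (k <= d)%N -> S (f k tt).
  move=> kd; apply: (@vandermonde_components R _ unit (fun h => S (h tt)) d f) kd => //.
  - by move=> h1 h2; exact: SD.
  - by move=> a h; exact: SZ.
  move=> u; have := Sp u; congr (S _); apply/rowP => l.
  rewrite mxE summxE (bigD1 l) //= big1 => [|i il].
    by rewrite !mxE inord_val !eqxx expr1n mulr1 addr0 /= mulr1 mulrC.
  by rewrite !mxE inord_val (eq_sym l) (negbTE il) andbF !mulr0.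
rewrite [c]row_sum_delta; apply: (big_ind S) => // l _.
have -> : delta_mx 0 l = ('C(d, l)%:R)^-1 *: f l tt :> 'rV[C]_d.+1.
  rewrite /f inord_val scalerA mulVf ?scale1r // pnatr_eq0 -lt0n bin_gt0.
  by rewrite -ltnS.
apply: (SZ); apply: (SZ); apply: Sf; by rewrite -ltnS.
Qed.

End BinaryForms.

(** * Symmetric powers and their characters *)

Section SymmetricPower.
Variable R : realType.
Local Notation C := R[i].
Implicit Types (x y s t u v a b : C) (pos : bool) (M N : 'M[C]_2).

Lemma coef_linear_mul a b (p : {poly C}) m :
  ((a *: 'X + b%:P) * p)`_m = a * (if m is k.+1 then p`_k else 0) + b * p`_m.
Proof. by rewrite mulrDl coefD -scalerAl coefZ coefXM mul_polyC coefZ; case: m. Qed.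

(** Forms of degree [d] are computed through univariate polynomials, whose coefficients supply the
    entries of [rho]. *)
Definition homogenize d (p : {poly C}) x y : C := \sum_(m < d.+1) p`_m * (x ^+ m * y ^+ (d - m)).

Lemma homogenize_mul d a b (p : {poly C}) x y : (size p <= d.+1)%N ->
  homogenize d.+1 ((a *: 'X + b%:P) * p) x y = (a * x + b * y) * homogenize d p x y.
Proof.
move=> sp; rewrite /homogenize.
under eq_bigr do rewrite coef_linear_mul mulrDl.
rewrite big_split /= mulrDl; congr (_ + _).
  rewrite big_ord_recl mulr0 mul0r add0r mulr_sumr; apply: eq_bigr => m _.
  by rewrite /= /bump /= add1n subSS exprS; ring.
rewrite big_ord_recr /= (nth_default _ sp) mulr0 mul0r addr0 mulr_sumr; apply: eq_bigr => m _.
by rewrite subSn ?exprS; [ring|rewrite -ltnS].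
Qed.

Lemma size_linear_mul d a b (p : {poly C}) : (size p <= d.+1)%N ->
  (size ((a *: 'X + b%:P) * p)%R <= d.+2)%N.
Proof.
move=> sp; apply/leq_sizeP => m dm; rewrite coef_linear_mul.
case: m dm => // m dm; rewrite !nth_default ?mulr0 ?addr0 //.
  by apply: leq_trans sp _; exact: ltnW.
by apply: leq_trans sp _.
Qed.

(* The matrix of c |-> c(r M) on binary forms of degree d, acting on coefficient rows. *)
Definition rho d M : 'M[C]_d.+1 :=
  \matrix_(l, m) ((M 0 0 *: 'X + (M 1 0)%:P) ^+ l * (M 0 1 *: 'X + (M 1 1)%:P) ^+ (d - l))`_m.

Lemma homogenize_linear_exp a b a' b' k l :
  let p := (a *: 'X + b%:P) ^+ k * (a' *: 'X + b'%:P) ^+ l in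
  (size p <= (k + l).+1)%N /\
  forall x y, homogenize (k + l) p x y = (a * x + b * y) ^+ k * (a' * x + b' * y) ^+ l.
Proof.
elim: k => [|k [IH1 IH2]] /=.
  rewrite expr0 add0n mul1r; elim: l => [|l [IH1 IH2]].
    rewrite expr0 size_poly1; split => // x y.
    by rewrite /homogenize big_ord_recl big_ord0 coef1 /= !expr0 !mulr1 addr0.
  rewrite exprS; split => [|x y]; first exact: size_linear_mul.
  by rewrite homogenize_mul // IH2 !expr0 !mul1r exprS.
rewrite exprS -mulrA addSn; split => [|x y]; first exact: size_linear_mul.
by rewrite homogenize_mul // IH2 exprS mulrA.
Qed.

Lemma binary_form_rho d M (c : 'rV[C]_d.+1) x y :
  binary_form (c *m rho d M) x y = binary_form c (rowL x y M) (rowR x y M).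
Proof.
rewrite /binary_form; under eq_bigr do rewrite mxE mulr_suml.
rewrite exchange_big /=; apply: eq_bigr => l _.
under eq_bigr do rewrite mxE -mulrA.
rewrite -mulr_sumr; congr (_ * _).
have [_] := homogenize_linear_exp (M 0 0) (M 1 0) (M 0 1) (M 1 1) l (d - l).
have ld : (l + (d - l) = d)%N by rewrite subnKC // -ltnS.
by rewrite ld => /(_ x y); rewrite /homogenize /rowL /rowR ![_ * x]mulrC ![_ * y]mulrC.
Qed.

Lemma binary_form_inj1 d (c c' : 'rV[C]_d.+1) :
  (forall x, binary_form c x 1 = binary_form c' x 1) -> c = c'.
Proof.
move=> h; apply/rowP => l.
pose f (k : nat) (_ : unit) : C^o := c 0 (inord k) - c' 0 (inord k).
have ld : (l <= d)%N by rewrite -ltnS.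
suff : f l tt = 0 by rewrite /f inord_val => /eqP; rewrite subr_eq0 => /eqP.
apply: (@vandermonde_components R C^o unit (fun h => h tt = 0) d f) ld => //.
- by move=> h1 h2 -> ->; rewrite addr0.
- by move=> a h1 ->; rewrite scaler0.
- move=> u; have := h u; rewrite /binary_form => /eqP; rewrite -subr_eq0 -sumrB => /eqP e.
  rewrite -[RHS]e; apply: eq_bigr => k _.
  by rewrite /f inord_val expr1n mulr1 -mulrBl [LHS]mulrC.
Qed.

Lemma binary_form_inj d (c c' : 'rV[C]_d.+1) :
  (forall x y, binary_form c x y = binary_form c' x y) -> c = c'.
Proof. by move=> h; apply: binary_form_inj1 => x; exact: h. Qed.

Lemma row_mulmx_inj d (A B : 'M[C]_d.+1) : (forall c : 'rV_d.+1, c *m A = c *m B) -> A = B.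
Proof. by move=> h; apply/row_matrixP => i; rewrite !rowE. Qed.

Lemma rowL_mul s t M N : rowL s t (M *m N) = rowL (rowL s t M) (rowR s t M) N.
Proof. by rewrite /rowL /rowR !mulmx2E; ring. Qed.

Lemma rowR_mul s t M N : rowR s t (M *m N) = rowR (rowL s t M) (rowR s t M) N.
Proof. by rewrite /rowL /rowR !mulmx2E; ring. Qed.

(** Substituting first [r M] and then [r N] evaluates the form at [r N M], so the order is
    reversed. *)
Lemma rhoM d M N : rho d M *m rho d N = rho d (N *m M).
Proof.
apply: row_mulmx_inj => c; apply: binary_form_inj => x y.
by rewrite mulmxA !binary_form_rho rowL_mul rowR_mul.
Qed.

Lemma rho1 d : rho d 1%:M = 1%:M.
Proof.
apply: row_mulmx_inj => c; apply: binary_form_inj => x y.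
by rewrite binary_form_rho mulmx1 /rowL /rowR !mxE /= !mulr1 !mulr0 addr0 add0r.
Qed.

Lemma power_form_rho d M x y :
  power_form d x y *m rho d M = power_form d (M 0 0 * x + M 0 1 * y) (M 1 0 * x + M 1 1 * y).
Proof.
apply: binary_form_inj => u v; rewrite binary_form_rho !binary_form_power /rowL /rowR.
by congr (_ ^+ _); ring.
Qed.

(** Checked on powers, where [M] acts on the column of the linear form. For the positive sign it
    rests on [M (r M)^perp = r^perp]; for the negative one it is the chain rule for gradients. *)
Lemma kernel_form_rho pos d M (c : 'rV[C]_d.+1) x y : \det M = 1 ->
  M *m kernel_form pos c (rowL x y M) (rowR x y M) = kernel_form pos (c *m rho d M) x y.
Proof.
rewrite det2E => dM; move: c; apply: power_form_span => [|c c' h h'|a c h|u].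
- by rewrite mul0mx !kernel_form0 mulmx0.
- by rewrite mulmxDl !kernel_formD mulmxDr h h'.
- by rewrite -scalemxAl !kernel_formZ -scalemxAr h.
rewrite power_form_rho !kernel_form_power -!scalemxAr; congr (_ *: _).
have -> : rowL x y M * u + rowR x y M * 1 =
    x * (M 0 0 * u + M 0 1 * 1) + y * (M 1 0 * u + M 1 1 * 1) by rewrite /rowL /rowR; ring.
congr (_ *: _); case: pos; apply: col2P; rewrite mulmx_col2E ?col2_0 ?col2_1 //.
  by rewrite -[RHS]mul1r -dM /rowL /rowR; ring.
by rewrite -[RHS]mul1r -dM /rowL /rowR; ring.
Qed.

Fixpoint cheb2 (T : C) (n : nat) : C * C :=
  if n is m.+1 then let: (u, w) := cheb2 T m in (w, T * w - u) else (1, T).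

(* The Chebyshev polynomials U_n(T / 2). *)
Definition chebU T n : C := (cheb2 T n).1.

Lemma chebU_SS T n : chebU T n.+2 = T * chebU T n.+1 - chebU T n.
Proof. by rewrite /chebU /=; case: (cheb2 T n). Qed.

Lemma sum_geom_chebU a b d : a * b = 1 -> \sum_(l < d.+1) a ^+ l * b ^+ (d - l) = chebU (a + b) d.
Proof.
move=> ab; pose S d := \sum_(l < d.+1) a ^+ l * b ^+ (d - l).
have S1 k : S k.+1 = a ^+ k.+1 + b * S k.
  rewrite {1}/S big_ord_recr /= subnn expr0 mulr1 addrC mulr_sumr; congr (_ + _).
  by apply: eq_bigr => l _; rewrite subSn ?exprS; [ring|rewrite -ltnS].
have S0 : S 0%N = 1 by rewrite /S big_ord_recl big_ord0 !expr0 mulr1 addr0.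
suff h k : S k = chebU (a + b) k /\ S k.+1 = chebU (a + b) k.+1 by have [] := h d.
elim: k => [|k [IH1 IH2]]; first by rewrite S1 S0 expr1 mulr1.
split => //; rewrite chebU_SS -IH1 -IH2 S1.
rewrite mulrDl -[S k]mul1r -ab.
have -> : a * S k.+1 = a * (a ^+ k.+1 + b * S k) by rewrite S1.
by rewrite [a ^+ k.+2]exprS; ring.
Qed.

Lemma coef_linear_exp a b l : ((a *: 'X + b%:P) ^+ l)`_l = a ^+ l.
Proof.
elim: l => [|l IH]; first by rewrite !expr0 coef1.
have [sp _] := homogenize_linear_exp a b 0 0 l 0; move: sp; rewrite expr0 mulr1 addn0 => sp.
by rewrite exprS coef_linear_mul IH (nth_default _ sp) mulr0 addr0 exprS.
Qed.

Lemma tr_rho_triangular d M : M 0 1 = 0 -> \det M = 1 -> \tr (rho d M) = chebU (\tr M) d.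
Proof.
rewrite det2E => M01; rewrite M01 mul0r subr0 => dM.
have -> : \tr M = M 0 0 + M 1 1.
  rewrite /mxtrace !big_ord_recl big_ord0 addr0; congr (M _ _ + M _ _); exact: val_inj.
rewrite -sum_geom_chebU //; apply: eq_bigr => l _.
by rewrite mxE M01 scale0r add0r -rmorphXn /= coefMC coef_linear_exp.
Qed.

(** A matrix that is not lower triangular is conjugated to one that is, by means of an eigenvalue
    [a]. In the triangular case the diagonal of [rho] consists of the monomials [a^l b^(d - l)] in
    the two eigenvalues, whose sum obeys the Chebyshev recursion. *)
Lemma tr_rho d M : \det M = 1 -> \tr (rho d M) = chebU (\tr M) d.
Proof.
move=> dM; have dM' := dM; rewrite det2E in dM'.
have [M01|M01] := eqVneq (M 0 1) 0; first exact: tr_rho_triangular.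
have tr2 N : \tr N = N 0 0 + N 1 1.
  rewrite /mxtrace !big_ord_recl big_ord0 addr0; congr (N _ _ + N _ _); exact: val_inj.
have [a ha] : exists a, a ^+ 2 - \tr M * a + 1 = 0.
  pose D := sqrtc ((\tr M) ^+ 2 - 4); exists ((\tr M + D) / 2).
  have D2 : D ^+ 2 = (\tr M) ^+ 2 - 4 by rewrite /D sqr_sqrtc.
  transitivity ((D ^+ 2 - ((\tr M) ^+ 2 - 4)) / 4); first by field.
  by rewrite D2 subrr mul0r.
rewrite tr2 in ha.
(* The columns are the second basis vector and an eigenvector for [a]; they are independent because
   [M 0 1] is nonzero. *)
pose h : 'M[C]_2 := mx2 0 (M 0 1) 1 (a - M 0 0).
pose N : 'M[C]_2 := mx2 (M 0 0 + M 1 1 - a) 0 1 a.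
have Mh : M *m h = h *m N.
  apply: matrix2P; rewrite !mulmx2E !mx2E; try by ring.
  apply/eqP; rewrite -subr_eq0; apply/eqP.
  transitivity (- (a ^+ 2 - (M 0 0 + M 1 1) * a + (M 0 0 * M 1 1 - M 0 1 * M 1 0))); first by ring.
  by rewrite dM' ha oppr0.
have uh : h \in unitmx.
  by rewrite unitmxE det_mx2 mul0r sub0r mulr1 unitfE oppr_eq0.
have rh : rho d h *m rho d (invmx h) = 1%:M by rewrite rhoM mulVmx // rho1.
have e : rho d M = rho d (invmx h) *m (rho d N *m rho d h).
  by rewrite [X in _ *m X]rhoM -Mh rhoM -mulmxA mulmxV // mulmx1.
have dN : \det N = 1.
  by move: ha; rewrite det_mx2 => ha; rewrite mul0r subr0 -[RHS]subr0 -ha; ring.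
rewrite e mxtrace_mulC -mulmxA rh mulmx1 tr_rho_triangular //.
  by rewrite !tr2 !mx2E; congr chebU; ring.
by rewrite mx2E.
Qed.

(** In the full rank factorisation of [P] idempotence cancels to [row_base P *m col_base P = 1%:M],
    an identity of size the rank, and the trace is cyclic. *)
Lemma mxtrace_idempotent (n : nat) (P : 'M[C]_n) : P *m P = P -> \tr P = (\rank P)%:R.
Proof.
move=> PP; have rc : row_base P *m col_base P = 1%:M.
  have h : col_base P *m (row_base P *m col_base P) *m row_base P = col_base P *m 1%:M *m row_base P.
    have e : (col_base P *m row_base P) *m (col_base P *m row_base P) = col_base P *m row_base P.
      by rewrite !mulmx_base.
    by rewrite mulmx1 -[RHS]e !mulmxA.
  have /row_free_inj := row_base_free P; move=> /(_ _ _ _ h) {}h.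
  have /row_full_inj := col_base_full P; by move=> /(_ _ _ _ h).
by rewrite -{1}(mulmx_base P) mxtrace_mulC rc mxtrace1.
Qed.

End SymmetricPower.

(* The points (1, i), i <= e, suffice because the kernels are homogeneous of
   degree e in r. *)
Definition kernel_family (R : realType) (pos : bool) (d e : nat) (A : 'M[R[i]]_(e.+1, d.+1))
    (M : 'M[R[i]]_2) : 'cV[R[i]]_2 :=
  \sum_(i < e.+1) kernel_form pos (row i A) (rowL 1 i%:R M) (rowR 1 i%:R M).

(** * Eigenspinors recorded by coefficient matrices *)

Section KernelFamilies.
Variable R : realType.
Local Notation C := R[i].
Implicit Types (x y s t u v a b : C) (pos : bool) (M N : 'M[C]_2).

Definition hpol (e : nat) (F : C -> C -> C) : Prop := exists f : nat -> C,
  forall s t, F s t = \sum_(m < e.+1) s ^+ (e - m) * t ^+ m * f m.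

Lemma hpol_eq e F G : (forall s t, F s t = G s t) -> hpol e F -> hpol e G.
Proof. by move=> h [f hf]; exists f => s t; rewrite -h. Qed.

Lemma hpolD e F G : hpol e F -> hpol e G -> hpol e (fun s t => F s t + G s t).
Proof.
move=> [f hf] [g hg]; exists (fun m => f m + g m) => s t.
by rewrite hf hg -big_split; apply: eq_bigr => m _; rewrite mulrDr.
Qed.

Lemma hpolZ e a F : hpol e F -> hpol e (fun s t => a * F s t).
Proof.
move=> [f hf]; exists (fun m => a * f m) => s t.
by rewrite hf mulr_sumr; apply: eq_bigr => m _; ring.
Qed.

Lemma hpol_cst a : hpol 0 (fun _ _ => a).
Proof. by exists (fun=> a) => s t; rewrite big_ord_recl big_ord0 !expr0 !mul1r addr0. Qed.

Lemma hpolS e F : hpol e F -> hpol e.+1 (fun s t => s * F s t).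
Proof.
move=> [f hf]; exists (fun m => if (m <= e)%N then f m else 0) => s t.
rewrite hf [RHS]big_ord_recr /= ltnn mulr0 addr0 mulr_sumr; apply: eq_bigr => m _.
have me : (m <= e)%N by rewrite -ltnS.
by rewrite me subSn // exprS; ring.
Qed.

Lemma hpolT e F : hpol e F -> hpol e.+1 (fun s t => t * F s t).
Proof.
move=> [f hf]; exists (fun m => if m is k.+1 then f k else 0) => s t.
rewrite hf [RHS]big_ord_recl /= mulr0 add0r mulr_sumr; apply: eq_bigr => m _.
by rewrite /= /bump /= add1n subSS exprS; ring.
Qed.

Lemma hpol_linear e F a b : hpol e F -> hpol e.+1 (fun s t => (s * a + t * b) * F s t).
Proof.
move=> h; apply: hpol_eq (hpolD (hpolZ a (hpolS h)) (hpolZ b (hpolT h))) => s t.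
by ring.
Qed.

Lemma hpol_linear_exp n a b : hpol n (fun s t => (s * a + t * b) ^+ n).
Proof.
elim: n => [|n IH]; first exact: hpol_cst.
by apply: hpol_eq (hpol_linear a b IH) => s t; rewrite exprS.
Qed.

(** On [s = 1] a form of degree [e] is a polynomial in [t], recovered from its values at 0, ..., e.
    The weights depend only on [(s, t)] and thus serve all kernels and both components at once. *)
Lemma hpol_interpolation e : exists om : C -> C -> nat -> C, forall F, hpol e F ->
  forall s t, F s t = \sum_(i < e.+1) om s t i * F 1 i%:R.
Proof.
have [w hw] := @vandermonde_weights R e.
exists (fun s t i => \sum_(m < e.+1) s ^+ (e - m) * t ^+ m * w m i) => F [f hf] s t.
under eq_bigr do rewrite hf mulr_suml.
rewrite exchange_big /= hf; apply: eq_bigr => m _.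
have me : (m <= e)%N by rewrite -ltnS.
transitivity (\sum_(i < e.+1) \sum_(l < e.+1) s ^+ (e - m) * t ^+ m * (w m i * i%:R ^+ l) * f l); last first.
  by apply: eq_bigr => i _; rewrite mulr_sumr; apply: eq_bigr => l _; rewrite expr1n; ring.
rewrite exchange_big /= (bigD1 m) //= [X in _ + X]big1 => [|l lm].
  by rewrite -mulr_suml -mulr_sumr hw // eqxx mulr1 addr0.
have le : (l <= e)%N by rewrite -ltnS.
by rewrite -mulr_suml -mulr_sumr hw // val_eqE (negbTE lm) mulr0 mul0r.
Qed.

Lemma kernel_hpol pos d (c : 'rV[C]_d.+1) M j :
  hpol (kernel_degree pos d) (fun s t => kernel_form pos c (rowL s t M) (rowR s t M) j 0).
Proof.
move: c; apply: power_form_span => [|c c' h h'|a c h|u].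
- case: (hpolZ 0 (hpol_linear_exp (kernel_degree pos d) 0 0)) => f hf; exists f => s t.
  by rewrite -hf mul0r kernel_form0 mxE.
- by apply: hpol_eq (hpolD h h') => s t; rewrite kernel_formD mxE.
- by apply: hpol_eq (hpolZ a h) => s t; rewrite kernel_formZ mxE.
have E s t : rowL s t M * u + rowR s t M * 1 = s * (M 0 0 * u + M 0 1) + t * (M 1 0 * u + M 1 1).
  by rewrite /rowL /rowR; ring.
have h n := hpol_linear_exp n (M 0 0 * u + M 0 1) (M 1 0 * u + M 1 1).
case: pos; move: j; apply: ord2P; rewrite /kernel_degree.
- apply: hpol_eq (hpol_linear (M 0 1) (M 1 1) (h d)) => s t.
  by rewrite kernel_form_power E !colZE col2_0 mul1r mulrC.
- apply: hpol_eq (hpol_linear (- M 0 0) (- M 1 0) (h d)) => s t.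
  by rewrite kernel_form_power E !colZE col2_1 mul1r mulrC /rowL; ring.
- apply: hpol_eq (hpolZ (d%:R * u) (h d.-1)) => s t.
  by rewrite kernel_form_power E !colZE col2_0; ring.
- apply: hpol_eq (hpolZ d%:R (h d.-1)) => s t.
  by rewrite kernel_form_power E !colZE col2_1; ring.
Qed.

Lemma kernel_form_homogeneous pos d (c : 'rV[C]_d.+1) a x y :
  kernel_form pos c (a * x) (a * y) = a ^+ kernel_degree pos d *: kernel_form pos c x y.
Proof.
have H j : kernel_form pos c (a * x) (a * y) j 0 = a ^+ kernel_degree pos d * kernel_form pos c x y j 0.
  have [f hf] := kernel_hpol pos c (mx2 x y 0 0) j.
  have E s : rowL s 0 (mx2 x y 0 0) = s * x /\ rowR s 0 (mx2 x y 0 0) = s * y.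
    by rewrite /rowL /rowR !mx2E !mul0r !addr0.
  have := hf a 0; have := hf 1 0; have [-> ->] := E a; have [-> ->] := E 1.
  rewrite !mul1r => -> ->; rewrite mulr_sumr; apply: eq_bigr => -[[|m] mh] _ /=.
    by rewrite subn0 expr1n expr0; ring.
  by rewrite !expr0n /=; ring.
by apply: col2P; rewrite H colZE.
Qed.

Lemma kernel_familyD pos d e (A B : 'M[C]_(e.+1, d.+1)) M :
  kernel_family pos (A + B) M = kernel_family pos A M + kernel_family pos B M.
Proof.
by rewrite /kernel_family -big_split /=; apply: eq_bigr => i _; rewrite linearD kernel_formD.
Qed.

Lemma kernel_familyZ pos d e a (A : 'M[C]_(e.+1, d.+1)) M :
  kernel_family pos (a *: A) M = a *: kernel_family pos A M.
Proof.
by rewrite /kernel_family scaler_sumr /=; apply: eq_bigr => i _; rewrite linearZ kernel_formZ.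
Qed.

Lemma kernel_family_rho pos d e (A : 'M[C]_(e.+1, d.+1)) M N : \det N = 1 ->
  N *m kernel_family pos A (M *m N) = kernel_family pos (A *m rho d N) M.
Proof.
move=> dN; rewrite /kernel_family mulmx_sumr; apply: eq_bigr => i _.
by rewrite rowL_mul rowR_mul kernel_form_rho // row_mul.
Qed.

Lemma eigspan_kernel_form pos d (c : 'rV[C]_d.+1) s t :
  eigspan pos (rot_degree pos d) (fun g : SU2 R => kernel_form pos c (rowL s t g) (rowR s t g)).
Proof.
move: c; apply: power_form_span => [|c c' h h'|a c h|u].
- by apply: (eigspan_eq _ (@eigspan0 R _ _)) => g; rewrite kernel_form0.
- by apply: eigspan_eq (eigspanD h h') => g; rewrite kernel_formD.
- by apply: eigspan_eq (eigspanZ a h) => g; rewrite kernel_formZ.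
apply: eigspan_eq (eigspanZ (if pos then 1 else d%:R) (eigspanG pos (rot_degree pos d) s t u 1)) => g.
rewrite kernel_form_power /egen /bil; congr (_ *: (_ *: _)).
by case: pos => //; rewrite !mulr0 !mulr1 addr0 add0r.
Qed.

Lemma eigspan_kernel_family pos d e (A : 'M[C]_(e.+1, d.+1)) :
  eigspan pos (rot_degree pos d) (fun g : SU2 R => kernel_family pos A g).
Proof.
rewrite /kernel_family; move: (e.+1) A => k A.
have h (s : seq 'I_k) : eigspan pos (rot_degree pos d)
    (fun g : SU2 R => \sum_(i <- s) kernel_form pos (row i A) (rowL 1 i%:R g) (rowR 1 i%:R g)).
  elim: s => [|i s IH].
    by apply: (eigspan_eq _ (@eigspan0 R _ _)) => g; rewrite big_nil.
  apply: eigspan_eq (eigspanD (eigspan_kernel_form pos (row i A) 1 i%:R) IH) => g.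
  by rewrite big_cons.
exact: (eigspan_eq _ (h (index_enum _))).
Qed.

(** Interpolation replaces the row [(s, t)] by the rows [(1, i)], so the coefficient matrix has rank
    at most one: weights times a power. The gradient of a power carries the factor [d], which has to
    be inverted. *)
Lemma egen_kernel_family pos d s t x y : pos || (0 < d)%N ->
  exists A : 'M[C]_((kernel_degree pos d).+1, d.+1),
    forall g : SU2 R, egen pos (rot_degree pos d) s t x y g = kernel_family pos A g.
Proof.
move=> pd; set e := kernel_degree pos d.
pose z : C := if pos then 1 else d%:R.
have z0 : z != 0 by move: pd; rewrite /z; case: (pos) => [_|pd]; rewrite ?oner_eq0 // pnatr_eq0 -lt0n.
have [om hom] := hpol_interpolation e.
pose c : 'rV[C]_d.+1 := z^-1 *: power_form d x y.
exists (\matrix_(i, j) (om s t i * c 0 j)) => g.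
have -> : egen pos (rot_degree pos d) s t x y g = kernel_form pos c (rowL s t g) (rowR s t g).
  rewrite /c kernel_formZ kernel_form_power -/z scalerA mulVf // scale1r /egen /bil.
  by congr (_ *: _); case: (pos) => //; rewrite !mulr0 !mulr1 addr0 add0r.
have rw (i : 'I_e.+1) : row i (\matrix_(i, j) (om s t i * c 0 j)) = om s t i *: c.
  by apply/rowP => j; rewrite !mxE.
have H j : kernel_form pos c (rowL s t g) (rowR s t g) j 0 =
    kernel_family pos (\matrix_(i < e.+1, j < d.+1) (om s t i * c 0 j)) g j 0.
  rewrite (hom _ (kernel_hpol pos c g j)) /kernel_family summxE; apply: eq_bigr => i _.
  by rewrite rw kernel_formZ mxE.
by apply: col2P.
Qed.

Lemma eigspanP pos d (psi : SU2 R -> 'cV[C]_2) : pos || (0 < d)%N ->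
  eigspan pos (rot_degree pos d) psi ->
  exists A : 'M[C]_((kernel_degree pos d).+1, d.+1), forall g, psi g = kernel_family pos A g.
Proof.
move=> pd; elim => [|s t x y|f1 f2 _ [A hA] _ [B hB]|a f _ [A hA]].
- exists 0 => g; have := kernel_familyZ pos 0 (0 : 'M[C]_((kernel_degree pos d).+1, d.+1)) g.
  by rewrite !scale0r.
- exact: egen_kernel_family.
- by exists (A + B) => g; rewrite kernel_familyD hA hB.
- by exists (a *: A) => g; rewrite kernel_familyZ hA.
Qed.

Definition polyfn (f : C -> C) : Prop := exists p : {poly C}, forall u, f u = p.[u].

Lemma polyfn_eq f h : f =1 h -> polyfn f -> polyfn h.
Proof. by move=> e [p hp]; exists p => u; rewrite -e. Qed.

Lemma polyfn_cst a : polyfn (fun=> a).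
Proof. by exists a%:P => u; rewrite hornerC. Qed.

Lemma polyfn_id : polyfn id.
Proof. by exists 'X => u; rewrite hornerX. Qed.

Lemma polyfnD f h : polyfn f -> polyfn h -> polyfn (fun u => f u + h u).
Proof. by move=> [p hp] [q hq]; exists (p + q) => u; rewrite hornerD hp hq. Qed.

Lemma polyfnM f h : polyfn f -> polyfn h -> polyfn (fun u => f u * h u).
Proof. by move=> [p hp] [q hq]; exists (p * q) => u; rewrite hornerM hp hq. Qed.

Lemma polyfnX f n : polyfn f -> polyfn (fun u => f u ^+ n).
Proof. by move=> [p hp]; exists (p ^+ n) => u; rewrite horner_exp hp. Qed.

Lemma polyfn_eq0 f : polyfn f -> (forall n : nat, f n.+1%:R = 0) -> forall u, f u = 0.
Proof.
move=> [p hp] h u; suff p0 : p = 0 by rewrite hp p0 horner0.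
apply/eqP/negPn/negP => p0.
have := max_poly_roots p0 (rs := [seq (n.+1%:R : C) | n <- iota 0 (size p)]).
rewrite size_map size_iota ltnn map_inj_uniq ?iota_uniq; last first.
  by move=> i j /eqP; rewrite eqr_nat eqSS => /eqP.
suff -> : all (root p) [seq (n.+1%:R : C) | n <- iota 0 (size p)] by move=> /(_ isT isT).
by apply/allP => _ /mapP[n _ ->]; rewrite /root -hp h.
Qed.

(** The complexification of [quat]. It reaches every matrix, while real arguments, not all zero,
    give the positive multiples of SU(2). *)
Definition quatC (z0 z1 z2 z3 : C) : 'M[C]_2 :=
  mx2 (z0 + 'i%C * z1) (z2 + 'i%C * z3) (- z2 + 'i%C * z3) (z0 - 'i%C * z1).

Lemma quatC_surj M : exists z0 z1 z2 z3, M = quatC z0 z1 z2 z3.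
Proof.
have i2 := @ImI2 R; have i0 := @ImI_neq0 R.
exists ((M 0 0 + M 1 1) / 2), (- 'i%C * (M 0 0 - M 1 1) / 2), ((M 0 1 - M 1 0) / 2),
  (- 'i%C * (M 0 1 + M 1 0) / 2).
apply: matrix2P; rewrite mx2E.
- transitivity (((M 0 0 + M 1 1) - 'i%C * 'i%C * (M 0 0 - M 1 1)) / 2); last by ring.
  by rewrite i2; field.
- transitivity (((M 0 1 - M 1 0) - 'i%C * 'i%C * (M 0 1 + M 1 0)) / 2); last by ring.
  by rewrite i2; field.
- transitivity ((- (M 0 1 - M 1 0) - 'i%C * 'i%C * (M 0 1 + M 1 0)) / 2); last by ring.
  by rewrite i2; field.
- transitivity (((M 0 0 + M 1 1) + 'i%C * 'i%C * (M 0 0 - M 1 1)) / 2); last by ring.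
  by rewrite i2; field.
Qed.

Lemma polyfn_kernel_form pos d (c : 'rV[C]_d.+1) p q j : polyfn p -> polyfn q ->
  polyfn (fun u => kernel_form pos c (p u) (q u) j 0).
Proof.
move=> hp hq; move: c; apply: power_form_span => [|c c' h h'|a c h|v].
- by apply: polyfn_eq (polyfn_cst 0) => u; rewrite kernel_form0 mxE.
- by apply: polyfn_eq (polyfnD h h') => u; rewrite kernel_formD mxE.
- by apply: polyfn_eq (polyfnM (polyfn_cst a) h) => u; rewrite kernel_formZ mxE.
have hG := polyfnX (rot_degree pos d) (polyfnD (polyfnM hp (polyfn_cst v)) (polyfnM hq (polyfn_cst 1))).
have h0 : polyfn (fun u => (if pos then col2 (q u) (- p u) else col2 v 1) j 0).
  case: (pos); move: j; apply: ord2P.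
  - by apply: polyfn_eq hq => u; rewrite col2_0.
  - by apply: polyfn_eq (polyfnM (polyfn_cst (-1)) hp) => u; rewrite col2_1 mulN1r.
  - by apply: polyfn_eq (polyfn_cst v) => u; rewrite col2_0.
  - by apply: polyfn_eq (polyfn_cst 1) => u; rewrite col2_1.
apply: polyfn_eq (polyfnM (polyfn_cst (if pos then 1 else d%:R)) (polyfnM hG h0)) => u.
by rewrite kernel_form_power !colZE; case: (pos).
Qed.

Lemma polyfn_sum n (f : nat -> C -> C) : (forall i, polyfn (f i)) ->
  polyfn (fun u => \sum_(i < n) f i u).
Proof.
move=> h; elim: n => [|n IH].
  by apply: polyfn_eq (polyfn_cst 0) => u; rewrite big_ord0.
by apply: polyfn_eq (polyfnD IH (h n)) => u; rewrite big_ord_recr.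
Qed.

Lemma polyfn_kernel_family pos d e (A : 'M[C]_(e.+1, d.+1)) (m : C -> 'M[C]_2) j :
  (forall a b : 'I_2, polyfn (fun u => m u a b)) -> polyfn (fun u => kernel_family pos A (m u) j 0).
Proof.
move=> h.
have hL s t (b : 'I_2) : polyfn (fun u => s * m u 0 b + t * m u 1 b).
  by apply: polyfnD; apply: polyfnM (polyfn_cst _) _; exact: h.
have := polyfn_sum e.+1 (fun i => polyfn_kernel_form pos (row (inord i) A) j
  (hL 1 i%:R 0) (hL 1 i%:R 1)).
apply: polyfn_eq => u; rewrite /kernel_family summxE; apply: eq_bigr => i _.
by rewrite inord_val.
Qed.

Lemma polyfn_quatC (z0 z1 z2 z3 : C) (a b : 'I_2) :
  [/\ polyfn (fun u => quatC u z1 z2 z3 a b), polyfn (fun u => quatC z0 u z2 z3 a b),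
      polyfn (fun u => quatC z0 z1 u z3 a b) & polyfn (fun u => quatC z0 z1 z2 u a b)].
Proof.
have P v w : polyfn (fun u => v * u + w).
  by apply: polyfnD (polyfn_cst _); apply: polyfnM (polyfn_cst _) polyfn_id.
move: a b; apply: ord2P; apply: ord2P; split.
- by apply: polyfn_eq (P (1) ('i%C * z1)) => u; rewrite mx2E; ring.
- by apply: polyfn_eq (P ('i%C) (z0)) => u; rewrite mx2E; ring.
- by apply: polyfn_eq (P (0) (z0 + 'i%C * z1)) => u; rewrite mx2E; ring.
- by apply: polyfn_eq (P (0) (z0 + 'i%C * z1)) => u; rewrite mx2E; ring.
- by apply: polyfn_eq (P (0) (z2 + 'i%C * z3)) => u; rewrite mx2E; ring.
- by apply: polyfn_eq (P (0) (z2 + 'i%C * z3)) => u; rewrite mx2E; ring.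
- by apply: polyfn_eq (P (1) ('i%C * z3)) => u; rewrite mx2E; ring.
- by apply: polyfn_eq (P ('i%C) (z2)) => u; rewrite mx2E; ring.
- by apply: polyfn_eq (P (0) (- z2 + 'i%C * z3)) => u; rewrite mx2E; ring.
- by apply: polyfn_eq (P (0) (- z2 + 'i%C * z3)) => u; rewrite mx2E; ring.
- by apply: polyfn_eq (P (-1) ('i%C * z3)) => u; rewrite mx2E; ring.
- by apply: polyfn_eq (P ('i%C) (- z2)) => u; rewrite mx2E; ring.
- by apply: polyfn_eq (P (1) (- 'i%C * z1)) => u; rewrite mx2E; ring.
- by apply: polyfn_eq (P (- 'i%C) (z0)) => u; rewrite mx2E; ring.
- by apply: polyfn_eq (P (0) (z0 - 'i%C * z1)) => u; rewrite mx2E; ring.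
- by apply: polyfn_eq (P (0) (z0 - 'i%C * z1)) => u; rewrite mx2E; ring.
Qed.

(** A univariate polynomial that vanishes at all positive integers is 0; this is applied to one
    variable after another. *)
Lemma natr_surj_eq0 (f : C -> C -> C -> C -> C) :
  (forall z1 z2 z3, polyfn (fun u => f u z1 z2 z3)) -> (forall z0 z2 z3, polyfn (fun u => f z0 u z2 z3)) ->
  (forall z0 z1 z3, polyfn (fun u => f z0 z1 u z3)) -> (forall z0 z1 z2, polyfn (f z0 z1 z2)) ->
  (forall n0 n1 n2 n3 : nat, f n0.+1%:R n1.+1%:R n2.+1%:R n3.+1%:R = 0) ->
  forall z0 z1 z2 z3, f z0 z1 z2 z3 = 0.
Proof.
move=> h0 h1 h2 h3 h z0 z1 z2 z3.
apply: (polyfn_eq0 (h3 z0 z1 z2)) => n3; apply: (polyfn_eq0 (h2 z0 z1 _)) => n2.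
by apply: (polyfn_eq0 (h1 z0 _ _)) => n1; apply: (polyfn_eq0 (h0 _ _ _)) => n0.
Qed.

Lemma natr_quatC (n0 n1 n2 n3 : nat) : quatC n0%:R n1%:R n2%:R n3%:R =
  quat (row4 n0%:R n1%:R n2%:R n3%:R).
Proof.
rewrite quat_row4; have E n : (n%:R : C) = (n%:R : R)%:C by rewrite rmorph_nat.
by rewrite /quatC !E; apply: matrix2P; rewrite !mx2E; apply: complex_ext => /=; ring.
Qed.

Lemma quat_scale (a : R) (x : 'rV[R]_4) : quat (a *: x) = a%:C *: quat x.
Proof.
by rewrite /quat !scalerDr !scalerA !mxE !rmorphM.
Qed.

Lemma kernel_family_scale pos d (A : 'M[C]_((kernel_degree pos d).+1, d.+1)) a M :
  kernel_family pos A (a *: M) = a ^+ kernel_degree pos d *: kernel_family pos A M.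
Proof.
rewrite /kernel_family scaler_sumr; apply: eq_bigr => i _.
rewrite -kernel_form_homogeneous /rowL /rowR !mxE; congr kernel_form; ring.
Qed.

(* By homogeneity the polynomial vanishes on the positive multiples of SU(2), and
   then on M_2(C), one complex variable at a time. *)
Lemma kernel_family_vanish pos d (A : 'M[C]_((kernel_degree pos d).+1, d.+1)) :
  (forall g : SU2 R, kernel_family pos A g = 0) -> forall M, kernel_family pos A M = 0.
Proof.
move=> h M; have [z0 [z1 [z2 [z3 ->]]]] := quatC_surj M.
have H j : kernel_family pos A (quatC z0 z1 z2 z3) j 0 = 0.
  apply: (natr_surj_eq0 (f := fun z0 z1 z2 z3 => kernel_family pos A (quatC z0 z1 z2 z3) j 0))
    => [w1 w2 w3|w0 w2 w3|w0 w1 w3|w0 w1 w2|n0 n1 n2 n3].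
  - by apply: polyfn_kernel_family => a b; have [] := polyfn_quatC 0 w1 w2 w3 a b.
  - by apply: polyfn_kernel_family => a b; have [] := polyfn_quatC w0 0 w2 w3 a b.
  - by apply: polyfn_kernel_family => a b; have [] := polyfn_quatC w0 w1 0 w3 a b.
  - by apply: polyfn_kernel_family => a b; have [] := polyfn_quatC w0 w1 w2 0 a b.
  rewrite natr_quatC; set x := row4 _ _ _ _.
  have sx : 0 < sqn x.
    have p (n : nat) : 0 <= (n.+1%:R : R) ^+ 2 by exact: sqr_ge0.
    have q : 0 < (n0.+1%:R : R) ^+ 2 by rewrite exprn_gt0.
    by rewrite /sqn !mxE !inordK //= -!addrA; apply: ltr_wpDr q _; rewrite !addr_ge0.
  pose r := Num.sqrt (sqn x); have r0 : 0 < r by rewrite sqrtr_gt0.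
  have n1' : sqn (r^-1 *: x) = 1.
    by rewrite sqnZ exprVn sqr_sqrtr ?ltW // mulVf // gt_eqF.
  have -> : x = r *: (r^-1 *: x) by rewrite scalerA mulfV ?scale1r // gt_eqF.
  by rewrite quat_scale kernel_family_scale -(ptE n1') h scaler0 mxE.
by apply: col2P; rewrite H mxE.
Qed.

Lemma power_sums_eq0 e (a : nat -> C) : (forall k, (k <= e)%N -> \sum_(i < e.+1) i%:R ^+ k * a i = 0) ->
  forall i, (i <= e)%N -> a i = 0.
Proof.
move=> h i ie; have [w hw] := @vandermonde_weights R e.
pose W : 'M[C]_e.+1 := \matrix_(k, j) w k j; pose V : 'M[C]_e.+1 := \matrix_(j, l) (j%:R ^+ l).
have WV : W *m V = 1%:M.
  apply/matrixP => k l; rewrite !mxE -[RHS]/((k == l)%:R) eq_sym -val_eqE.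
  have [kl ll] : (k <= e)%N /\ (l <= e)%N by split; rewrite -ltnS ltn_ord.
  rewrite -(hw _ _ kl ll); by apply: eq_bigr => j _; rewrite !mxE.
have VW := mulmx1C WV.
have a0 : (\row_j a j) *m V = 0 :> 'rV[C]_e.+1.
  apply/rowP => k; rewrite !mxE -[RHS](h k); last by rewrite -ltnS.
  by apply: eq_bigr => j _; rewrite !mxE mulrC.
have : (\row_j a j) *m V *m W = 0 :> 'rV[C]_e.+1 by rewrite a0 mul0mx.
rewrite -mulmxA VW mulmx1 => /rowP/(_ (inord i)).
by rewrite !mxE inordK.
Qed.

(** The coefficient of [u ^+ k] is a nonzero binomial times the weighted power sum of exponent [k],
    and all these sums vanish only for [a = 0] because the Vandermonde matrix is invertible. *)
Lemma linear_powers_eq0 e (a : nat -> C) :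
  (forall u : C, \sum_(i < e.+1) (1 + i%:R * u) ^+ e * a i = 0) -> forall i, (i <= e)%N -> a i = 0.
Proof.
move=> h; apply: power_sums_eq0 => k ke.
pose f (k : nat) (_ : unit) : C^o := 'C(e, k)%:R * \sum_(i < e.+1) i%:R ^+ k * a i.
have fk : f k tt = 0.
  apply: (@vandermonde_components R C^o unit (fun h => h tt = 0) e f) ke => //.
  - by move=> h1 h2 -> ->; rewrite addr0.
  - by move=> c h1 ->; rewrite scaler0.
  move=> u; rewrite -[RHS](h u) /f.
  under [RHS]eq_bigr do rewrite exprDn mulr_suml.
  rewrite [RHS]exchange_big /=; apply: eq_bigr => l _.
  rewrite -[LHS]/(u ^+ l * ('C(e, l)%:R * \sum_(i < e.+1) i%:R ^+ l * a i)) !mulr_sumr.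
  by apply: eq_bigr => i _; rewrite expr1n exprMn mul1r -[_ *+ 'C(e, l)]mulr_natl; ring.
move/eqP: fk; rewrite /f mulf_eq0 pnatr_eq0 -leqn0 leqNgt bin_gt0 ke /=.
by move/eqP.
Qed.

(** Euler's identity for homogeneous functions; it recovers a form of positive degree from its
    gradient. *)
Lemma kernel_form_euler pos d (c : 'rV[C]_d.+1) x y : ~~ pos ->
  x * kernel_form pos c x y 0 0 + y * kernel_form pos c x y 1 0 = d%:R * binary_form c x y.
Proof.
case: pos => // _; move: c; apply: power_form_span => [|c c' h h'|a c h|u].
- have := binary_formZ 0 (0 : 'rV[C]_d.+1) x y; rewrite scale0r mul0r => ->.
  by rewrite kernel_form0 !mxE !mulr0 addr0.
- by rewrite kernel_formD binary_formD !colDE [RHS]mulrDr -h -h'; ring.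
- by rewrite kernel_formZ binary_formZ !colZE [RHS]mulrCA -h; ring.
rewrite kernel_form_power binary_form_power !colZE col2_0 col2_1 /rot_degree.
by case: d => [|d] /=; rewrite ?exprS; ring.
Qed.

Lemma kernel_form_eq0 pos d (c : 'rV[C]_d.+1) : pos || (0 < d)%N ->
  (forall x y, kernel_form pos c x y = 0) -> c = 0.
Proof.
move=> pd h; apply: binary_form_inj1 => x.
have -> : binary_form (0 : 'rV[C]_d.+1) x 1 = 0.
  by have := binary_formZ 0 (0 : 'rV[C]_d.+1) x 1; rewrite scale0r mul0r.
case: pos pd h => [_|/= d0] h.
  by have := congr1 (fun m : 'cV[C]_2 => m 0 0) (h x 1); rewrite kernel_form_pos colZE col2_0 mxE mulr1.
have := kernel_form_euler c x 1 (isT : ~~ false); rewrite h !mxE !mulr0 addr0 => /eqP.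
by rewrite eq_sym mulf_eq0 pnatr_eq0 -leqn0 leqNgt d0 => /eqP.
Qed.

(* At the matrix of rank one with rows (x, y) and u (x, y), the i-th summand is
   multiplied by (1 + i u)^e. *)
Lemma kernel_family_eq0 pos d (A : 'M[C]_((kernel_degree pos d).+1, d.+1)) : pos || (0 < d)%N ->
  (forall g : SU2 R, kernel_family pos A g = 0) -> A = 0.
Proof.
move=> pd /kernel_family_vanish h; apply/row_matrixP => i; rewrite row0.
apply: (kernel_form_eq0 pd) => x y.
have H j : kernel_form pos (row i A) x y j 0 = 0.
  pose a k := kernel_form pos (row (inord k) A) x y j 0.
  rewrite -(inord_val i) -/(a i).
  apply: (@linear_powers_eq0 (kernel_degree pos d) a) => [u|]; last by rewrite -ltnS.
  have := congr1 (fun m : 'cV[C]_2 => m j 0) (h (mx2 x y (u * x) (u * y))).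
  rewrite [in X in _ = X -> _]mxE => e; rewrite -[RHS]e /kernel_family summxE; apply: eq_bigr => k _.
  have -> : rowL 1 k%:R (mx2 x y (u * x) (u * y)) = (1 + k%:R * u) * x by rewrite /rowL !mx2E; ring.
  have -> : rowR 1 k%:R (mx2 x y (u * x) (u * y)) = (1 + k%:R * u) * y by rewrite /rowR !mx2E; ring.
  by rewrite kernel_form_homogeneous colZE /a inord_val.
by apply: col2P; rewrite H mxE.
Qed.

End KernelFamilies.

(** * Eigenspaces on the quotient *)

Section Eigenfunctions.
Variable R : realType.
Local Notation C := R[i].
Implicit Types (psi phi : SU2 R -> 'cV[C]_2) (g : SU2 R) (b : nat -> SU2 R -> 'cV[C]_2).

Definition lincomb N (c : nat -> C) b : SU2 R -> 'cV[C]_2 := bigspin N (fun k g => c k *: b k g).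

Lemma scont_lincomb N c b : (forall k, scont (b k)) -> scont (lincomb N c b).
Proof. by move=> h; apply: bigspin_scont => k; exact: scontZ. Qed.

Lemma scontB psi phi : scont psi -> scont phi -> scont (fun g => psi g - phi g).
Proof.
move=> h k; have := scontD h (scontZ (-1) k).
by congr (scont _); apply/funext => g; rewrite scaleN1r.
Qed.

Lemma ipB psi1 psi2 phi : scont psi1 -> scont psi2 -> scont phi ->
  ip (fun g => psi1 g - psi2 g) phi = ip psi1 phi - ip psi2 phi.
Proof.
move=> h k hp; have := ipD h (scontZ (-1) k) hp; rewrite (ipZ _ k hp) mulN1r => <-.
by congr (ip _ phi); apply/funext => g; rewrite scaleN1r.
Qed.

Lemma ip_lincombr N c b psi : (forall k, scont (b k)) -> scont psi ->
  (forall k, (k < N)%N -> ip psi (b k) = 0) -> ip psi (lincomb N c b) = 0.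
Proof.
move=> hb h h0; rewrite (bigspin_ipr N (fun k => scontZ (c k) (hb k)) h) big1 // => k _.
by rewrite (ipZr _ h (hb k)) h0 ?mulr0.
Qed.

(** Gram-Schmidt by induction on [N], for a family that may be linearly dependent. *)
Lemma orthogonal_projection N b : (forall k, scont (b k)) -> forall psi, scont psi ->
  exists c, forall k, (k < N)%N -> ip (fun g => psi g - lincomb N c b g) (b k) = 0.
Proof.
move=> hb; elim: N => [|N IH] psi h; first by exists (fun=> 0).
have [c1 h1] := IH psi h; have [c2 h2] := IH (b N) (hb N).
pose p g := psi g - lincomb N c1 b g; pose q g := b N g - lincomb N c2 b g.
have sp : scont p := scontB h (scont_lincomb N c1 hb).
have sq : scont q := scontB (hb N) (scont_lincomb N c2 hb).
pose t := ip p q / ip q q.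
(* If [b N] depends on the earlier members, then [q = 0] and both terms vanish whatever [t] is. *)
have tq : ip p q - t * ip q q = 0.
  rewrite /t; have [q0|q0] := eqVneq (ip q q) 0; last by rewrite divfK // subrr.
  rewrite q0 mulr0 subr0; have qz : q = fun=> 0.
    apply/funext => g; apply: (L2norm2_eq0 sq).
    by move: q0; rewrite ip_L2norm2 => /(congr1 (@complex.Re R)).
  by rewrite qz (ipC (@scont_0 R) sp) ip0l //; apply: complex_ext; rewrite /= ?oppr0.
exists (fun k => if k == N then t else c1 k - t * c2 k).
have -> : (fun g => psi g - lincomb N.+1 (fun k => if k == N then t else c1 k - t * c2 k) b g) =
    (fun g => p g - t *: q g).
  apply/funext => g; rewrite /lincomb bigspinS eqxx /p /q /lincomb.
  have -> : bigspin N (fun k g => (if k == N then t else c1 k - t * c2 k) *: b k g) g =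
      bigspin N (fun k g => c1 k *: b k g) g - t *: bigspin N (fun k g => c2 k *: b k g) g.
    rewrite /bigspin scaler_sumr -sumrB; apply: eq_bigr => k _.
    by rewrite ltn_eqF // scalerBl scalerA.
  rewrite scalerBr !opprD !opprK !addrA.
  by rewrite [LHS]addrAC.
have P k : (k < N)%N -> ip (fun g => p g - t *: q g) (b k) = 0.
  move=> kN; have e1 : ip p (b k) = 0 by exact: h1.
  have e2 : ip q (b k) = 0 by exact: h2.
  by rewrite (ipB sp (scontZ t sq) (hb k)) (ipZ t sq (hb k)) e1 e2 mulr0 subr0.
move=> k; rewrite ltnS leq_eqVlt => /orP[/eqP ->|]; last exact: P.
have st := scontB sp (scontZ t sq).
have bN : b N = (fun g => q g + lincomb N c2 b g) by apply/funext => g; rewrite /q subrK.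
rewrite [X in ip _ X]bN (ipDr st sq (scont_lincomb N c2 hb)) (ip_lincombr c2 hb st P) addr0.
by rewrite (ipB sp (scontZ t sq) sq) (ipZ t sq sq).
Qed.

Lemma orthogonal_spinpoly_eq0 psi : scont psi -> (forall phi, spinpoly phi -> ip psi phi = 0) ->
  forall g, psi g = 0.
Proof.
move=> h h0; apply: (L2norm2_eq0 h); apply/eqP; rewrite eq_le (L2norm2_ge0 h) andbT.
apply/ler_addgt0Pr => e e_gt0; rewrite add0r.
have v0 := @su2_volume_gt0 R.
pose d : R := Num.sqrt (e / (4 * su2_volume R)).
have d0 : 0 < d by rewrite sqrtr_gt0 divr_gt0 // mulr_gt0.
have hd : 4 * d ^+ 2 * su2_volume R = e.
  rewrite sqr_sqrtr; last by rewrite divr_ge0 ?mulr_ge0 // ltW.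
  by field; rewrite gt_eqF.
have [s ss us] := spinor_density h d0.
have [M [e1 [a1 h1]]] := spinpoly_decomposition ss.
have sc : scont s.
  have -> : s = bigspin M e1 by apply/funext => g; exact: h1.
  exact: bigspin_scont (alpha_family_scont a1).
have Z := uclose_L2 (ltW d0) h sc us; have Z2 := L2norm2_sub 1 h sc.
have S0 := L2norm2_ge0 sc.
have Z3 : L2norm2 psi + L2norm2 s <= e.
  move: Z2; rewrite (h0 s ss) mulr0 subr0 expr1n mul1r -hd => <-; apply: le_trans Z.
  by rewrite le_eqVlt; apply/orP; left; apply/eqP; congr L2norm2; apply/funext => g; rewrite scale1r.
by apply: le_trans Z3; rewrite lerDl.
Qed.

Lemma spinpoly_scont phi : spinpoly phi -> scont phi.
Proof. by elim => [pos n f /eigspan_scont|f1 f2 _ h1 _ h2] //; exact: scontD. Qed.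

(** Subtract the orthogonal projection to the span. The remainder is still an eigenspinor,
    orthogonal to this span by construction and to the other eigenspaces by symmetry of D, hence to
    all of [spinpoly], and density makes it 0. *)
Lemma eigenfunction_eigspan pos n N b psi : (forall k, eigspan pos n (b k)) ->
  (forall phi, eigspan pos n phi -> exists c, phi = lincomb N c b) ->
  sC1 psi -> (forall g, dirac psi g = (eigval R pos n)%:C *: psi g) -> eigspan pos n psi.
Proof.
move=> hb hspan h hd; have hs := sC1_scont h.
have [c hc] := orthogonal_projection N (fun k => eigspan_scont (hb k)) hs.
have es : eigspan pos n (lincomb N c b).
  elim: (N) => [|m IH]; rewrite /lincomb; first by rewrite bigspin0; exact: eigspan0.
  by rewrite bigspinS; apply: eigspanD => //; exact: eigspanZ.
pose p g := psi g - lincomb N c b g.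
have pE : p = (fun g => psi g + (-1) *: lincomb N c b g).
  by apply/funext => g; rewrite /p scaleN1r.
have e1 := eigspanZ (-1) es.
have p1 : sC1 p by rewrite pE; apply: sC1D h _; exact: eigspan_sC1 e1.
have sp := sC1_scont p1.
have pd g : dirac p g = (eigval R pos n)%:C *: p g.
  by rewrite pE (diracD g h (eigspan_sC1 e1)) hd (eigspan_dirac e1) -scalerDr.
have p0 : forall g, p g = 0.
  apply: (orthogonal_spinpoly_eq0 sp) => phi.
  elim => [pos' n' f hf|f1 f2 s1 i1 s2 i2].
    have [e|ne] := eqVneq (pos, n) (pos', n'); last first.
      exact: (ip_eigenfunction p1 (eigspan_sC1 hf) pd (eigspan_dirac hf) (eigval_neq R ne)).
    case: e hf => <- <- /hspan[c' ->].
    exact: (ip_lincombr c' (fun k => eigspan_scont (hb k)) sp hc).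
  by rewrite (ipDr sp (spinpoly_scont s1) (spinpoly_scont s2)) i1 i2 addr0.
by apply: eigspan_eq es => g; apply/eqP; rewrite eq_sym -subr_eq0 -[X in X == _]/(p g) p0.
Qed.

End Eigenfunctions.

(** * Multiplicities as ranks of the invariant projectors *)

Section Multiplicity.
Variables (R : realType) (L : seq (SU2 R)) (Gamma : set (SU2 R)).
Hypothesis LG : enumerates L Gamma.
Local Notation C := R[i].
Implicit Types (psi phi : SU2 R -> 'cV[C]_2) (g : SU2 R).

(* The projector onto the Gamma-invariant binary forms of degree d. *)
Definition invariant_projector d : 'M[C]_d.+1 := (size L)%:R^-1 *: \sum_(k <- L) rho d k.
Local Notation P := invariant_projector.

Lemma su2_det1 g : \det (g : 'M[C]_2) = 1.
Proof. by rewrite det2E su2_det. Qed.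

Lemma mul_invariant_projector_rho d g : Gamma g -> P d *m rho d g = P d.
Proof.
have [_ _ Lp] := LG; move=> Gg; rewrite /P -scalemxAl mulmx_suml; congr (_ *: _).
rewrite -[RHS](perm_big _ (Lp g Gg)) /= big_map; apply: eq_bigr => k _.
by rewrite rhoM su2mulE.
Qed.

Lemma invariant_projector_idem d : P d *m P d = P d.
Proof.
have [GL _ _] := LG.
rewrite {2}/P -scalemxAr mulmx_sumr (eq_big_seq (fun=> P d)); last first.
  by move=> k /GL Gk; exact: mul_invariant_projector_rho.
rewrite big_const_seq count_predT -Monoid.iteropE /= -[iterop _ _ _ _]/(P d *+ size L).
by rewrite -(@scaler_nat C _ (size L) (P d)) scalerA mulVf ?scale1r // (size_neq0 LG).
Qed.

(** By [kernel_family_rho] each translation multiplies the coefficient matrix on the right by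
    [rho d k]; the mean of these is the projector. *)
Lemma average_kernel_family pos d e (A : 'M[C]_(e.+1, d.+1)) g :
  average L (fun g : SU2 R => kernel_family pos A g) g = kernel_family pos (A *m P d) g.
Proof.
rewrite /P -scalemxAr kernel_familyZ /average; congr (_ *: _).
rewrite mulmx_sumr.
elim: (L) => [|k s IH]; last first.
  by rewrite !big_cons kernel_familyD -IH -(kernel_family_rho pos A g (su2_det1 k)) su2mulE.
rewrite !big_nil; have := kernel_familyZ pos 0 (0 : 'M[C]_(e.+1, d.+1)) g.
by rewrite !scale0r.
Qed.

Lemma smooth_sC1 psi : (forall j, smooth (fun g => complex.Re (psi g j 0)) /\
  smooth (fun g => complex.Im (psi g j 0))) -> sC1 psi.
Proof. by move=> h j; have [s1 s2] := h j; split; exact: smooth_cont1. Qed.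

(** Families of the matrix units, flattened and continued by 0 beyond the last index, since
    [lincomb] expects a sequence. *)
Definition kernel_basis pos d (k : nat) g : 'cV[C]_2 :=
  if (insub k : option 'I_((kernel_degree pos d).+1 * d.+1)) is Some i
  then kernel_family pos (vec_mx (delta_mx 0 i) : 'M[C]_((kernel_degree pos d).+1, d.+1)) g else 0.

Lemma kernel_family_lincomb pos d (A : 'M[C]_((kernel_degree pos d).+1, d.+1)) :
  exists c, (fun g : SU2 R => kernel_family pos A g) =
  lincomb ((kernel_degree pos d).+1 * d.+1) c (kernel_basis pos d).
Proof.
exists (fun k => if (insub k : option 'I_((kernel_degree pos d).+1 * d.+1)) is Some i
  then mxvec A 0 i else 0).
apply/funext => g; rewrite -{1}(mxvecK A) {1}(row_sum_delta (mxvec A)) linear_sum /lincomb /bigspin.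
transitivity (\sum_i mxvec A 0 i *:
    kernel_family pos (vec_mx (delta_mx 0 i) : 'M[C]_((kernel_degree pos d).+1, d.+1)) g).
  elim: (index_enum _) => [|i s IH].
    rewrite !big_nil; have := kernel_familyZ pos 0 (0 : 'M[C]_((kernel_degree pos d).+1, d.+1)) g.
    by rewrite !scale0r.
  by rewrite !big_cons kernel_familyD IH linearZ kernel_familyZ.
by apply: eq_bigr => i _; rewrite /kernel_basis valK.
Qed.

(** Equivariance allows [A] to be replaced by [A *m P d]; factoring the projector through [row_base]
    leaves a matrix with only [\rank (P d)] columns. *)
Lemma eigenspace_kernel_family pos d psi : pos || (0 < d)%N ->
  dirac_eigenspace Gamma (eigval R pos (rot_degree pos d))%:C psi ->
  exists B : 'M[C]_((kernel_degree pos d).+1, \rank (P d)),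
    psi = (fun g => kernel_family pos (B *m row_base (P d)) g).
Proof.
move=> pd [[eq sm] hd].
have h := smooth_sC1 sm.
have hd' g : dirac psi g = (eigval R pos (rot_degree pos d))%:C *: psi g by rewrite hd.
have es : eigspan pos (rot_degree pos d) psi.
  apply: (eigenfunction_eigspan (N := ((kernel_degree pos d).+1 * d.+1)%N) (b := kernel_basis pos d)) h hd'.
    move=> k; rewrite /kernel_basis; case: insubP => [i _ _|_]; first exact: eigspan_kernel_family.
    exact: eigspan0.
  move=> phi /(eigspanP pd)[A hA]; have [c hc] := kernel_family_lincomb A.
  by exists c; rewrite -hc; apply/funext.
have [A hA] := eigspanP pd es.
have hP g : psi g = kernel_family pos (A *m P d) g.
  rewrite -(average_id LG eq g) -average_kernel_family; congr (average L _ g).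
  exact/funext.
exists (A *m col_base (P d)); apply/funext => g; by rewrite -mulmxA mulmx_base.
Qed.

Lemma kernel_family_eigenspace pos d (B : 'M[C]_((kernel_degree pos d).+1, \rank (P d))) :
  dirac_eigenspace Gamma (eigval R pos (rot_degree pos d))%:C
    (fun g => kernel_family pos (B *m row_base (P d)) g).
Proof.
have es := eigspan_kernel_family pos (B *m row_base (P d)).
split; last by apply/funext => g; exact: eigspan_dirac es g.
split; last exact: eigspan_smooth es.
move=> g k Gk /=.
have rP : row_base (P d) *m P d = row_base (P d).
  have /submxP[X ->] : (row_base (P d) <= P d)%MS by rewrite eq_row_base.
  by rewrite -mulmxA invariant_projector_idem.
have e : B *m row_base (P d) *m rho d k = B *m row_base (P d).
  by rewrite -[X in B *m X]rP -!mulmxA mul_invariant_projector_rho // rP.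
by rewrite -{2}e -(kernel_family_rho pos _ g (su2_det1 k)) [RHS]mulmxA mulVmx ?su2_unit // mul1mx.
Qed.

Lemma sum_enum_delta (a b : nat) (c : 'I_#|{: 'I_a * 'I_b}| -> C) :
  \sum_i c i *: (delta_mx (enum_val i).1 (enum_val i).2 : 'M[C]_(a, b)) =
  \matrix_(x, y) c (enum_rank (x, y)).
Proof.
rewrite [RHS]matrix_sum_delta pair_big /=.
rewrite (reindex (@enum_val _ (mem {: 'I_a * 'I_b}))) /=; last first.
  by apply: onW_bij; exact: enum_val_bij.
apply: eq_bigr => i _; rewrite mxE; congr (c _ *: _).
by rewrite -surjective_pairing enum_valK.
Qed.

Lemma dirac_multiplicity_rank pos d : pos || (0 < d)%N ->
  dirac_multiplicity Gamma (eigval R pos (rot_degree pos d))%:C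
    ((kernel_degree pos d).+1 * \rank (P d)).
Proof.
move=> pd; set e := kernel_degree pos d; set r := \rank (P d).
have -> : (e.+1 * r)%N = #|{: 'I_e.+1 * 'I_r}| by rewrite card_prod !card_ord.
pose E (i : 'I_#|{: 'I_e.+1 * 'I_r}|) : SU2 R -> 'cV[C]_2 := fun g =>
  kernel_family pos (delta_mx (enum_val i).1 (enum_val i).2 *m row_base (P d)) g.
have sumE (c : 'I_#|{: 'I_e.+1 * 'I_r}| -> C) : \sum_i c i *: E i =
    (fun g => kernel_family pos ((\matrix_(x, y) c (enum_rank (x, y))) *m row_base (P d)) g).
  rewrite fct_sumE; apply/funext => g; rewrite -sum_enum_delta mulmx_suml.
  elim: (index_enum _) => [|i s IH].
    rewrite !big_nil; have := kernel_familyZ pos 0 (0 : 'M[C]_(e.+1, d.+1)) g.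
    by rewrite !scale0r.
  by rewrite !big_cons kernel_familyD -scalemxAl kernel_familyZ -IH.
exists E; split.
- by move=> i; exact: kernel_family_eigenspace.
- move=> c c0; have z : (\matrix_(x, y) c (enum_rank (x, y))) *m row_base (P d) = 0.
    apply: (kernel_family_eq0 pd) => g.
    by have := congr1 (fun f => f g) c0; rewrite sumE.
  have z2 : \matrix_(x, y) c (enum_rank (x, y)) = 0 :> 'M[C]_(e.+1, r).
    by apply: (row_free_inj (row_base_free (P d))); rewrite z mul0mx.
  move=> i; have := congr1 (fun m : 'M[C]_(e.+1, r) => m (enum_val i).1 (enum_val i).2) z2.
  by rewrite !mxE -surjective_pairing enum_valK.
move=> psi /(eigenspace_kernel_family pd)[B ->].
exists (fun i => B (enum_val i).1 (enum_val i).2); rewrite sumE; apply/funext => g.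
congr (kernel_family pos (_ *m _) g).
by apply/matrixP => x y; rewrite mxE enum_rankK.
Qed.

Lemma rank_invariant_projector d : (\rank (P d))%:R =
  (size L)%:R^-1 * \sum_(k <- L) chebU (\tr (k : 'M[C]_2)) d.
Proof.
rewrite -(mxtrace_idempotent (invariant_projector_idem d)) linearZ /= linear_sum /=.
by congr (_ * _); apply: eq_bigr => k _; rewrite tr_rho // su2_det1.
Qed.

End Multiplicity.

(** * Only eigenvalues on SU(2) can lie in the spectrum *)

Section Spectrum.
Variables (R : realType) (L : seq (SU2 R)) (Gamma : set (SU2 R)).
Hypothesis LG : enumerates L Gamma.
Local Notation C := R[i].
Lemma finite_lower_bound (q : nat -> R) K : (forall k, 0 < q k) ->
  exists c : R, [/\ 0 < c, c <= 1 & forall k, (k < K)%N -> c <= q k].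
Proof.
move=> h; elim: K => [|K [c [c0 c1 hc]]]; first by exists 1.
exists (Num.min c (q K)); rewrite lt_min c0 h ge_min c1; split => // k.
rewrite ltnS leq_eqVlt ge_min => /orP[/eqP ->|/hc ->//]; by rewrite lexx orbT.
Qed.

(** From index [n.*2] on, where [n] exceeds the absolute value of the real part, [alpha k] is at
    distance at least 1 from it; the finitely many earlier terms have a positive lower bound. *)
Lemma spectral_gap (lambda : C) : (forall k, (alpha R k)%:C != lambda) ->
  exists2 c : R, 0 < c &
    forall k, c <= (alpha R k - complex.Re lambda) ^+ 2 + complex.Im lambda ^+ 2.
Proof.
case: lambda => x y /= h; pose q k := (alpha R k - x) ^+ 2 + y ^+ 2.
have q0 k : 0 < q k.
  rewrite lt_neqAle addr_ge0 ?sqr_ge0 // andbT eq_sym paddr_eq0 ?sqr_ge0 // !sqrf_eq0 subr_eq0.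
  apply/negP => /andP[/eqP e /eqP y0]; move/negP: (h k); apply.
  by rewrite e y0; apply/eqP.
have [n hn] : exists n : nat, `|x| < n%:R.
  by exists (Num.truncn `|x|).+1; rewrite truncnS_gt.
have [c [c0 c1 hc]] := finite_lower_bound n.*2 q0; exists c => // k.
have [kn|nk] := ltnP k n.*2; first exact: hc.
apply: le_trans c1 _; rewrite -[leLHS]addr0; apply: lerD (sqr_ge0 y).
have nk2 : n%:R <= (k./2)%:R :> R by rewrite ler_nat -(doubleK n) half_leq.
have xl := ler_norm x; have xr := ler_norm (- x); rewrite normrN in xr.
rewrite /alpha /eigval; case: ifP => _.
  have : 1 <= (k./2)%:R + 3 / 2 - x by lra.
  by move=> z; rewrite -[leLHS](expr1n _ 2) lerXn2r ?nnegrE // ; lra.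
have : 1 <= (k./2)%:R + 3 / 2 + x by lra.
rewrite -opprD sqrrN.
by move=> z; rewrite -[leLHS](expr1n _ 2) lerXn2r ?nnegrE // ; lra.
Qed.

Lemma spinor_field_sC1 psi : spinor_field Gamma psi -> sC1 psi.
Proof. by move=> [_ h]; exact: smooth_sC1. Qed.

Lemma resolvent_of_gap (lambda : C) : (forall k, (alpha R k)%:C != lambda) ->
  dirac_resolvent Gamma lambda.
Proof.
move=> ne; have [c c0 hc] := spectral_gap ne; split.
  exists c => // psi /spinor_field_sC1 h; have := resolvent_bound c0 hc h.
  by rewrite (_ : dirac psi - lambda *: psi = fun g => dirac psi g - lambda *: psi g).
move=> phi hphi e e0.
have [psi h1 h2] := resolvent_dense LG ne (spinor_field_sC1 hphi) hphi.1 e0.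
by exists psi.
Qed.

Lemma alpha_nat k : exists n, alpha R k = 3 / 2 + n%:R \/ alpha R k = - (3 / 2 + n%:R).
Proof.
exists k./2; rewrite /alpha /eigval [3 / 2 + _]addrC; by case: odd; [left|right].
Qed.

Lemma dirac_spectrum_sub (lambda : C) : dirac_spectrum Gamma lambda ->
  exists k : nat, lambda = (3 / 2 + k%:R : R)%:C \/ lambda = - (3 / 2 + k%:R : R)%:C.
Proof.
move=> sp; apply: contrapT => no; apply: sp; apply: resolvent_of_gap => k.
apply/eqP => e; apply: no; have [n h] := alpha_nat k; exists n; rewrite -e.
by case: h => ->; [left|right; rewrite rmorphN].
Qed.

(** An eigenspinor is annihilated by [D - lambda], so the resolvent bound forces its norm to be
    0. *)
Lemma dirac_multiplicity0 (lambda : C) : (forall k, (alpha R k)%:C != lambda) ->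
  dirac_multiplicity Gamma lambda 0.
Proof.
move=> ne; have [c c0 hc] := spectral_gap ne; exists (fun _ _ => 0); split.
- by case.
- by move=> ? _ [].
move=> psi [hpsi hd]; exists (fun=> 0); rewrite big_ord0; apply/funext.
have h := spinor_field_sC1 hpsi; have hs := sC1_scont h.
apply: (L2norm2_eq0 hs); have := resolvent_bound c0 hc h.
have -> : (fun g => dirac psi g - lambda *: psi g) = fun=> 0.
  by apply/funext => g; rewrite hd; apply: subrr.
have -> : L2norm2 (fun _ : SU2 R => 0 : 'cV[C]_2) = 0.
  by apply: (complexI (R := R)); rewrite -ip_L2norm2 (ip0l (@scont_0 R)).
rewrite pmulr_rle0 // => le0; apply/eqP; rewrite eq_le le0 /=; exact: L2norm2_ge0.
Qed.

End Spectrum.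

(** * The binary octahedral group *)

(* The pair (a, b) encodes the number (a + b sqrt 2) / 2, and four such pairs
   the coordinates of a quaternion. *)
Definition half_num := (int * int)%type.
Definition quat_code := (half_num * half_num * half_num * half_num)%type.

Definition num_add (p q : half_num) : half_num := (p.1 + q.1, p.2 + q.2).
Definition num_opp (p : half_num) : half_num := (- p.1, - p.2).
(* Twice the product. *)
Definition num_mul2 (p q : half_num) : half_num :=
  (p.1 * q.1 + 2 * (p.2 * q.2), p.1 * q.2 + p.2 * q.1).
Definition num_half (p : half_num) : half_num := ((p.1 %/ 2)%Z, (p.2 %/ 2)%Z).
Definition num_even (p : half_num) : bool := (2 %| p.1)%Z && (2 %| p.2)%Z.

Definition code_mul2 (p q : quat_code) : quat_code :=
  let: (p0, p1, p2, p3) := p in let: (q0, q1, q2, q3) := q in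
  let m := num_mul2 in let a := num_add in let n := num_opp in
  (a (a (m p0 q0) (n (m p1 q1))) (a (n (m p2 q2)) (n (m p3 q3))),
   a (a (m p0 q1) (m p1 q0)) (a (m p2 q3) (n (m p3 q2))),
   a (a (m p0 q2) (n (m p1 q3))) (a (m p2 q0) (m p3 q1)),
   a (a (m p0 q3) (m p1 q2)) (a (n (m p2 q1)) (m p3 q0))).

Definition code_map (f : half_num -> half_num) (p : quat_code) : quat_code :=
  let: (p0, p1, p2, p3) := p in (f p0, f p1, f p2, f p3).
Definition code_even (p : quat_code) : bool :=
  let: (p0, p1, p2, p3) := p in [&& num_even p0, num_even p1, num_even p2 & num_even p3].
(** Integer division is exact only on even codes, so this is the quaternion product under the
    condition that [octahedral_codes_even] checks for all pairs. *)
Definition code_mul (p q : quat_code) : quat_code := code_map num_half (code_mul2 p q).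

Definition signz (s : bool) : int := if s then -1 else 1.
Definition code_of (f : nat -> half_num) : quat_code := (f 0%N, f 1%N, f 2%N, f 3%N).
Definition unit_code (i : nat) (s : bool) : quat_code :=
  code_of (fun j => if j == i then (2 * signz s, 0) else (0, 0)).
Definition half_code (s0 s1 s2 s3 : bool) : quat_code :=
  ((signz s0, 0), (signz s1, 0), (signz s2, 0), (signz s3, 0)).
Definition pair_code (i j : nat) (s t : bool) : quat_code :=
  code_of (fun k => if k == i then (0, signz s) else if k == j then (0, signz t) else (0, 0)).

Definition bool_pairs : seq (bool * bool) :=
  [:: (false, false); (false, true); (true, false); (true, true)].

(** The three blocks have 8, 16 and 24 members; positions with [i < j] avoid listing an element of
    the third kind twice. *)
Definition octahedral_codes : seq quat_code :=
  [seq unit_code i s | i <- iota 0 4, s <- [:: false; true]] ++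
  [seq half_code u.1 u.2 v.1 v.2 | u <- bool_pairs, v <- bool_pairs] ++
  [seq pair_code u.1 u.2 v.1 v.2 |
     u <- [seq (i, j) | j <- iota 0 4, i <- iota 0 j], v <- bool_pairs].

Lemma octahedral_codes_even :
  all (fun c => all (fun c' => code_even (code_mul2 c c')) octahedral_codes) octahedral_codes.
Proof. by vm_compute. Qed.

Lemma octahedral_codes_perm :
  all (fun c => perm_eq [seq code_mul c c' | c' <- octahedral_codes] octahedral_codes) octahedral_codes.
Proof. by vm_compute. Qed.

(* For the elements other than 1 and -1, the pairs (a, b) such that the trace is a + b sqrt 2. *)
Definition noncentral_traces : seq half_num :=
  nseq 18 (0, 0) ++ nseq 8 (1, 0) ++ nseq 8 (-1, 0) ++ nseq 6 (0, 1) ++ nseq 6 (0, -1).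

Lemma octahedral_codes_traces :
  perm_eq [seq c.1.1.1 | c <- octahedral_codes] ((2, 0) :: (-2, 0) :: noncentral_traces).
Proof. by vm_compute. Qed.

Definition code_sqnorm (c : quat_code) : half_num :=
  let: (p0, p1, p2, p3) := c in let a := num_add in
  a (a (num_mul2 p0 p0) (num_mul2 p1 p1)) (a (num_mul2 p2 p2) (num_mul2 p3 p3)).

(** Squares are doubled by [num_mul2] and [(4, 0)] encodes 2, so the norm is 1. *)
Lemma octahedral_codes_norm : all (fun c => code_sqnorm c == (4, 0)) octahedral_codes.
Proof. by vm_compute. Qed.

Lemma unit_code_in i s : (i < 4)%N -> unit_code i s \in octahedral_codes.
Proof. by case: i => [|[|[|[|]]]] //; case: s. Qed.

Lemma half_code_in s0 s1 s2 s3 : half_code s0 s1 s2 s3 \in octahedral_codes.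
Proof. by case: s0; case: s1; case: s2; case: s3. Qed.

Lemma pair_code_in i j s t : (i < 4)%N -> (j < 4)%N -> i != j ->
  pair_code i j s t \in octahedral_codes.
Proof.
by case: i => [|[|[|[|]]]] //; case: j => [|[|[|[|]]]] //; case: s; case: t.
Qed.

Lemma octahedral_codesP (c : quat_code) : c \in octahedral_codes ->
  [\/ exists i s, (i < 4)%N /\ c = unit_code i s,
      exists s0 s1 s2 s3, c = half_code s0 s1 s2 s3
    | exists i j s t, [/\ (i < 4)%N, (j < 4)%N, i != j & c = pair_code i j s t]].
Proof.
rewrite /octahedral_codes mem_cat [X in _ || X]mem_cat => /or3P[/allpairsPdep[i [s [hi _ ->]]]|/allpairsPdep[u [v [_ _ ->]]]|].
- by constructor 1; exists i, s; move: hi; rewrite mem_iota.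
- by constructor 2; exists u.1, u.2, v.1, v.2.
move=> /allpairsPdep[[i j] [v [/allpairsPdep[j' [i' [hj hi [-> ->]]]] _ ->]]].
move: hi hj; rewrite !mem_iota /= !add0n => hi hj.
by constructor 3; exists i', j', v.1, v.2; split => //; [exact: ltn_trans hj|rewrite ltn_eqF].
Qed.

Section OctahedralGroup.
Variable R : realType.
Local Notation C := R[i].

Definition num_val (p : half_num) : R := (p.1%:~R + p.2%:~R * Num.sqrt 2) / 2.

Definition code_vec (c : quat_code) : 'rV[R]_4 :=
  let: (p0, p1, p2, p3) := c in row4 (num_val p0) (num_val p1) (num_val p2) (num_val p3).

Definition code_su2 (c : quat_code) : SU2 R := pt (code_vec c).

Lemma sqrt2_sqr : (Num.sqrt 2 : R) * Num.sqrt 2 = 2.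
Proof. by rewrite -expr2 sqr_sqrtr. Qed.

Lemma num_valD p q : num_val (num_add p q) = num_val p + num_val q.
Proof. by rewrite /num_val /= !rmorphD /=; field. Qed.

Lemma num_valN p : num_val (num_opp p) = - num_val p.
Proof. by rewrite /num_val /= !rmorphN /=; field. Qed.

Lemma num_val_mul2 p q : num_val (num_mul2 p q) = 2 * (num_val p * num_val q).
Proof.
rewrite /num_val /= !rmorphD !rmorphM /= -[(2%:~R : R)]/(2 : R).
have h := sqrt2_sqr; move: (Num.sqrt 2) h => r h.
transitivity ((p.1%:~R * q.1%:~R + (r * r) * (p.2%:~R * q.2%:~R) +
  (p.1%:~R * q.2%:~R + p.2%:~R * q.1%:~R) * r) / 2 : R); first by rewrite h.
by field.
Qed.

Lemma num_val_half p : num_even p -> 2 * num_val (num_half p) = num_val p.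
Proof.
case: p => a b /andP[/= /divzK ha /divzK hb].
rewrite /num_val /num_half /= -{2}ha -{2}hb !rmorphM /= -[(2%:~R : R)]/(2 : R); by field.
Qed.

Lemma quat_mul (p0 p1 p2 p3 q0 q1 q2 q3 : R) :
  quat (row4 p0 p1 p2 p3) *m quat (row4 q0 q1 q2 q3) =
  quat (row4 (p0 * q0 - p1 * q1 - p2 * q2 - p3 * q3) (p0 * q1 + p1 * q0 + p2 * q3 - p3 * q2)
    (p0 * q2 - p1 * q3 + p2 * q0 + p3 * q1) (p0 * q3 + p1 * q2 - p2 * q1 + p3 * q0)).
Proof.
rewrite !quat_row4 mx2_mul; apply: matrix2P; rewrite !mx2E; apply: complex_ext => /=; ring.
Qed.

Lemma code_vec_mul c c' : code_even (code_mul2 c c') ->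
  quat (code_vec c) *m quat (code_vec c') = quat (code_vec (code_mul c c')).
Proof.
have n2 (x y : R) : 2 * x = 2 * y -> x = y by move=> h; lra.
case: c c' => [[[p0 p1] p2] p3] [[[q0 q1] q2] q3]; rewrite /code_mul /code_even /code_map /=.
move=> /and4P[e0 e1 e2 e3]; rewrite quat_mul; 
move: (num_val_half e0) (num_val_half e1) (num_val_half e2) (num_val_half e3).
rewrite !num_valD !num_valN !num_val_mul2.
move: (num_val p0) (num_val p1) (num_val p2) (num_val p3) (num_val q0) (num_val q1)
  (num_val q2) (num_val q3) => x0 x1 x2 x3 y0 y1 y2 y3.
move: (num_val (num_half _)) (num_val (num_half _)) (num_val (num_half _)) (num_val (num_half _))
  => z0 z1 z2 z3 h0 h1 h2 h3.
have {h0}-> : z3 = x0 * y0 - x1 * y1 - x2 * y2 - x3 * y3 by apply: n2; rewrite h0; ring.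
have {h1}-> : z2 = x0 * y1 + x1 * y0 + x2 * y3 - x3 * y2 by apply: n2; rewrite h1; ring.
have {h2}-> : z1 = x0 * y2 - x1 * y3 + x2 * y0 + x3 * y1 by apply: n2; rewrite h2; ring.
by have {h3}-> : z0 = x0 * y3 + x1 * y2 - x2 * y1 + x3 * y0 by apply: n2; rewrite h3; ring.
Qed.

Lemma code_norm c : c \in octahedral_codes -> sqn (code_vec c) = 1.
Proof.
move=> /(allP octahedral_codes_norm) /eqP; case: c => [[[p0 p1] p2] p3] /= /(congr1 num_val).
rewrite !(num_valD, num_val_mul2) /sqn !mxE !inordK //=.
have -> : num_val (4, 0) = 2 by rewrite /num_val /= mul0r addr0 -[(4%:~R : R)]/(4 : R); field.
move: (num_val p0) (num_val p1) (num_val p2) (num_val p3) => x0 x1 x2 x3 h; lra.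
Qed.

Lemma code_su2E c : c \in octahedral_codes -> (code_su2 c : 'M[C]_2) = quat (code_vec c).
Proof. by move=> h; rewrite ptE // code_norm. Qed.

Lemma code_su2_mul c c' : c \in octahedral_codes -> c' \in octahedral_codes ->
  su2mul (code_su2 c) (code_su2 c') = code_su2 (code_mul c c').
Proof.
move=> h h'; apply: su2_inj; rewrite su2mulE !code_su2E //.
  apply: code_vec_mul.
  exact: (allP (allP octahedral_codes_even c h) c' h').
rewrite -(perm_mem (allP octahedral_codes_perm c h)); exact: map_f.
Qed.

Definition octahedral_seq : seq (SU2 R) := [seq code_su2 c | c <- octahedral_codes].

Lemma row4P (x y : 'rV[R]_4) : (forall k, (k < 4)%N -> x 0 (inord k) = y 0 (inord k)) -> x = y.
Proof. by move=> h; apply/rowP => i; rewrite -(inord_val i); apply: h. Qed.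

Lemma code_vec_of f k : (k < 4)%N -> code_vec (code_of f) 0 (inord k) = num_val (f k).
Proof. by case: k => [|[|[|[|]]]] // _; rewrite /= mxE inordK. Qed.

Lemma num_val0 : num_val (0, 0) = 0.
Proof. by rewrite /num_val /= mul0r addr0 mul0r. Qed.

Lemma signz_val s : ((signz s)%:~R : R) = (-1) ^+ s.
Proof. by case: s; rewrite /= ?expr1 ?rmorphN1. Qed.

Lemma unit_code_vec i s : (i < 4)%N ->
  code_vec (unit_code i s) = (-1) ^+ s *: delta_mx 0 (inord i).
Proof.
move=> i4; apply: row4P => k k4; rewrite code_vec_of // !mxE eqxx /= -val_eqE /= !inordK //.
case: eqP => _; last by rewrite num_val0 mulr0.
by rewrite /num_val /= rmorphM /= signz_val mul0r addr0 mulr1 mulrAC divff ?mul1r.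
Qed.

Lemma pair_code_vec i j s t : (i < 4)%N -> (j < 4)%N -> i != j ->
  code_vec (pair_code i j s t) = (Num.sqrt 2)^-1 *:
    ((-1) ^+ s *: delta_mx 0 (inord i) + (-1) ^+ t *: delta_mx 0 (inord j)).
Proof.
have r0 : (Num.sqrt 2 : R) != 0 by rewrite sqrtr_eq0 -ltNge.
have rV : (Num.sqrt 2 : R)^-1 = Num.sqrt 2 / 2.
  by apply: (mulfI r0); rewrite mulfV // mulrA sqrt2_sqr divff.
move=> i4 j4 ij; apply: row4P => k k4; rewrite code_vec_of // !mxE eqxx /= -!val_eqE /= !inordK //.
have [->|ki] := eqVneq k i.
  by rewrite (negbTE ij) mulr0 addr0 mulr1 rV /num_val /= signz_val add0r; ring.
have [_|_] := eqVneq k j; last by rewrite num_val0 !mulr0 addr0 mulr0.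
by rewrite mulr0 add0r mulr1 rV /num_val /= signz_val add0r; ring.
Qed.

Lemma half_code_entry s0 s1 s2 s3 (k : 'I_4) :
  code_vec (half_code s0 s1 s2 s3) 0 k = (-1) ^+ (nth false [:: s0; s1; s2; s3] k) / 2.
Proof.
have nv s : num_val (signz s, 0) = (-1) ^+ s / 2 by rewrite /num_val /= signz_val mul0r addr0.
rewrite -(inord_val k); case: k => [[|[|[|[|]]]] //= _]; by rewrite mxE inordK //= nv.
Qed.

Lemma sign_half (s : bool) : (-1) ^+ s / 2 = (if s then - (1 / 2) else 1 / 2) :> R.
Proof. by case: s => //; rewrite expr1 mulNr. Qed.

Lemma octahedral_quatP (x : 'rV[R]_4) : binary_octahedral_quat x <->
  exists2 c, c \in octahedral_codes & x = code_vec c.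
Proof.
split=> [[[i [s ->]]|h|[i [j [s [t [ij ->]]]]]]|[c /octahedral_codesP h ->]].
- exists (unit_code i s); first exact: unit_code_in.
  by rewrite unit_code_vec // inord_val.
- have hs k : exists s : bool, x 0 (inord k) = (-1) ^+ s / 2.
    by case: (h (inord k)) => ->; [exists false|exists true]; rewrite sign_half.
  have [s0 h0] := hs 0%N; have [s1 h1] := hs 1%N; have [s2 h2] := hs 2%N; have [s3 h3] := hs 3%N.
  exists (half_code s0 s1 s2 s3); first exact: half_code_in.
  apply: row4P => k k4; rewrite half_code_entry inordK //.
  by case: k k4 => [|[|[|[|]]]] //.
- exists (pair_code i j s t); first exact: pair_code_in.
  by rewrite pair_code_vec // !inord_val.
case: h => [[i [s [i4 ->]]]|[s0 [s1 [s2 [s3 ->]]]]|[i [j [s [t [i4 j4 ij ->]]]]]].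
- by constructor 1; exists (inord i), s; rewrite unit_code_vec.
- constructor 2 => k; rewrite half_code_entry sign_half; by case: nth; [right|left].
constructor 3; exists (inord i), (inord j), s, t; rewrite pair_code_vec //; split => //.
by rewrite -val_eqE /= !inordK.
Qed.

Lemma octahedral_enumerates : enumerates octahedral_seq (@binary_octahedral R).
Proof.
have GL g : binary_octahedral g <-> g \in octahedral_seq.
  split=> [[x /octahedral_quatP[c hc ->] e]|/mapP[c hc ->]].
    apply/mapP; exists c => //; apply: su2_inj; by rewrite code_su2E.
  by exists (code_vec c); [apply/octahedral_quatP; exists c|rewrite code_su2E].
split => // g /GL /mapP[c hc ->].
rewrite /octahedral_seq -map_comp.
have -> : [seq (su2mul (code_su2 c) \o code_su2) i | i <- octahedral_codes] =
    [seq code_su2 i | i <- [seq code_mul c i | i <- octahedral_codes]].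
  by rewrite -map_comp; apply/eq_in_map => c' hc' /=; exact: code_su2_mul.
by apply: perm_map; exact: (allP octahedral_codes_perm c hc).
Qed.

Lemma tr_code_su2 c : c \in octahedral_codes ->
  \tr (code_su2 c : 'M[C]_2) = (c.1.1.1.1%:~R + c.1.1.1.2%:~R * Num.sqrt 2 : R)%:C.
Proof.
move=> hc; rewrite code_su2E //; case: c hc => [[[p0 p1] p2] p3] _ /=.
rewrite quat_row4 /mxtrace !big_ord_recl big_ord0 addr0 !mxE /= /num_val.
by apply: complex_ext => /=; field.
Qed.

End OctahedralGroup.

(** * Multiplicities for the binary octahedral group *)

(** Traces are pairs read as [a + b sqrt 2], without the division by 2. In this reading [num_mul2]
    is the exact product, so the Chebyshev recursion stays among integers. *)
Fixpoint cheb_num2 (p : half_num) (n : nat) : half_num * half_num :=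
  if n is m.+1 then
    let: (u, w) := cheb_num2 p m in (w, num_add (num_mul2 p w) (num_opp u))
  else ((1, 0), p).
Definition cheb_num (p : half_num) (n : nat) : half_num := (cheb_num2 p n).1.

Definition num_sum (s : seq half_num) : half_num := foldr num_add (0, 0) s.

(** The sums of [U_k] over the 46 elements other than 1 and -1. They vanish for odd [k] because
    traces occur in opposite pairs of equal frequency; the entry at 23 is the default of [nth]. *)
Definition noncentral_sum (k : nat) : int :=
  nth 0 [:: 46; 0; -6; 0; -10; 0; -14; 0; 30; 0; -22; 0; 22; 0; -30; 0; 14; 0; 10; 0; 6; 0; -46] k.

Lemma noncentral_sumE : all (fun k =>
  num_sum [seq cheb_num p k | p <- noncentral_traces] == (noncentral_sum k, 0)) (iota 0 24).
Proof. by vm_compute. Qed.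

(** At the trace [2 cos theta] the value of [U_d] is [sin ((d + 1) theta) / sin theta], and the
    noncentral elements have orders 3, 4, 6 and 8, all dividing 24. Two consecutive values determine
    a recursion of order two. *)
Lemma cheb_num_period : all (fun p => (cheb_num p 24 == (1, 0)) && (cheb_num p 25 == p))
  noncentral_traces.
Proof. by vm_compute. Qed.

Section OctahedralRank.
Variable R : realType.
Local Notation C := R[i].

Definition trace_val (p : half_num) : C := (p.1%:~R + p.2%:~R * Num.sqrt 2 : R)%:C.

Lemma trace_valE (p : half_num) : trace_val p = (2 * num_val R p)%:C.
Proof. by rewrite /trace_val /num_val; congr (_%:C); field. Qed.

Lemma trace_valD p q : trace_val (num_add p q) = trace_val p + trace_val q.
Proof. by rewrite !trace_valE num_valD mulrDr rmorphD. Qed.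

Lemma trace_valN p : trace_val (num_opp p) = - trace_val p.
Proof. by rewrite !trace_valE num_valN mulrN rmorphN. Qed.

Lemma trace_valM p q : trace_val (num_mul2 p q) = trace_val p * trace_val q.
Proof. by rewrite !trace_valE num_val_mul2 -rmorphM; congr (_%:C); ring. Qed.

Lemma trace_val_int (z : int) : trace_val (z, 0) = z%:~R.
Proof. by rewrite /trace_val /= mul0r addr0 rmorph_int. Qed.

Lemma cheb_numE p n : trace_val (cheb_num p n) = chebU (trace_val p) n.
Proof.
suff : trace_val (cheb_num2 p n).1 = (cheb2 (trace_val p) n).1 /\
  trace_val (cheb_num2 p n).2 = (cheb2 (trace_val p) n).2 by case.
elim: n => [|n] /=; first by rewrite trace_val_int.
case: (cheb_num2 p n) (cheb2 _ n) => [u w] [u' w'] /= [h1 h2].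
by rewrite trace_valD trace_valM trace_valN h1 h2.
Qed.

Lemma chebU_period (T : C) (p : nat) : chebU T p = 1 -> chebU T p.+1 = T ->
  forall d, chebU T (d + p) = chebU T d.
Proof.
move=> h0 h1 d; suff [] : chebU T (d + p) = chebU T d /\ chebU T (d + p).+1 = chebU T d.+1 by [].
elim: d => [|d [IH1 IH2]]; first by rewrite add0n h0 h1.
by rewrite addSn; split => //; rewrite !chebU_SS IH1 IH2.
Qed.

Lemma chebU_2 d : chebU (2 : C) d = d.+1%:R.
Proof.
suff [] : chebU (2 : C) d = d.+1%:R /\ chebU (2 : C) d.+1 = d.+2%:R by [].
elim: d => [|d [IH1 IH2]] //; split => //; rewrite chebU_SS IH1 IH2.
by rewrite -[d.+3%:R]natr1 -[d.+2%:R]natr1; ring.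
Qed.

Lemma chebU_N2 d : chebU (- 2 : C) d = (if odd d then -1 else 1) * d.+1%:R.
Proof.
suff [] : chebU (- 2 : C) d = (if odd d then -1 else 1) * d.+1%:R /\
  chebU (- 2 : C) d.+1 = (if odd d.+1 then -1 else 1) * d.+2%:R by [].
elim: d => [|d [IH1 IH2]]; first by rewrite /chebU /= mulr1 mulN1r.
split => //; rewrite chebU_SS IH1 IH2 /=; case: (odd d) => /=;
  by rewrite -[d.+3%:R]natr1 -[d.+2%:R]natr1; ring.
Qed.

Lemma chebU_add24 p q k : p \in noncentral_traces ->
  chebU (trace_val p) (24 * q + k) = chebU (trace_val p) k.
Proof.
move=> /(allP cheb_num_period)/andP[/eqP e0 /eqP e1].
have per := @chebU_period (trace_val p) 24.
elim: q => [|q IH]; first by rewrite muln0.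
rewrite mulnS -addnA addnC per ?IH //.
  by rewrite -cheb_numE e0 trace_val_int.
by rewrite -cheb_numE e1.
Qed.

Lemma sum_chebU_noncentral q k : (k < 24)%N ->
  \sum_(p <- noncentral_traces) chebU (trace_val p) (24 * q + k) = (noncentral_sum k)%:~R.
Proof.
move=> k24; rewrite (eq_big_seq (fun p => trace_val (cheb_num p k))); last first.
  by move=> p hp; rewrite chebU_add24 // cheb_numE.
have := allP noncentral_sumE k; rewrite mem_iota => /(_ k24)/eqP/(congr1 trace_val).
rewrite trace_val_int => <-; elim: noncentral_traces => [|p s IH].
  by rewrite big_nil trace_val_int.
by rewrite big_cons /= trace_valD IH.
Qed.

Definition octahedral_rank (d : nat) : nat := \rank (invariant_projector (octahedral_seq R) d).

Lemma octahedral_rankE q k : (k < 24)%N ->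
  48 * (octahedral_rank (24 * q + k))%:R =
  (24 * q%:R + k%:R + 1) * (if odd k then 0 else 2) + (noncentral_sum k)%:~R :> R.
Proof.
move=> k24; apply: (complexI (R := R)).
rewrite rmorphM /= !rmorph_nat (rank_invariant_projector (octahedral_enumerates R)).
have sz : size (octahedral_seq R) = 48 by rewrite size_map.
rewrite sz mulrA mulfV ?pnatr_eq0 // mul1r big_map.
rewrite (eq_big_seq (fun c : quat_code => chebU (trace_val c.1.1.1) (24 * q + k))); last first.
  by move=> c hc; rewrite tr_code_su2.
rewrite -(big_map (fun c : quat_code => c.1.1.1) predT (fun p => chebU (trace_val p) (24 * q + k))).
rewrite (perm_big _ octahedral_codes_traces) big_cons big_cons.
rewrite sum_chebU_noncentral // !trace_val_int.
have -> : (2%:~R : C) = 2 by [].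
have -> : ((-2)%:~R : C) = - 2 by rewrite rmorphN.
have ok : odd (24 * q + k) = odd k by rewrite oddD oddM.
rewrite chebU_2 chebU_N2 ok rmorphD rmorphM /= rmorph_int rmorphD rmorphD rmorphM /= !rmorph_nat rmorph1.
rewrite addrA; congr (_ + _).
rewrite -natr1 natrD natrM; case: (odd k); rewrite ?rmorph0 ?rmorph_nat; ring.
Qed.

(** In degree [d = 24 Q + k] the eigenvalue is [d + 3/2] and its multiplicity [d + 2] times the rank
    [r]; each residue [k] is a separate polynomial identity in [Q]. *)
Lemma octahedral_poly_pos k (Q r : R) : (k < 24)%N ->
  48 * r = (24 * Q + k%:R + 1) * (if odd k then 0 else 2) + (noncentral_sum k)%:~R ->
  (24 * Q + k%:R + 2) * r = octahedral_poly k (3 / 2 + k%:R + 24 * Q).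
Proof.
move=> k24 h.
have -> : r = ((24 * Q + k%:R + 1) * (if odd k then 0 else 2) + (noncentral_sum k)%:~R) / 48.
  by rewrite -h; field.
move: k24 {h}; do 24! [case: k => [|k]; first by move=> _ /=; rewrite /noncentral_sum /= ?rmorphN /=; field].
by [].
Qed.

(** The eigenvalue [- (d + 1/2)] equals [3/2 + k - 24 (Q + 1)] exactly for [d = 24 Q + 22 - k],
    whence the reflected index; its multiplicity is [d] times the rank [r]. *)
Lemma octahedral_poly_neg k (Q r : R) : (k <= 22)%N ->
  48 * r = (24 * Q + (22 - k)%:R + 1) * (if odd (22 - k) then 0 else 2) +
    (noncentral_sum (22 - k))%:~R ->
  (24 * Q + (22 - k)%:R) * r = octahedral_poly k (3 / 2 + k%:R + 24 * - (Q + 1)).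
Proof.
move=> k22 h.
have -> : r = ((24 * Q + (22 - k)%:R + 1) * (if odd (22 - k) then 0 else 2) +
    (noncentral_sum (22 - k))%:~R) / 48.
  by rewrite -h; field.
move: k22 {h}; do 23! [case: k => [|k]; first by move=> _; rewrite ?subSS subn0 /noncentral_sum /= ?rmorphN /=; field].
by [].
Qed.

Lemma alpha_neq_small (x : R) : `|x| < 3 / 2 -> forall k, (alpha R k)%:C != x%:C.
Proof.
move=> hx k; rewrite (inj_eq (@complexI R)); apply/eqP => e; move: hx; rewrite -e.
have n0 := ler0n R k./2.
by rewrite /alpha /eigval; case: odd; rewrite ?normrN ger0_norm; lra.
Qed.

Lemma octahedral_multiplicity_pos q k : (k < 24)%N -> exists m : nat,
  dirac_multiplicity (@binary_octahedral R) (3 / 2 + k%:R + 24 * q%:R : R)%:C m /\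
  m%:R = octahedral_poly k (3 / 2 + k%:R + 24 * q%:R : R).
Proof.
move=> k24; exists ((24 * q + k).+2 * octahedral_rank (24 * q + k))%N; split.
  have := dirac_multiplicity_rank (octahedral_enumerates R) (pos := true) (d := (24 * q + k)%N) isT.
  by congr (dirac_multiplicity _ _%:C _); rewrite /eigval natrD natrM; ring.
rewrite -(octahedral_poly_pos k24 (octahedral_rankE q k24)) natrM.
by rewrite -[in LHS]addn2 natrD natrD natrM.
Qed.

Lemma octahedral_multiplicity_neg q k : (k <= 22)%N -> exists m : nat,
  dirac_multiplicity (@binary_octahedral R) (3 / 2 + k%:R + 24 * - (q%:R + 1) : R)%:C m /\
  m%:R = octahedral_poly k (3 / 2 + k%:R + 24 * - (q%:R + 1) : R).
Proof.
move=> k22; have k24 : (22 - k < 24)%N by apply: leq_ltn_trans (leq_subr _ _) _.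
pose d := (24 * q + (22 - k))%N; exists (d * octahedral_rank d)%N; split; last first.
  by rewrite -(octahedral_poly_neg k22 (octahedral_rankE q k24)) natrM natrD natrM.
have dE : d%:R = 24 * q%:R + 22 - k%:R :> R by rewrite natrD natrM natrB // addrA.
(* Degree 0 occurs for [k = 22] and [q = 0], where the argument is -1/2 and hence no eigenvalue. *)
have [d0|dp] := posnP d.
  rewrite d0 mul0n; apply: dirac_multiplicity0; apply: alpha_neq_small.
  have -> : 3 / 2 + k%:R + 24 * - (q%:R + 1) = - (1 / 2) :> R by move: dE; rewrite d0; lra.
  by rewrite normrN ger0_norm; lra.
have := dirac_multiplicity_rank (octahedral_enumerates R) (pos := false) (d := d) dp.
rewrite /= prednK //; congr (dirac_multiplicity _ _%:C _).
have e : (d.-1)%:R = d%:R - 1 :> R by rewrite -[in RHS](prednK dp) -natr1 addrK.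
by rewrite /eigval e dE; lra.
Qed.

(** The reflected index [22 - k] would be -1 here, so the degree borrows one period and becomes
    [24 q + 23] for the successor of [q]: it is odd, and -1 in the group leaves no invariant form.
    For [q = 0] the argument is 1/2, which is no eigenvalue. *)
Lemma octahedral_multiplicity_neg23 q : exists m : nat,
  dirac_multiplicity (@binary_octahedral R) (3 / 2 + 23%:R + 24 * - (q%:R + 1) : R)%:C m /\
  m%:R = 0 :> R.
Proof.
case: q => [|q].
  exists 0%N; split=> //; apply: dirac_multiplicity0; apply: alpha_neq_small.
  have -> : 3 / 2 + 23%:R + 24 * - (0%:R + 1) = 1 / 2 :> R by field.
  by rewrite ger0_norm; lra.
pose d := (24 * q + 23)%N; exists (d * octahedral_rank d)%N; split; last first.
  have r0 : (octahedral_rank d)%:R = 0 :> R.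
    have := octahedral_rankE q (isT : (23 < 24)%N); rewrite /= mulr0 addr0 => /eqP.
    by rewrite mulf_eq0 pnatr_eq0 /= => /eqP.
  by rewrite natrM r0 mulr0.
have dp : (0 < d)%N by rewrite /d addnS.
have dE : d%:R = 24 * q%:R + 23 :> R by rewrite natrD natrM.
have := dirac_multiplicity_rank (octahedral_enumerates R) (pos := false) (d := d) dp.
rewrite /= prednK //; congr (dirac_multiplicity _ _%:C _).
have e : (d.-1)%:R = d%:R - 1 :> R by rewrite -[in RHS](prednK dp) -natr1 addrK.
by rewrite /eigval e dE -[q.+1%:R]natr1; lra.
Qed.

End OctahedralRank.

Theorem proposition10p1 (R : realType) :
  (forall lambda : R[i], dirac_spectrum (@binary_octahedral R) lambda ->
     exists k : nat,
       lambda = (3 / 2 + k%:R : R)%:C \/ lambda = - (3 / 2 + k%:R : R)%:C) /\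
  (forall (k : nat) (t : int), (k <= 23)%N ->
     exists m : nat,
       dirac_multiplicity (@binary_octahedral R)
         (3 / 2 + k%:R + 24 * t%:~R : R)%:C m /\
       m%:R = octahedral_poly k (3 / 2 + k%:R + 24 * t%:~R : R)).
Proof.
split=> [lambda|k [q|q] k23]; first exact: dirac_spectrum_sub (octahedral_enumerates R) _.
  exact: octahedral_multiplicity_pos.
(* [Negz q] stands for [- (q + 1)], which is why the lemmas for negative [t] are stated with this
   shift. *)
have -> : (Negz q)%:~R = - (q%:R + 1) :> R by rewrite NegzE rmorphN natr1.
move: k23; rewrite leq_eqVlt => /orP[/eqP ->|]; last exact: octahedral_multiplicity_neg.
exact: octahedral_multiplicity_neg23.
Qed.
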